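(* Let $\rho\ge1$ be a real number, let $H$ be a complex Hilbert space and let $T\in\mathcal{B}(H)$ be such that $w_\rho(T)\le1$. Denote $$C=\frac{\rho^2+1+(\rho-1)\sqrt{5\rho^2+2\rho+1}}{2\rho^2}.$$ Then the open unit disc $\mathbb{D}$ is a complete $C$-$w_\rho$ set for $T$.
   Context: $\mathcal{B}(H)$ denotes the bounded linear operators on the complex Hilbert space $H$ and $\mathbb{D}=\{z\in\mathbb{C}:|z|<1\}$. Operator radii: for $\rho\ge1$, an operator $S\in\mathcal{B}(H)$ is in the class $\mathcal{C}_\rho$ if there exist a Hilbert space $\mathcal{H}\supset H$ and a unitary operator $U\in\mathcal{B}(\mathcal{H})$ with $S^n=\rho\,PU^nP^*$ for all $n=1,2,\dots$, where $P:\mathcal{H}\to H$ is the orthogonal projection onto $H$ (so $P^*$ is the inclusion). The operator $\rho$-radius is $w_\rho(A)=\inf\{\lambda>0:\lambda^{-1}A\in\mathcal{C}_\rho\}$. The spectral radius satisfies $r(A)\le w_\rho(A)$, so $w_\rho(T)\le1$ implies $\sigma(T)\subset\overline{\mathbb{D}}$. For $c\ge1$ and $T$ with $\sigma(T)\subset\overline{\mathbb{D}}$, the disc $\mathbb{D}$ is a complete $c$-$w_\rho$ set for $T$ if for all $n\ge1$ and all $n\times n$ matrices $F=(f_{ij})$ of rational functions with poles off $\overline{\mathbb{D}}$ one has $w_\rho(F(T))\le c\,\sup_{z\in\mathbb{D}}\|F(z)\|$, where $F(T)=(f_{ij}(T))$ acts on $H^{(n)}$, the $\ell_2$-sum of $n$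 copies of $H$, and $\|F(z)\|$ is the operator norm of the $n\times n$ matrix $F(z)$. *)

(* Defs.v *)
From HB Require Import structures.
From mathcomp Require Import all_boot all_order all_algebra complex.
From mathcomp Require Import all_classical all_reals all_analysis.
From mathcomp Require Import fraction generic_quotient sesquilinear.

Set Implicit Arguments.
Unset Strict Implicit.
Unset Printing Implicit Defensive.

Import Order.TTheory GRing.Theory Num.Theory.
Import numFieldNormedType.Exports.

Local Open Scope classical_set_scope.
Local Open Scope ring_scope.

HB.mixin Record NormedModule_hasDotp (R : realType) H
    & NormedModule R[i] H := {
  dotp : H -> H -> R[i];
  dotp_scalarl : forall y : H, scalar (fun x : H => dotp x y);
  dotp_conjC : forall x y : H, dotp x y = (dotp y x)^*;
  dotp_norm : forall x : H, dotp x x = `|x| ^+ 2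
}.

#[short(type="preHilbertType")]
HB.structure Definition PreHilbert (R : realType) :=
  {H of NormedModule R[i] H & NormedModule_hasDotp R H}.

#[short(type="hilbertType")]
HB.structure Definition Hilbert (R : realType) :=
  {H of CompleteNormedModule R[i] H & NormedModule_hasDotp R H}.

HB.factory Record Lmodule_hasDotp (R : realType) H & GRing.Lmodule R[i] H := {
  dotp : H -> H -> R[i];
  dotp_scalarl : forall y : H, scalar (fun x : H => dotp x y);
  dotp_conjC : forall x y : H, dotp x y = (dotp y x)^*;
  dotp_gt0 : forall x : H, x != 0 -> 0 < dotp x x
}.

HB.builders Context R H & Lmodule_hasDotp R H.

Local Lemma dotpP a x y z : dotp (a *: x + y) z = a * dotp x z + dotp y z.
Proof. exact: dotp_scalarl. Qed.

Local Lemma dotp0l y : dotp 0 y = 0.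
Proof. by have := dotpP (-1) 0 0 y; rewrite scaler0 addr0 mulN1r addNr. Qed.

Local Lemma dotpDl x y z : dotp (x + y) z = dotp x z + dotp y z.
Proof. by rewrite -[x]scale1r dotpP mul1r scale1r. Qed.

Local Lemma dotpZl a x y : dotp (a *: x) y = a * dotp x y.
Proof. by rewrite -[a *: x]addr0 dotpP dotp0l addr0. Qed.

Local Lemma dotpDr x y z : dotp x (y + z) = dotp x y + dotp x z.
Proof. by rewrite dotp_conjC dotpDl rmorphD/= -!dotp_conjC. Qed.

Local Lemma dotpZr a x y : dotp x (a *: y) = a^* * dotp x y.
Proof. by rewrite dotp_conjC dotpZl rmorphM/= -dotp_conjC. Qed.

Local Lemma dotpp_ge0 x : 0 <= dotp x x.
Proof.
by have [->|/dotp_gt0/ltW//] := eqVneq x 0; rewrite dotp0l.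
Qed.

Local Lemma dotp_CS x y : `|dotp x y| ^+ 2 <= dotp x x * dotp y y.
Proof.
have [->|y0] := eqVneq y 0.
  by rewrite dotp_conjC !dotp0l conjC0 normr0 expr0n mulr0.
have yy := dotp_gt0 y0.
have yyN0 : dotp y y != 0 by rewrite gt_eqF.
pose a := - (dotp x y / dotp y y).
have := dotpp_ge0 (x + a *: y).
rewrite dotpDl !dotpDr !dotpZl !dotpZr.
have -> : a * (a^* * dotp y y) = - (a * dotp y x).
  rewrite {2}/a rmorphN rmorphM/= fmorphV/= -!dotp_conjC.
  rewrite -[RHS]mulrN; congr (_ * _).
  by rewrite mulNr divfK.
rewrite [a * dotp y x + _]addrC addNr addr0 /a rmorphN rmorphM/= fmorphV/=.
rewrite -!dotp_conjC mulNr mulrAC [dotp y x]dotp_conjC.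
by rewrite [_^* * _]mulrC -normCK subr_ge0 ler_pdivrMr.
Qed.

Local Definition norm (x : H) : R[i] := sqrtC (dotp x x).

Local Lemma norm_ge0 x : 0 <= norm x.
Proof. by rewrite sqrtC_ge0 dotpp_ge0. Qed.

Local Lemma normE x : norm x ^+ 2 = dotp x x. Proof. exact: sqrtCK. Qed.

Local Lemma ler_normD x y : norm (x + y) <= norm x + norm y.
Proof.
have nxy : 0 <= norm x + norm y by rewrite addr_ge0 ?norm_ge0.
rewrite -(@ler_pXn2r _ 2) ?nnegrE ?norm_ge0// sqrrD !normE.
rewrite dotpDl !dotpDr addrA lerD2r -!addrA lerD2l.
rewrite [dotp y x]dotp_conjC.
have cs : `|dotp x y| <= norm x * norm y.
  rewrite -(@ler_pXn2r _ 2) ?nnegrE ?mulr_ge0 ?norm_ge0//.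
  by rewrite exprMn !normE dotp_CS.
have -> : dotp x y + (dotp x y)^* = 2 * 'Re (dotp x y).
  by rewrite ReE mulrCA divff ?mulr1// pnatr_eq0.
rewrite -[leRHS]mulr_natl ler_pM2l ?ltr0n//.
exact: le_trans (leif_Re_Creal _) cs.
Qed.

Local Lemma normrZ (a : R[i]) x : norm (a *: x) = `|a| * norm x.
Proof.
rewrite /norm dotpZl dotpZr mulrA -normCK sqrtCM ?nnegrE ?exprn_ge0//.
  by rewrite sqrCK.
exact: dotpp_ge0.
Qed.

Local Lemma normr0_eq0 x : norm x = 0 -> x = 0.
Proof.
move=> x0; apply/eqP/negPn/negP => /dotp_gt0.
by rewrite -normE x0 expr0n ltxx.
Qed.

HB.instance Definition _ :=
  Lmodule_isNormed.Build R[i] H ler_normD normrZ normr0_eq0.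

Local Lemma dotp_norm x : dotp x x = `|x| ^+ 2.
Proof. by rewrite -normE. Qed.

HB.instance Definition _ :=
  NormedModule_hasDotp.Build R H dotp_scalarl dotp_conjC dotp_norm.

HB.end.

Section dotp_form.
Variables (R : realType) (H : preHilbertType R).

Let dotp_bilinear :
  bilinear_for *%R (Num.conj \; *%R) (@dotp R H : H -> H -> R[i]).
Proof.
split=> [y|x a y z] /=; first exact: dotp_scalarl.
rewrite dotp_conjC dotp_scalarl rmorphD rmorphM/=.
by rewrite -!dotp_conjC.
Qed.

HB.instance Definition _ :=
  bilinear_isBilinear.Build _ _ _ _ _ _ (@dotp R H) dotp_bilinear.

Let dotp_hermitian (x y : H) : dotp x y = (-1) ^+ false * (dotp y x)^*.
Proof. by rewrite mul1r dotp_conjC. Qed.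

HB.instance Definition _ :=
  isHermitianSesquilinear.Build _ _ _ _ (@dotp R H) dotp_hermitian.

Let dotp_pos (x : H) : x != 0 -> 0 < dotp x x.
Proof. by move=> x0; rewrite dotp_norm exprn_gt0// normr_gt0. Qed.

HB.instance Definition _ := isDotProduct.Build _ _ (@dotp R H) dotp_pos.

End dotp_form.

(* H^(n), the l2-sum of n copies of H; the alias keeps its Hilbert structure
   apart from any other structure on finite functions. *)
Definition ell2_sum (R : realType) (H : hilbertType R) (n : nat) : Type :=
  {ffun 'I_n -> H}.

Section ell2_sum.
Variables (R : realType) (H : hilbertType R) (n : nat).

HB.instance Definition _ :=
  GRing.Lmodule.copy (ell2_sum H n) {ffun 'I_n -> H}.

Definition ell2_coord (i : 'I_n) (x : ell2_sum H n) : H :=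
  (x : {ffun 'I_n -> H}) i.

Definition ell2_dotp (x y : ell2_sum H n) : R[i] :=
  \sum_(i < n) dotp (ell2_coord i x) (ell2_coord i y).

Let ell2_dotp_scalarl y : scalar (ell2_dotp ^~ y).
Proof.
move=> a x z; rewrite /ell2_dotp mulr_sumr -big_split/=.
by apply: eq_bigr => i _; rewrite /ell2_coord !ffunE; exact: dotp_scalarl.
Qed.

Let ell2_dotp_conjC x y : ell2_dotp x y = (ell2_dotp y x)^*.
Proof.
by rewrite /ell2_dotp rmorph_sum/=; apply: eq_bigr => i _; rewrite dotp_conjC.
Qed.

Let ell2_dotp_ge0 x : 0 <= ell2_dotp x x.
Proof. by apply: sumr_ge0 => i _; rewrite dotp_norm exprn_ge0. Qed.

Let ell2_dotp_gt0 x : x != 0 -> 0 < ell2_dotp x x.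
Proof.
move=> x0; rewrite lt_def ell2_dotp_ge0 andbT; apply: contra x0.
rewrite psumr_eq0; last by move=> i _; rewrite dotp_norm exprn_ge0.
move=> /allP h; apply/eqP/ffunP => i; rewrite ffunE.
have := h i (mem_index_enum _).
by rewrite dotp_norm /= expf_eq0/= normr_eq0 => /eqP.
Qed.

HB.instance Definition _ := Lmodule_hasDotp.Build R (ell2_sum H n)
  ell2_dotp_scalarl ell2_dotp_conjC ell2_dotp_gt0.

Let ell2_normE (x : ell2_sum H n) :
  `|x| ^+ 2 = \sum_(i < n) `|ell2_coord i x| ^+ 2.
Proof.
by rewrite -dotp_norm; apply: eq_bigr => i _; rewrite dotp_norm.
Qed.

Let ell2_norm_coord (i : 'I_n) (x : ell2_sum H n) : `|ell2_coord i x| <= `|x|.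
Proof.
rewrite -(@ler_pXn2r _ 2) ?nnegrE// ell2_normE (bigD1 i)//= lerDl.
by apply: sumr_ge0 => j _; rewrite exprn_ge0.
Qed.

Let ell2_norm_sum (x : ell2_sum H n) :
  `|x| <= \sum_(i < n) `|ell2_coord i x|.
Proof.
rewrite -(@ler_pXn2r _ 2) ?nnegrE ?sumr_ge0// ell2_normE.
rewrite expr2 mulr_suml; apply: ler_sum => i _.
rewrite expr2 ler_wpM2l// (bigD1 i)//= lerDl.
by apply: sumr_ge0 => j _.
Qed.

Let ell2_complete (F : set_system (ell2_sum H n)) :
  ProperFilter F -> cauchy F -> cvg F.
Proof.
move=> FF /cauchy_ballP Fc.
have Fic i : cvg (ell2_coord i @ F).
  apply: cauchy_cvg; apply/cauchy_ballP => e e0.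
  rewrite near_map2; apply: filterS (Fc _ e0) => -[x y] /=.
  rewrite -!ball_normE /ball_/=; apply: le_lt_trans.
  have -> : ell2_coord i x - ell2_coord i y = ell2_coord i (x - y).
    by rewrite /ell2_coord !ffunE.
  exact: ell2_norm_coord.
pose l : ell2_sum H n := [ffun i => lim (ell2_coord i @ F)].
apply/cvg_ex; exists l; apply/cvgrPdist_lt => e e0.
have e'0 : 0 < e / n.+1%:R by rewrite divr_gt0 ?ltr0n.
have Fi : \forall x \near F, forall i : 'I_n,
    `|lim (ell2_coord i @ F) - ell2_coord i x| < e / n.+1%:R.
  apply: filter_forall => i.
  by have /cvgrPdist_lt := Fic i; exact.
near=> x.
apply: le_lt_trans (ell2_norm_sum _) _.
have : forall i : 'I_n, `|lim (ell2_coord i @ F) - ell2_coord i x| < e / n.+1%:R.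
  by near: x.
move=> xe.
apply: (@le_lt_trans _ _ (\sum_(i < n) e / n.+1%:R)).
  apply: ler_sum => i _; apply: le_trans (ltW (xe i)).
  by rewrite /ell2_coord !ffunE.
rewrite sumr_const card_ord -[ltLHS]mulr_natr mulrAC ltr_pdivrMr ?ltr0n//.
by rewrite ltr_pM2l// ltr_nat.
Unshelve. all: by end_near. Qed.

HB.instance Definition _ :=
  Uniform_isComplete.Build (ell2_sum H n) ell2_complete.

End ell2_sum.

Section operators.
Variable R : realType.

Definition bounded_op (H : hilbertType R) (A : H -> H) : Prop :=
  linear A /\ exists M : R, forall x, `|A x| <= M%:C%C * `|x|.

(* Inverses are taken in B(H). *)
Definition is_inverse_op (H : hilbertType R) (A B : H -> H) : Prop :=
  [/\ bounded_op B, cancel A B & cancel B A].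

(* The junk value 0 is only taken when A is not invertible in B(H). *)
Definition inv_op (H : hilbertType R) (A : H -> H) : H -> H :=
  xget (fun=> 0) [set B | is_inverse_op A B].

Definition spectrum (H : hilbertType R) (A : H -> H) : set R[i] :=
  [set z | ~ exists B, is_inverse_op (fun x => A x - z *: x) B].

Definition adjoint_op (H K : hilbertType R) (A : H -> K) (B : K -> H) : Prop :=
  forall x y, dotp (A x) y = dotp x (B y).

Definition unitary_op (K : hilbertType R) (U : K -> K) : Prop :=
  exists W, [/\ adjoint_op U W, cancel U W & cancel W U].

(* The inclusion of H in K is an isometric embedding V, so that the orthogonal
   projection of K onto H is P = V^*.  The case n = 1 forces S to be linear and
   bounded. *)
Definition rho_class (rho : R) (H : hilbertType R) (S : H -> H) : Prop :=
  exists (K : hilbertType R) (V : {linear H -> K}) (P : {linear K -> H})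
      (U : {linear K -> K}),
    [/\ forall x y, dotp (V x) (V y) = dotp x y,
        adjoint_op V P,
        unitary_op U &
        forall n x, (0 < n)%N ->
          iter n S x = rho%:C%C *: P (iter n U (V x))].

(* The infimum is taken in the extended reals: it is +oo on the empty set. *)
Definition rho_radius (rho : R) (H : hilbertType R) (A : H -> H) : \bar R :=
  ereal_inf [set l%:E | l in
    [set l : R | 0 < l /\ rho_class rho (fun x => l%:C%C^-1 *: A x)]].

Definition poly_op (p : {poly R[i]}) (H : hilbertType R) (T : H -> H) (x : H)
    : H :=
  \sum_(i < size p) p`_i *: iter i T x.

End operators.

Section rational_functions.
Variable F : fieldType.
Implicit Types f : {fraction {poly F}}.

Definition ratfun_gcd f : {poly F} := gcdp (repr f).1 (repr f).2.

(* Numerator and denominator in lowest terms, so that the poles of f are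
   exactly the roots of ratfun_den f. *)
Definition ratfun_num f : {poly F} := (repr f).1 %/ ratfun_gcd f.
Definition ratfun_den f : {poly F} := (repr f).2 %/ ratfun_gcd f.

Definition ratfun_pole f (z : F) : bool := root (ratfun_den f) z.

Definition ratfun_eval f (z : F) : F :=
  (ratfun_num f).[z] / (ratfun_den f).[z].

Lemma ratfun_gcd_neq0 f : ratfun_gcd f != 0.
Proof. by rewrite gcdp_eq0 negb_and denom_ratioP orbT. Qed.

Lemma ratfun_den_neq0 f : ratfun_den f != 0.
Proof.
apply/negP => /eqP d0; have := denom_ratioP (repr f).
by rewrite -(divpK (dvdp_gcdr (repr f).1 (repr f).2)) -/(ratfun_gcd f)
  -/(ratfun_den f) d0 mul0r eqxx.
Qed.

Lemma coprimep_ratfun f : coprimep (ratfun_num f) (ratfun_den f).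
Proof. by rewrite coprimep_div_gcd// denom_ratioP orbT. Qed.

Lemma ratfun_numdenE f :
  f = FracField.tofrac (ratfun_num f) / FracField.tofrac (ratfun_den f).
Proof.
have fE : f * FracField.tofrac (repr f).2 = FracField.tofrac (repr f).1.
  rewrite -{1}[f]reprK; move: (repr f) => r; unlock FracField.tofrac.
  rewrite -[LHS]FracField.pi_mul; apply/eqmodP.
  rewrite /= FracField.equivfE /FracField.mulf.
  by rewrite !numden_Ratio ?mulf_neq0 ?oner_eq0 ?denom_ratioP// !mulr1 mulrC.
have tofracN0 (p : {poly F}) : p != 0 -> FracField.tofrac p != 0 by rewrite tofrac_eq0.
apply: (mulIf (tofracN0 _ (ratfun_den_neq0 f))).
rewrite divfK ?tofracN0 ?ratfun_den_neq0//.
apply: (mulIf (tofracN0 _ (ratfun_gcd_neq0 f))).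
by rewrite -mulrA -!tofracM !divpK ?dvdp_gcdl ?dvdp_gcdr.
Qed.

End rational_functions.

Section complete_sets.
Variable R : realType.

Definition open_disc : set R[i] := [set z | `|z| < 1].
Definition closed_disc : set R[i] := [set z | `|z| <= 1].

Definition ratfun_op (f : {fraction {poly R[i]}}) (H : hilbertType R)
    (T : H -> H) : H -> H :=
  poly_op (ratfun_num f) T \o inv_op (poly_op (ratfun_den f) T).

Definition ratmx_eval n (F : 'M[{fraction {poly R[i]}}]_n) (z : R[i])
    : 'M[R[i]]_n :=
  \matrix_(i, j) ratfun_eval (F i j) z.

Definition ratmx_op n (F : 'M[{fraction {poly R[i]}}]_n) (H : hilbertType R)
    (T : H -> H) (x : ell2_sum H n) : ell2_sum H n :=
  [ffun i => \sum_(j < n) ratfun_op (F i j) T (ell2_coord j x)].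

Definition ell2_norm n (v : 'cV[R[i]]_n) : R :=
  Num.sqrt (\sum_(i < n) complex.Re `|v i 0| ^+ 2).

Definition mx_opnorm n (A : 'M[R[i]]_n) : \bar R :=
  ereal_sup [set (ell2_norm (A *m v))%:E | v in [set v | ell2_norm v <= 1]].

(* The notion is only defined for c >= 1 and for T with spectrum in the closed
   disc; the first two conditions record this. *)
Definition complete_rho_disc (c rho : R) (H : hilbertType R) (T : H -> H)
    : Prop :=
  [/\ 1 <= c,
      spectrum T `<=` closed_disc &
      forall n (F : 'M[{fraction {poly R[i]}}]_n), (0 < n)%N ->
        (forall i j z, closed_disc z -> ~~ ratfun_pole (F i j) z) ->
        (rho_radius rho (ratmx_op F T) <=
          c%:E * ereal_sup [set mx_opnorm (ratmx_eval F z) | z in open_disc])%E].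

End complete_sets.

(* Main.v *)
(* T is similar to a contraction, with a similarity of condition number rho
   (Okubo-Ando): there is a positive form b with rho^-2 |x|^2 <= b(x) <= |x|^2
   that T contracts, up to a factor l > 1 which may be taken arbitrarily close
   to 1.  If U on K is a unitary rho-dilation of T, j : H -> K is the projection
   onto the span of the U^n H, n >= 1, and X = j^* j, then b is an explicit
   rational function of X.
   A matrix F(T) of norm bound |F| <= 1 then contracts b coordinatewise, by von
   Neumann's inequality, which follows from Parseval's identity on Z/N applied
   to the orbit of a vector under the isometric dilation of T for b.
   Finally an operator S that contracts b satisfies w_rho(S) <= C.  With h_n a
   finite sequence, u_n = h_n + C^-1 S u_{n+1} and g_n = S u_{n+1}, the Toeplitz
   form of a rho-dilation of S / C is the sum over n of
     |u_n|^2 - 2 (1 - 1/rho) Re <g_n, u_n> / C + (1 - 2/rho) |g_n|^2 / C^2,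
   each term is at least (b(u_n) - b(g_n)) / C since
   C^2 - (1 + rho^-2) C = 1 - 2 / rho, and the sum of these bounds telescopes.
   Positivity of the Toeplitz form gives the dilation, as the bilateral shift on
   the Hilbert space completion of the finite sequences. *)
From HB Require Import structures.
Require Import Defs.
From mathcomp Require Import all_boot all_order all_algebra complex.
From mathcomp Require Import all_classical all_reals all_analysis.
From mathcomp Require Import fraction sesquilinear spectral.
From mathcomp Require Import cyclic separable cyclotomic.
From mathcomp Require Import ring lra zify.

Set Implicit Arguments.
Unset Strict Implicit.
Unset Printing Implicit Defensive.

Import Order.TTheory GRing.Theory Num.Theory.
Import numFieldNormedType.Exports.
Local Open Scope classical_set_scope.
Local Open Scope ring_scope.

(** The infimum in [rho_radius] is not known to be attained, so a form [b] is available for each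
    [l > 1] and no limit of these forms is taken. Every estimate carries slack, and the order of
    choices matters: the precision [e] fixes a length [N'], which fixes [l], and only then is [b]
    obtained. The bounds between [b] and the norm do not depend on [l]; hence T is power bounded by
    rho. Rational entries are reduced to polynomials: a common multiple of the denominators is
    [1 - r] with [r] of small coefficient sum, so that r(T) is small. Such identities also give the
    inverses of the denominators and the location of the spectrum. No spectral theorem on H is used.
    A polynomial in X, where 0 <= X <= 1, is shown positive by writing it with nonnegative
    coefficients in the x^m (1 - x)^n, up to square factors. With t = 1/rho, C is the larger root of
    C^2 - (1 + t^2) C = 1 - 2 t, of discriminant (rho - 1)^2 (5 rho^2 + 2 rho + 1) / rho^4.
    Rewritten as (C^2 - C t^2) (C^2 - C) = C^2 (1 - t)^2, the equation makes two square roots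
    multiply to C (1 - t), the mixed coefficient of the quadratic form to be bounded. *)

Section real_part.
Variable R : realType.
Implicit Types (x y z : R[i]) (r : R).

Local Notation re := (@complex.Re R).

Lemma reD x y : re (x + y) = re x + re y. Proof. by case: x; case: y. Qed.
Lemma reN x : re (- x) = - re x. Proof. by case: x. Qed.
Lemma reB x y : re (x - y) = re x - re y. Proof. by rewrite reD reN. Qed.
Lemma re0 : re 0 = 0. Proof. by []. Qed.
Lemma re_sum (I : Type) (s : seq I) (P : pred I) (f : I -> R[i]) :
  re (\sum_(i <- s | P i) f i) = \sum_(i <- s | P i) re (f i).
Proof. exact: (big_morph re reD re0). Qed.
Lemma reZ r x : re (r%:C%C * x) = r * re x.
Proof. by case: x => a b /=; rewrite mul0r subr0. Qed.
Lemma re_conj x : re x^* = re x. Proof. by case: x. Qed.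
Lemma conj_realM r x : (r%:C%C * x)^* = r%:C%C * x^*.
Proof.
by case: x => a b; apply/eqP; rewrite eq_complex/=; apply/andP; split; apply/eqP;
  ring.
Qed.
Lemma re_ge0 x : 0 <= x -> 0 <= re x.
Proof. by rewrite lecE/= => /andP[]. Qed.
Lemma ge0_reE x : 0 <= x -> (re x)%:C%C = x.
Proof. by case: x => a b; rewrite lecE/= => /andP[/eqP -> _]. Qed.
Definition cabs x : R := re `|x|.
Lemma cabsE x : `|x| = (cabs x)%:C%C. Proof. by rewrite ge0_reE. Qed.
Lemma cabs_ge0 x : 0 <= cabs x. Proof. exact: re_ge0. Qed.
Lemma cabsM x y : cabs (x * y) = cabs x * cabs y.
Proof. by apply: (@complexI R); rewrite rmorphM/= -!cabsE normrM. Qed.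
Lemma cabsD x y : cabs (x + y) <= cabs x + cabs y.
Proof. by rewrite -lecR rmorphD/= -!cabsE ler_normD. Qed.
Lemma cabsN x : cabs (- x) = cabs x. Proof. by rewrite /cabs normrN. Qed.
Lemma cabsC x : cabs x^* = cabs x. Proof. by rewrite /cabs norm_conjC. Qed.
Lemma cabs0 : cabs 0 = 0. Proof. by rewrite /cabs normr0. Qed.
Lemma cabs1 : cabs 1 = 1. Proof. by rewrite /cabs normr1. Qed.
Lemma cabs_eq0 x : (cabs x == 0) = (x == 0).
Proof. by rewrite -(inj_eq (@complexI R)) -cabsE normr_eq0. Qed.
Lemma cabsX x n : cabs (x ^+ n) = cabs x ^+ n.
Proof. by elim: n => [|n IH]; rewrite ?expr0 ?cabs1// !exprS cabsM IH. Qed.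
Lemma cabsV x : cabs x^-1 = (cabs x)^-1.
Proof. by apply: (@complexI R); rewrite fmorphV/= -!cabsE normfV. Qed.
Lemma cabs_real r : 0 <= r -> cabs r%:C%C = r.
Proof. by move=> r0; rewrite /cabs ger0_norm// lecR. Qed.
Lemma cabs_sq x : x * x^* = ((cabs x) ^+ 2)%:C%C.
Proof. by rewrite -normCK cabsE rmorphXn. Qed.
Lemma re_le_cabs x : re x <= cabs x.
Proof.
rewrite -lecR -cabsE; apply: le_trans (normc_ge_Re x).
by rewrite lecR ler_norm.
Qed.
Lemma cabs_sum (I : Type) (s : seq I) (P : pred I) (f : I -> R[i]) :
  cabs (\sum_(i <- s | P i) f i) <= \sum_(i <- s | P i) cabs (f i).
Proof.
elim/big_ind2: _ => [|x a y b xa yb|//]; first by rewrite cabs0.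
by apply: le_trans (cabsD _ _) _; rewrite lerD.
Qed.
Lemma cabs_small0 x : (forall e : R, 0 < e -> cabs x <= e) -> x = 0.
Proof.
move=> h; apply/eqP; rewrite -cabs_eq0 eq_le cabs_ge0 andbT.
by apply/ler_addgt0Pr => e e0; rewrite add0r h.
Qed.
End real_part.

Local Notation re := (@complex.Re _).

(** * Semi-inner products and completion *)

(* No vector space axioms are required of the carrier: formal combinations with
   concatenation as addition are an instance. *)
Record semi_ip (R : realType) (E : Type) := SemiIp {
  ip_add : E -> E -> E;
  ip_scale : R[i] -> E -> E;
  ip_zero : E;
  ip_form : E -> E -> R[i];
  ip_form0l : forall y, ip_form ip_zero y = 0;
  ip_formDl : forall x y z, ip_form (ip_add x y) z = ip_form x z + ip_form y z;
  ip_formZl : forall a x z, ip_form (ip_scale a x) z = a * ip_form x z;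
  ip_formC : forall x y, ip_form x y = (ip_form y x)^*;
  ip_form_ge0 : forall x, 0 <= ip_form x x }.

Section semi_ip_theory.
Variables (R : realType) (E : Type) (B : semi_ip R E).
Notation "x +' y" := (ip_add B x y) (at level 50, left associativity).
Notation "a *' x" := (ip_scale B a x) (at level 40).
Notation b := (ip_form B).
Implicit Types (x y z : E) (a : R[i]).

Definition ip_sq x : R := re (b x x).
Definition ip_sub x y := x +' ((-1) *' y).

Lemma ip_sqE x : b x x = (ip_sq x)%:C%C.
Proof. by rewrite ge0_reE// ip_form_ge0. Qed.
Lemma ip_sq_ge0 x : 0 <= ip_sq x.
Proof. by apply: re_ge0; exact: ip_form_ge0. Qed.
Lemma ip_formDr x y z : b x (y +' z) = b x y + b x z.
Proof. by rewrite ip_formC ip_formDl rmorphD/= -!ip_formC. Qed.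
Lemma ip_formZr a x y : b x (a *' y) = a^* * b x y.
Proof. by rewrite ip_formC ip_formZl rmorphM/= -ip_formC. Qed.
Lemma ip_formBl x y z : b (ip_sub x y) z = b x z - b y z.
Proof. by rewrite ip_formDl ip_formZl mulN1r. Qed.
Lemma ip_formBr x y z : b x (ip_sub y z) = b x y - b x z.
Proof. by rewrite ip_formC ip_formBl rmorphB/= -!ip_formC. Qed.
Lemma re_formC x y : re (b x y) = re (b y x).
Proof. by rewrite ip_formC re_conj. Qed.
Lemma ip_sqD x y : ip_sq (x +' y) = ip_sq x + ip_sq y + 2 * re (b x y).
Proof.
rewrite /ip_sq ip_formDl !ip_formDr !reD [re (b y x)]re_formC; lra.
Qed.
Lemma ip_sqZ a x : ip_sq (a *' x) = cabs a ^+ 2 * ip_sq x.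
Proof. by rewrite /ip_sq ip_formZl ip_formZr mulrA cabs_sq reZ. Qed.
Lemma ip_sqB x y : ip_sq (ip_sub x y) = ip_sq x + ip_sq y - 2 * re (b x y).
Proof.
by rewrite ip_sqD ip_sqZ cabsN cabs1 ip_formZr rmorphN rmorph1 mulN1r reN; lra.
Qed.

Lemma ip_CS x y : cabs (b x y) ^+ 2 <= ip_sq x * ip_sq y.
Proof.
set c := b x y.
have key (s : R) : 0 <= ip_sq x - 2 * s * cabs c ^+ 2 + s ^+ 2 * cabs c ^+ 2 *
  ip_sq y.
  have := ip_sq_ge0 (ip_sub x ((s%:C%C * c) *' y)).
  rewrite ip_sqB ip_sqZ ip_formZr -/c rmorphM/= cabsM.
  rewrite -mulrA [c^* * _]mulrC cabs_sq.
  have -> : (s%:C%C)^* = s%:C%C :> R[i] by rewrite conj_Creal// complex_real.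
  rewrite -rmorphM/= exprMn.
  have -> : cabs s%:C%C ^+ 2 = s ^+ 2.
    apply: (@complexI R); rewrite -cabs_sq.
    have -> : (s%:C%C)^* = s%:C%C :> R[i] by rewrite conj_Creal// complex_real.
    by rewrite -rmorphM.
  by move=> h; apply: le_trans h _; lra.
have c0 := sqr_ge0 (cabs c).
(* For a null [y] the bound [key] is affine in [s], so a large [s] refutes a nonzero [c]. *)
have [y0|y0] := eqVneq (ip_sq y) 0.
  rewrite y0 mulr0 leNgt; apply/negP => cp.
  have := key ((ip_sq x + 1) / cabs c ^+ 2).
  rewrite y0 mulr0 addr0 -mulrA divfK ?gt_eqF//.
  have := ip_sq_ge0 x; lra.
have yp : 0 < ip_sq y by rewrite lt_def y0 ip_sq_ge0.
have := key ((ip_sq y)^-1).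
have -> : (ip_sq y)^-1 ^+ 2 * cabs c ^+ 2 * ip_sq y = (ip_sq y)^-1 * cabs c ^+ 2.
  by rewrite expr2; field; rewrite y0.
move=> h; rewrite -ler_pdivrMr//.
by rewrite [_ / _]mulrC; lra.
Qed.

Lemma ip_sqD_le x y : ip_sq (x +' y) <= 2 * ip_sq x + 2 * ip_sq y.
Proof.
have := ip_sq_ge0 (ip_sub x y); rewrite ip_sqB ip_sqD; lra.
Qed.
End semi_ip_theory.

(** * Limits of complex sequences with real tolerances *)

Section complex_limits.
Variable R : realType.
Implicit Types (c d : nat -> R[i]) (l m : R[i]).

Definition clim c l := forall e : R, 0 < e ->
  exists n, forall i, (n <= i)%N -> cabs (c i - l) < e.

Lemma clim_unique c l m : clim c l -> clim c m -> l = m.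
Proof.
move=> cl cm; apply/eqP; rewrite -subr_eq0; apply/eqP; apply: cabs_small0 => e e0.
have e20 : 0 < e / 2 by lra.
have [i il] := cl _ e20; have [j jm] := cm _ e20.
have := il _ (leq_maxl i j); have := jm _ (leq_maxr i j).
set k := maxn i j => h1 h2.
have -> : l - m = (c k - m) - (c k - l) by ring.
have := cabsD (c k - m) (- (c k - l)); rewrite cabsN; lra.
Qed.

Lemma climD c d l m : clim c l -> clim d m -> clim (fun n => c n + d n) (l + m).
Proof.
move=> cl dm e e0.
have e20 : 0 < e / 2 by lra.
have [i il] := cl _ e20; have [j jm] := dm _ e20.
exists (maxn i j) => k; rewrite geq_max => /andP[ik jk].
have := il _ ik; have := jm _ jk => h1 h2.
have -> : c k + d k - (l + m) = (c k - l) + (d k - m) by ring.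
have := cabsD (c k - l) (d k - m); lra.
Qed.

Lemma climZ a c l : clim c l -> clim (fun n => a * c n) (a * l).
Proof.
move=> cl e e0.
have p : 0 < cabs a + 1 by have := cabs_ge0 a; lra.
have [i il] := cl _ (divr_gt0 e0 p).
exists i => k /il h; rewrite -mulrBr cabsM.
rewrite ltr_pdivlMr// in h.
have := cabs_ge0 (c k - l); nra.
Qed.

Lemma climC c l : clim c l -> clim (fun n => (c n)^*) l^*.
Proof.
by move=> cl e /cl [i il]; exists i => k /il; rewrite -rmorphB/= cabsC.
Qed.

Lemma clim_cst l : clim (fun=> l) l.
Proof. by move=> e e0; exists 0%N => i _; rewrite subrr cabs0. Qed.

Lemma clim_ext c d l : (forall n, c n = d n) -> clim c l -> clim d l.
Proof. by move=> cd cl e /cl [i il]; exists i => k /il; rewrite cd. Qed.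

Lemma clim_le (M : R) c l n : clim c l ->
  (forall i, (n <= i)%N -> cabs (c i) <= M) -> cabs l <= M.
Proof.
move=> cl cM; apply/ler_addgt0Pr => e /cl [i il].
have h1 := il _ (leq_maxl i n); have h2 := cM _ (leq_maxr i n).
have := cabsD (c (maxn i n)) (- (c (maxn i n) - l)).
rewrite cabsN opprB addrC subrK; lra.
Qed.

Lemma clim_ge0 c l : (forall i, 0 <= c i) -> clim c l -> 0 <= l.
Proof.
move=> c0 cl.
have lr : l^* = l.
  apply: (clim_unique (climC cl)); apply: clim_ext cl => n.
  by rewrite (@conj_Creal _ (c n))// ger0_real.
have /RRe_real <- : l \is Num.real by rewrite CrealE lr.
rewrite lecR; apply/ler_addgt0Pr => e /cl [i /(_ i (leqnn i))].
have := re_le_cabs (c i - l); rewrite reB; have := re_ge0 (c0 i); lra.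
Qed.

Lemma clim_add_null c d l : clim c l -> clim (fun n => d n - c n) 0 -> clim d l.
Proof.
move=> cl dc; rewrite -[l]addr0; apply: clim_ext (climD cl dc) => n /=; ring.
Qed.

Let real_cauchy (u : nat -> R) :
  (forall e : R, 0 < e -> exists n, forall i j, (n <= i)%N -> (n <= j)%N ->
    `|u i - u j| < e) -> exists l : R, forall e : R, 0 < e ->
    exists n, forall i, (n <= i)%N -> `|u i - l| < e.
Proof.
move=> uc.
have /cvg_ex [l /cvgrPdist_lt ul] : cvg (u @ \oo).
  apply: cauchy_cvg; apply/cauchy_ballP => e e0.
  have [n un] := uc _ e0; rewrite near_map2.
  exists ([set i | (n <= i)%N], [set i | (n <= i)%N]); first by split; exists n.
  by move=> [i j] [/= ni nj]; rewrite -ball_normE/=; exact: un.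
exists l => e /ul [n _ un]; exists n => i ni.
by rewrite distrC; exact: un.
Qed.

Lemma clim_cauchy c :
  (forall e : R, 0 < e -> exists n, forall i j, (n <= i)%N -> (n <= j)%N ->
    cabs (c i - c j) < e) -> exists l, clim c l.
Proof.
move=> cc.
have h (f : R[i] -> R) (fl : forall x y, `|f x - f y| <= cabs (x - y)) :
    exists l : R, forall e : R, 0 < e ->
    exists n, forall i, (n <= i)%N -> `|f (c i) - l| < e.
  apply: real_cauchy => e /cc [n nc]; exists n => i j ni nj.
  exact: le_lt_trans (fl _ _) (nc _ _ ni nj).
have [|a ha] := h (@complex.Re R).
  move=> x y; rewrite -reB -lecR -cabsE; exact: normc_ge_Re.
have [|b hb] := h (@complex.Im R).
  move=> x y; have -> : complex.Im x - complex.Im y = complex.Im (x - y).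
    by case: x; case: y.
  rewrite -lecR -cabsE; have := normc_ge_Re ((x - y) * 'i%C).
  by rewrite ReiNIm !normrN normrM [`|'i%C|]normc_def/= expr0n/= expr1n add0r
    sqrtr1 mulr1.
exists (a +i* b)%C => e e0; have e20 : 0 < e / 2 by lra.
have [i hi] := ha _ e20; have [j hj] := hb _ e20.
exists (maxn i j) => k; rewrite geq_max => /andP[/hi ik /hj jk].
set z := c k - _.
have zE : z = (complex.Re (c k) - a)%:C%C + 'i%C * (complex.Im (c k) - b)%:C%C.
  rewrite /z; case: (c k) => x y; apply/eqP; rewrite eq_complex/=.
  by apply/andP; split; apply/eqP; ring.
rewrite zE; apply: le_lt_trans (cabsD _ _) _; rewrite cabsM.
have -> : cabs ('i%C : R[i]) = 1.
  by rewrite /cabs [`|'i%C|]normc_def/= expr0n/= expr1n add0r sqrtr1.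
have cr (r : R) : cabs r%:C%C = `|r|.
  by rewrite /cabs normc_def/= expr0n/= addr0 sqrtr_sqr.
rewrite !cr; lra.
Qed.
End complex_limits.

Section completion.
Variables (R : realType) (E : Type) (B : semi_ip R E).
Notation b := (ip_form B).
Notation q := (ip_sq B).
Notation "x -' y" := (ip_sub B x y) (at level 50, left associativity).
Implicit Types (u v w : nat -> E) (x y z : E).

Definition ip_cauchy u := forall e : R, 0 < e ->
  exists n, forall i j, (n <= i)%N -> (n <= j)%N -> q (u i -' u j) < e.

(** [f] is the functional represented by the Cauchy sequence [u]. Sequences that differ by a null
    sequence represent the same [f], so the completion can be a space of functionals and needs no
    quotient. *)
Definition ip_limit u (f : E -> R[i]) :=
  ip_cauchy u /\ forall y, clim (fun n => b (u n) y) (f y).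

Lemma ip_cauchy_bound u : ip_cauchy u ->
  exists M : R, 0 < M /\ exists n, forall i, (n <= i)%N -> q (u i) <= M.
Proof.
move=> /(_ 1 ltr01) [n un]; exists (2 * q (u n) + 3).
split; first by have := ip_sq_ge0 B (u n); lra.
exists n => i ni; have := un _ _ ni (leqnn n); rewrite ip_sqB => h.
(* Positivity at [u i - 2 u n] bounds the mixed term from above, the Cauchy property bounds it from
   below. *)
have := ip_sq_ge0 B (ip_add B (u i) (ip_scale B (-2) (u n))).
rewrite ip_sqD ip_sqZ ip_formZr.
have -> : (-2 : R[i])^* = (-2)%:C%C by rewrite conj_Creal ?rpredN ?realn//
  rmorphN rmorph_nat.
rewrite reZ; have -> : cabs (-2 : R[i]) = 2.
  by rewrite cabsN /cabs normr_nat.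
by have := ip_sq_ge0 B (u n); lra.
Qed.

Lemma form_null u v : ip_cauchy v ->
  (forall e : R, 0 < e -> exists n, forall i, (n <= i)%N -> q (u i) < e) ->
  clim (fun n => b (u n) (v n)) 0.
Proof.
move=> /ip_cauchy_bound [M [M0 [n vM]]] un e e0.
have [|m um] := un (e ^+ 2 / M); first by rewrite divr_gt0// exprn_gt0.
exists (maxn n m) => i; rewrite geq_max subr0 => /andP[/vM ni /um mi].
rewrite -(ltr_pXn2r (_ : 0 < 2)%N) ?nnegrE ?cabs_ge0 ?(ltW e0)//.
apply: le_lt_trans (ip_CS B _ _) _.
rewrite ltr_pdivlMr// in mi.
by have := ip_sq_ge0 B (u i); nra.
Qed.

(** Split q(w_i) = Re b(w_i, w_m) + Re b(w_i, w_i - w_m) with [m] fixed: the first term is small by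
    weak nullity, the second by the Cauchy property and boundedness. *)
Lemma ip_cauchy_null w : ip_cauchy w -> (forall y, clim (fun n => b (w n) y) 0) ->
  forall e : R, 0 < e -> exists n, forall i, (n <= i)%N -> q (w i) < e.
Proof.
move=> wc w0 e e0; have [M [M0 [n wM]]] := ip_cauchy_bound wc.
have e2 : 0 < e / 2 by lra.
have [|m wm] := wc ((e / 2) ^+ 2 / M); first by rewrite divr_gt0// exprn_gt0.
have [p wp] := w0 (w m) _ e2.
exists (maxn n (maxn m p)) => i; rewrite !geq_max => /and3P[/wM ni mi /wp].
rewrite subr0 => h; have {}mi := wm _ _ mi (leqnn m).
have -> : q (w i) = re (b (w i) (w m)) + re (b (w i) (w i -' w m)).
  by rewrite ip_formBr reB addrC subrK.
have h1 := le_lt_trans (re_le_cabs _) h.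
suff h2 : cabs (b (w i) (w i -' w m)) < e / 2.
  have := re_le_cabs (b (w i) (w i -' w m)); lra.
rewrite -(ltr_pXn2r (_ : 0 < 2)%N) ?nnegrE ?cabs_ge0 ?(ltW e2)//.
apply: le_lt_trans (ip_CS B _ _) _.
rewrite ltr_pdivlMr// in mi.
have := ip_sq_ge0 B (w i -' w m); have := ip_sq_ge0 B (w i); nra.
Qed.

Lemma ip_cauchyD u v : ip_cauchy u -> ip_cauchy v ->
  ip_cauchy (fun n => ip_add B (u n) (v n)).
Proof.
move=> uc vc e e0; have e4 : 0 < e / 4 by lra.
have [n un] := uc _ e4; have [m vm] := vc _ e4.
exists (maxn n m) => i j; rewrite !geq_max => /andP[ni mi] /andP[nj mj].
have := un _ _ ni nj; have := vm _ _ mi mj.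
have := ip_sqD_le B (u i -' u j) (v i -' v j).
rewrite [X in X <= _](_ : _ = q (ip_add B (u i) (v i) -' ip_add B (u j) (v j)));
  first lra.
rewrite /ip_sq /ip_sub; congr re.
by rewrite !(ip_formDl, ip_formZl, ip_formDr, ip_formZr); ring.
Qed.

Lemma ip_cauchyZ a u : ip_cauchy u -> ip_cauchy (fun n => ip_scale B a (u n)).
Proof.
move=> uc e e0.
have p : 0 < cabs a ^+ 2 + 1 by have := sqr_ge0 (cabs a); lra.
have [n un] := uc _ (divr_gt0 e0 p); exists n => i j ni nj.
have := un _ _ ni nj; rewrite ltr_pdivlMr// => h.
rewrite [X in X < _](_ : _ = cabs a ^+ 2 * q (u i -' u j)).
  by have := ip_sq_ge0 B (u i -' u j); nra.
rewrite -ip_sqZ /ip_sq /ip_sub; congr re.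
by rewrite !(ip_formDl, ip_formZl, ip_formDr, ip_formZr); ring.
Qed.

Lemma ip_limitD u v f g : ip_limit u f -> ip_limit v g ->
  ip_limit (fun n => ip_add B (u n) (v n)) (fun y => f y + g y).
Proof.
move=> [uc uf] [vc vg]; split; first exact: ip_cauchyD.
by move=> y; apply: clim_ext (climD (uf y) (vg y)) => n; rewrite ip_formDl.
Qed.

Lemma ip_limitZ a u f : ip_limit u f ->
  ip_limit (fun n => ip_scale B a (u n)) (fun y => a * f y).
Proof.
move=> [uc uf]; split; first exact: ip_cauchyZ.
by move=> y; apply: clim_ext (climZ a (uf y)) => n; rewrite ip_formZl.
Qed.

Lemma form_cauchy u v : ip_cauchy u -> ip_cauchy v ->
  exists l, clim (fun n => b (u n) (v n)) l.
Proof.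
move=> uc vc; apply: clim_cauchy => e e0.
have [M [M0 [n uM]]] := ip_cauchy_bound uc.
have [N [N0 [m vN]]] := ip_cauchy_bound vc.
have e2 : 0 < e / 2 by lra.
have [|n' un] := uc ((e / 2) ^+ 2 / N); first by rewrite divr_gt0// exprn_gt0.
have [|m' vm] := vc ((e / 2) ^+ 2 / M); first by rewrite divr_gt0// exprn_gt0.
exists (maxn (maxn n n') (maxn m m')) => i j.
rewrite !geq_max -!andbA => /and4P[ni n'i mi m'i] /and4P[nj n'j mj m'j].
have -> : b (u i) (v i) - b (u j) (v j) =
    b (u i -' u j) (v i) + b (u j) (v i -' v j).
  by rewrite ip_formBl ip_formBr; ring.
apply: le_lt_trans (cabsD _ _) _.
have key x y (L : R) : 0 < L -> q x < (e / 2) ^+ 2 / L -> q y <= L ->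
    cabs (b x y) < e / 2.
  move=> L0; rewrite ltr_pdivlMr// => qx qy.
  rewrite -(ltr_pXn2r (_ : 0 < 2)%N) ?nnegrE ?cabs_ge0 ?(ltW e2)//.
  apply: le_lt_trans (ip_CS B _ _) _.
  by have := ip_sq_ge0 B x; nra.
have h1 := key _ _ _ N0 (un _ _ n'i n'j) (vN _ mi).
have h2 := key _ _ _ M0 (vm _ _ m'i m'j) (uM _ nj).
rewrite ip_formC cabsC in h2; lra.
Qed.

Lemma ip_limit_form u u' v f l : ip_limit u f -> ip_limit u' f -> ip_cauchy v ->
  clim (fun n => b (u n) (v n)) l -> clim (fun n => b (u' n) (v n)) l.
Proof.
move=> uf u'f vc ul; apply: clim_add_null ul _.
have [wc w0] := ip_limitD u'f (ip_limitZ (-1) uf).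
apply: clim_ext (form_null vc (ip_cauchy_null wc _)) => [n|y].
  by rewrite ip_formDl ip_formZl mulN1r.
by have := w0 y; rewrite mulN1r subrr.
Qed.

Definition completion_pred : {pred E -> R[i]} :=
  fun f => `[< exists u, ip_limit u f >].

Lemma completion_predP (f : E -> R[i]) :
  reflect (exists u, ip_limit u f) (f \in completion_pred).
Proof. exact: asboolP. Qed.

Let completion_submod : submod_closed completion_pred.
Proof.
split=> [|a f g /completion_predP[u uf] /completion_predP[v vg]].
  apply/completion_predP; exists (fun=> ip_zero B); split.
    move=> e e0; exists 0%N => i j _ _.
    by rewrite ip_sqB /ip_sq !ip_form0l mulr0 subr0 addr0.
  by move=> y; apply: clim_ext (clim_cst _) => n; rewrite ip_form0l.
apply/completion_predP.
exists (fun n => ip_add B (ip_scale B a (u n)) (v n)).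
exact: ip_limitD (ip_limitZ a uf) vg.
Qed.

HB.instance Definition _ :=
  GRing.isSubmodClosed.Build R[i] (E -> R[i]) completion_pred completion_submod.

Definition completion := {f : E -> R[i] | f \in completion_pred}.

HB.instance Definition _ := Choice.on completion.
HB.instance Definition _ := SubType.on completion.
HB.instance Definition _ := [SubChoice_isSubLmodule of completion by <:].

Implicit Types f g : completion.

Lemma completion_rep f : exists u, ip_limit u (val f).
Proof. exact/completion_predP/valP. Qed.

Definition completion_seq f : nat -> E := sval (cid (completion_rep f)).

Lemma completion_seqP f : ip_limit (completion_seq f) (val f).
Proof. exact: svalP (cid (completion_rep f)). Qed.

(** The limit exists by [form_cauchy], so the default 0 is never taken. *)
Definition completion_dotp f g : R[i] :=
  xget 0 [set l | clim (fun n => b (completion_seq f n) (completion_seq g n)) l].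

Lemma completion_dotpP u v f g : ip_limit u (val f) -> ip_limit v (val g) ->
  clim (fun n => b (u n) (v n)) (completion_dotp f g).
Proof.
move=> uf vg; have ff := completion_seqP f; have gg := completion_seqP g.
have h : clim (fun n => b (completion_seq f n) (completion_seq g n))
    (completion_dotp f g).
  rewrite /completion_dotp; case: xgetP => [l _ //|no].
  by have [l hl] := form_cauchy ff.1 gg.1; case: (no l).
have h1 := ip_limit_form ff uf gg.1 h.
have h2 : clim (fun n => b (completion_seq g n) (u n)) (completion_dotp f g)^*.
  by apply: clim_ext (climC h1) => n; rewrite -ip_formC.
have := climC (ip_limit_form gg vg uf.1 h2).
by rewrite conjCK; apply: clim_ext => n; rewrite -ip_formC.
Qed.

Let completion_dotp_scalarl g : scalar (completion_dotp ^~ g).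
Proof.
move=> a f h; have ff := completion_seqP f; have hh := completion_seqP h.
have gg := completion_seqP g.
have afh : ip_limit (fun n => ip_add B (ip_scale B a (completion_seq f n))
    (completion_seq h n)) (val (a *: f + h)).
  exact: ip_limitD (ip_limitZ a ff) hh.
apply: clim_unique (completion_dotpP afh gg) _.
apply: clim_ext (climD (climZ a (completion_dotpP ff gg)) (completion_dotpP hh gg)).
by move=> n; rewrite ip_formDl ip_formZl.
Qed.

Let completion_dotpC f g : completion_dotp f g = (completion_dotp g f)^*.
Proof.
have ff := completion_seqP f; have gg := completion_seqP g.
apply: clim_unique (completion_dotpP ff gg) _.
by apply: clim_ext (climC (completion_dotpP gg ff)) => n; rewrite -ip_formC.
Qed.

Let completion_dotp_gt0 f : f != 0 -> 0 < completion_dotp f f.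
Proof.
move=> f0; have ff := completion_seqP f; have hf := completion_dotpP ff ff.
rewrite lt_def (clim_ge0 _ hf) ?andbT => [|i]; last exact: ip_form_ge0.
apply: contra f0 => /eqP f0; apply/eqP/val_inj/funext => y /=.
rewrite f0 in hf.
apply: clim_unique (ff.2 y) _.
apply: form_null => [e e0|e /hf[n hn]].
  by exists 0%N => i j _ _; rewrite ip_sqB; rewrite -/(ip_sq B y); lra.
by exists n => i /hn; rewrite subr0; apply: le_lt_trans; exact: re_le_cabs.
Qed.

HB.instance Definition _ := Lmodule_hasDotp.Build R completion
  completion_dotp_scalarl completion_dotpC completion_dotp_gt0.

Lemma completion_dotpE f g : dotp f g = completion_dotp f g.
Proof. by []. Qed.

Lemma completion_const_limit x : ip_limit (fun=> x) (b x).
Proof.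
split=> [e e0|y]; last exact: clim_cst.
by exists 0%N => i j _ _; rewrite ip_sqB; rewrite -/(ip_sq B x); lra.
Qed.

Lemma completion_const_pred x : b x \in completion_pred.
Proof. by apply/completion_predP; exists (fun=> x); exact:
  completion_const_limit. Qed.

Definition completion_inj x : completion := Sub (b x) (completion_const_pred x).

Lemma dotp_completion_inj f x : dotp f (completion_inj x) = val f x.
Proof.
have ff := completion_seqP f; rewrite completion_dotpE.
have h0 := @completion_dotpP _ _ f (completion_inj x) ff (completion_const_limit x).
exact: clim_unique h0 (ff.2 x).
Qed.

Lemma completion_inj_lim u f (e : R) : ip_limit u (val f) -> 0 < e ->
  exists n, forall i, (n <= i)%N -> cabs (dotp (f - completion_inj (u i)) (f -
    completion_inj (u i))) <= e.
Proof.
move=> uf e0; have [n un] := uf.1 _ e0; exists n => i ni.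
have h : ip_limit (fun m => u m -' u i) (val (f - completion_inj (u i))).
  have := ip_limitD uf (ip_limitZ (-1) (completion_const_limit (u i))).
  congr ip_limit; apply/funext => y /=.
  by rewrite !fctE mulN1r.
apply: (clim_le (n := n) (completion_dotpP h h)) => j nj.
by rewrite ip_sqE cabs_real ?ip_sq_ge0// ltW ?un.
Qed.

(** Each set of the filter inside a ball of radius 1/(n+1) is approximated by the image of some
    [x n] in [E]. The [x n] form a Cauchy sequence, and the functional that they represent is the
    limit. *)
Let completion_complete (F : set_system completion) :
  ProperFilter F -> cauchy F -> cvg F.
Proof.
move=> FF /cauchy_ballP Fc.
pose d n : R[i] := n.+1%:R^-1.
have d0 n : 0 < d n by rewrite invr_gt0.
have dE n : d n = (n.+1%:R^-1 : R)%:C%C by rewrite fmorphV rmorph_nat.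
have /choice [c cP] : forall n, exists c : completion, F (ball c (d n)).
  move=> n; have := Fc _ (d0 n); rewrite near_map2 => -[[P Q] /= [FP FQ] PQ].
  have [g Pg] := filter_ex FP; exists g; apply: filterS FQ => h Qh.
  exact: (PQ (g, h)).
have /choice [x xP] : forall n, exists x : E, `|c n - completion_inj x| <= d n.
  move=> n; have cc := completion_seqP (c n).
  have e0 : 0 < (n.+1%:R^-1 : R) ^+ 2 by rewrite exprn_gt0// invr_gt0.
  have [i /(_ i (leqnn i)) h] := completion_inj_lim cc e0.
  exists (completion_seq (c n) i).
  rewrite -(@ler_pXn2r _ 2) ?nnegrE ?(ltW (d0 n))// -dotp_norm.
  rewrite dE -rmorphXn/= -[leLHS]ge0_reE ?dotp_norm ?exprn_ge0// lecR.
  by apply: le_trans h; rewrite dotp_norm re_le_cabs.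
have cx n g : ball (c n) (d n) g -> `|completion_inj (x n) - g| <= d n + d n.
  rewrite -ball_normE /ball_ /= => h.
  have := ler_normD (c n - g) (- (c n - completion_inj (x n))).
  rewrite normrN opprB addrC addrA subrK => h1.
  by apply: le_trans h1 _; rewrite lerD// ltW.
have inj_sq i j : `|completion_inj (x i) - completion_inj (x j)| ^+ 2 =
    (q (x i -' x j))%:C%C.
  rewrite -ip_sqE -dotp_norm.
  have h : ip_limit (fun=> x i -' x j) (val (completion_inj (x i) -
    completion_inj (x j))).
    have := ip_limitD (completion_const_limit (x i)) (ip_limitZ (-1)
      (completion_const_limit (x j))).
    congr ip_limit; apply/funext => y /=.
    by rewrite !fctE mulN1r.
  exact: clim_unique (completion_dotpP h h) (clim_cst _).
have archi (e : R) : 0 < e -> exists n, forall i, (n <= i)%N -> d i < e%:C%C.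
  move=> e0; exists (Num.truncn e^-1) => i ni; rewrite dE ltcR.
  rewrite invf_plt ?posrE// (lt_le_trans (truncnS_gt _))// ler_nat ltnS//.
have sum4 (r s t : R) : r < t / 4 -> s < t / 4 -> s + s + (r + r) < t by lra.
have xc : ip_cauchy x.
  move=> e e0; have s0 : 0 < Num.sqrt e by rewrite sqrtr_gt0.
  have [n dn] := archi (Num.sqrt e / 4) (divr_gt0 s0 (ltr0n _ 4)).
  exists n => i j ni nj; rewrite -ltcR -inj_sq.
  have -> : e%:C%C = (Num.sqrt e)%:C%C ^+ 2 by rewrite -rmorphXn/= sqr_sqrtr// ltW.
  rewrite ltr_pXn2r ?nnegrE// ?lecR ?sqrtr_ge0//.
  have [g [gi gj]] := filter_ex (filterI (cP i) (cP j)).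
  have := ler_normD (completion_inj (x i) - g) (- (completion_inj (x j) - g)).
  rewrite normrN opprB addrA subrK => /le_lt_trans; apply.
  apply: le_lt_trans (lerD (cx _ _ gi) (cx _ _ gj)) _.
  have := dn _ ni; have := dn _ nj; rewrite !dE -!rmorphD/= !ltcR; exact: sum4.
have /choice [f fP] : forall y, exists l, clim (fun n => b (x n) y) l.
  move=> y; have [l hl] := form_cauchy xc (completion_const_limit y).1.
  by exists l.
have fp : f \in completion_pred by apply/completion_predP; exists x.
apply/cvg_ex; exists (Sub f fp : completion); apply/cvgrPdist_lt => e e0.
have eE : (re e)%:C%C = e by rewrite ge0_reE// ltW.
have re0 : 0 < re e by rewrite -ltcR eE.
have [n dn] := archi (re e / 4) (divr_gt0 re0 (ltr0n _ 4)).
have e40 : 0 < (re e / 4) ^+ 2 by rewrite exprn_gt0// divr_gt0.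
have [m hm] := @completion_inj_lim x (Sub f fp) _ (conj xc fP) e40.
set k := maxn n m; have {}hm := hm _ (leq_maxr n m : (m <= k)%N).
have fk : `|(Sub f fp : completion) - completion_inj (x k)| <= (re e / 4)%:C%C.
  rewrite -(@ler_pXn2r _ 2) ?nnegrE ?lecR// ?divr_ge0// ?(ltW re0)//.
  rewrite -rmorphXn/= -dotp_norm -[leLHS]ge0_reE ?dotp_norm ?exprn_ge0// lecR.
  by apply: le_trans hm; rewrite dotp_norm re_le_cabs.
near=> g.
have gk : ball (c k) (d k) g by near: g; exact: cP.
have := ler_normD ((Sub f fp : completion) - completion_inj (x k))
  (completion_inj (x k) - g).
rewrite addrA subrK => /le_lt_trans; apply.
apply: le_lt_trans (lerD fk (cx _ _ gk)) _.
apply: (@lt_le_trans _ _ (re e)%:C%C); last by rewrite eE.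
have := dn _ (leq_maxl n m : (n <= k)%N); rewrite dE -!rmorphD/= !ltcR.
by move: (_.+1%:R^-1) (re e) re0 => r t; lra.
Unshelve. all: by end_near. Qed.

HB.instance Definition _ := Uniform_isComplete.Build completion completion_complete.

End completion.

(** * Hilbert spaces *)

Section psd_forms.
Variables (R : realType) (V : lmodType R[i]).
Implicit Types (b : V -> V -> R[i]) (x y z : V) (a : R[i]).

Definition psd_form b : Prop :=
  [/\ forall y, scalar (b ^~ y), forall x y, b x y = (b y x)^* &
      forall x, 0 <= b x x].

Lemma psd_formDl b x y z : psd_form b -> b (x + y) z = b x z + b y z.
Proof. by case=> h _ _; rewrite -[x in LHS]scale1r h mul1r. Qed.
Lemma psd_form0l b z : psd_form b -> b 0 z = 0.
Proof. by move=> hb; apply: (@addrI _ (b 0 z)); rewrite -psd_formDl// !addr0. Qed.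
Lemma psd_formZl b a x z : psd_form b -> b (a *: x) z = a * b x z.
Proof. by move=> hb; case: (hb) => h _ _; rewrite -[a *: x]addr0 h psd_form0l//
  addr0. Qed.

Definition psd_ip b (hb : psd_form b) : semi_ip R V :=
  @SemiIp R V +%R *:%R 0 b (fun y => psd_form0l y hb)
    (fun x y z => psd_formDl x y z hb) (fun a x z => psd_formZl a x z hb)
    (let: And3 _ h _ := hb in h) (let: And3 _ _ h := hb in h).

Definition fsq b x : R := re (b x x).

Section one_form.
Variable b : V -> V -> R[i].
Hypothesis hb : psd_form b.

Lemma psd_formC x y : b x y = (b y x)^*. Proof. by case: hb. Qed.
Lemma psd_formDr x y z : b x (y + z) = b x y + b x z.
Proof. exact: (ip_formDr (psd_ip hb)). Qed.
Lemma psd_formZr a x y : b x (a *: y) = a^* * b x y.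
Proof. exact: (ip_formZr (psd_ip hb)). Qed.
Lemma psd_formNl x y : b (- x) y = - b x y.
Proof. by rewrite -scaleN1r psd_formZl// mulN1r. Qed.
Lemma psd_formNr x y : b x (- y) = - b x y.
Proof. by rewrite -scaleN1r psd_formZr// rmorphN rmorph1 mulN1r. Qed.
Lemma psd_formBl x y z : b (x - y) z = b x z - b y z.
Proof. by rewrite psd_formDl// psd_formNl. Qed.
Lemma psd_formBr x y z : b x (y - z) = b x y - b x z.
Proof. by rewrite psd_formDr psd_formNr. Qed.
Lemma psd_form_suml (I : Type) (s : seq I) (P : pred I) (f : I -> V) y :
  b (\sum_(i <- s | P i) f i) y = \sum_(i <- s | P i) b (f i) y.
Proof.
by apply: (big_morph (b ^~ y)) => [x z|]; rewrite ?psd_formDl// psd_form0l.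
Qed.
Lemma psd_form_sumr (I : Type) (s : seq I) (P : pred I) (f : I -> V) x :
  b x (\sum_(i <- s | P i) f i) = \sum_(i <- s | P i) b x (f i).
Proof.
rewrite psd_formC psd_form_suml rmorph_sum/=; apply: eq_bigr => i _.
by rewrite -psd_formC.
Qed.
Lemma fsqE x : b x x = (fsq b x)%:C%C.
Proof. exact: (ip_sqE (psd_ip hb)). Qed.
Lemma fsq_ge0 x : 0 <= fsq b x.
Proof. exact: (ip_sq_ge0 (psd_ip hb)). Qed.
Lemma re_psd_formC x y : re (b x y) = re (b y x).
Proof. exact: (re_formC (psd_ip hb)). Qed.
Lemma fsqD x y : fsq b (x + y) = fsq b x + fsq b y + 2 * re (b x y).
Proof. exact: (ip_sqD (psd_ip hb)). Qed.
Lemma fsqZ a x : fsq b (a *: x) = cabs a ^+ 2 * fsq b x.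
Proof. exact: (ip_sqZ (psd_ip hb)). Qed.
Lemma fsqN x : fsq b (- x) = fsq b x.
Proof. by rewrite -scaleN1r fsqZ cabsN cabs1 expr1n mul1r. Qed.
Lemma fsqB x y : fsq b (x - y) = fsq b x + fsq b y - 2 * re (b x y).
Proof. by rewrite fsqD fsqN psd_formNr reN mulrN. Qed.
Lemma fsq0 : fsq b 0 = 0.
Proof. by rewrite /fsq psd_form0l. Qed.
Lemma psd_CS x y : cabs (b x y) ^+ 2 <= fsq b x * fsq b y.
Proof. exact: (ip_CS (psd_ip hb)). Qed.
Lemma fsqZr (r : R) x : fsq b (r%:C%C *: x) = r ^+ 2 * fsq b x.
Proof.
rewrite fsqZ; congr (_ * _); apply: (@complexI R); rewrite -cabs_sq.
by rewrite conj_Creal ?complex_real// -rmorphM.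
Qed.
End one_form.
End psd_forms.

Section hilbert_theory.
Variables (R : realType).

Lemma dotp_psd (H : hilbertType R) : psd_form (@dotp R H).
Proof.
split; [exact: dotp_scalarl|exact: dotp_conjC|].
by move=> x; rewrite dotp_norm exprn_ge0.
Qed.

Definition hsq (H : hilbertType R) (x : H) : R := fsq (@dotp R H) x.
Definition hnorm (H : hilbertType R) (x : H) : R := re `|x|.

Variable H : hilbertType R.
Implicit Types (x y z : H) (u : nat -> H).

Lemma hnormE x : `|x| = (hnorm x)%:C%C. Proof. by rewrite ge0_reE. Qed.
Lemma hnorm_ge0 x : 0 <= hnorm x. Proof. exact: re_ge0. Qed.
Lemma hsqE x : hsq x = hnorm x ^+ 2.
Proof.
by apply: (@complexI R); rewrite -fsqE ?dotp_norm ?hnormE ?rmorphXn//; exact: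
  dotp_psd.
Qed.
Lemma hsq_ge0 x : 0 <= hsq x. Proof. exact/fsq_ge0/dotp_psd. Qed.
Lemma hsqD x y : hsq (x + y) = hsq x + hsq y + 2 * re (dotp x y).
Proof. exact/fsqD/dotp_psd. Qed.
Lemma hsqB x y : hsq (x - y) = hsq x + hsq y - 2 * re (dotp x y).
Proof. exact/fsqB/dotp_psd. Qed.
Lemma hsqZr (r : R) x : hsq (r%:C%C *: x) = r ^+ 2 * hsq x.
Proof. exact/fsqZr/dotp_psd. Qed.
Lemma hnormD x y : hnorm (x + y) <= hnorm x + hnorm y.
Proof. by rewrite -lecR rmorphD/= -!hnormE ler_normD. Qed.
Lemma hnormN x : hnorm (- x) = hnorm x. Proof. by rewrite /hnorm normrN. Qed.
Lemma hnorm0 : hnorm (0 : H) = 0. Proof. by rewrite /hnorm normr0. Qed.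
Lemma hnormZ (a : R[i]) x : hnorm (a *: x) = cabs a * hnorm x.
Proof. by apply: (@complexI R); rewrite rmorphM/= -hnormE -cabsE normrZ hnormE. Qed.
Lemma hnorm_sum (I : Type) (s : seq I) (P : pred I) (f : I -> H) :
  hnorm (\sum_(i <- s | P i) f i) <= \sum_(i <- s | P i) hnorm (f i).
Proof.
elim/big_ind2: _ => [|x a y b xa yb|//]; first by rewrite hnorm0.
by apply: le_trans (hnormD _ _) _; rewrite lerD.
Qed.
Lemma hsq_eq0 x : hsq x = 0 -> x = 0.
Proof.
by rewrite hsqE => /eqP; rewrite expf_eq0/= => /eqP h; apply/eqP; rewrite
  -normr_eq0 hnormE h.
Qed.
Lemma hnorm_eq0 x : hnorm x = 0 -> x = 0.
Proof. by move=> h; apply: hsq_eq0; rewrite hsqE h expr0n. Qed.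
Lemma dotp_CS x y : cabs (dotp x y) <= hnorm x * hnorm y.
Proof.
rewrite -(@ler_pXn2r _ 2) ?nnegrE ?mulr_ge0 ?hnorm_ge0 ?cabs_ge0//.
by rewrite exprMn -!hsqE; exact: (psd_CS (dotp_psd H)).
Qed.
Lemma dotp_eqP x y : (forall z, dotp x z = dotp y z) -> x = y.
Proof.
move=> h; apply/eqP; rewrite -subr_eq0; apply/eqP; apply: hsq_eq0.
by rewrite /hsq /fsq (psd_formBl (dotp_psd H)) h subrr.
Qed.

Definition hcvg u l := forall e : R, 0 < e ->
  exists n, forall i, (n <= i)%N -> hnorm (u i - l) < e.

Lemma hilbert_cauchy u :
  (forall e : R, 0 < e -> exists n, forall i j, (n <= i)%N -> (n <= j)%N ->
    hnorm (u i - u j) < e) -> exists l, hcvg u l.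
Proof.
move=> uc.
have /cvg_ex [l /cvgrPdist_lt ul] : cvg (u @ \oo).
  apply: cauchy_cvg; apply/cauchy_ballP => e e0.
  have eE : (re e)%:C%C = e by rewrite ge0_reE// ltW.
  have re0 : 0 < re e by rewrite -ltcR eE.
  have [n un] := uc _ re0; rewrite near_map2.
  exists ([set i | (n <= i)%N], [set i | (n <= i)%N]); first by split; exists n.
  move=> [i j] [/= ni nj]; rewrite -ball_normE/= /ball_/=.
  by rewrite -eE hnormE ltcR un.
exists l => e e0; have := ul e%:C%C; rewrite ltcR => /(_ e0) [n _ un].
exists n => i ni; have := un i ni.
by rewrite /= -opprB normrN hnormE ltcR.
Qed.

Lemma hcvg_dotp u l x : hcvg u l -> clim (fun n => dotp x (u n)) (dotp x l).
Proof.
move=> ul e e0; have p : 0 < hnorm x + 1 by have := hnorm_ge0 x; lra.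
have [n un] := ul _ (divr_gt0 e0 p); exists n => i /un; rewrite ltr_pdivlMr// => h.
rewrite -(psd_formBr (dotp_psd H)); apply: le_lt_trans (dotp_CS _ _) _.
have := hnorm_ge0 (u i - l); nra.
Qed.

Lemma hcvg_unique u l m : hcvg u l -> hcvg u m -> l = m.
Proof.
move=> ul um; apply: dotp_eqP => z.
rewrite dotp_conjC [RHS]dotp_conjC; congr (_^*).
exact: clim_unique (hcvg_dotp z ul) (hcvg_dotp z um).
Qed.

(* The minimizer of |x|^2 - 2 Re f(x) over the orthogonal complement of W. *)
Lemma riesz_on_orthogonal (W : set H) (f : H -> R[i]) (M : R) : scalar f ->
  (forall x, cabs (f x) <= M * hnorm x) ->
  exists2 v, (forall w, W w -> dotp v w = 0) &
    forall x, (forall w, W w -> dotp x w = 0) -> f x = dotp x v.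
Proof.
move=> fl fM; pose N := [set x | forall w, W w -> dotp x w = 0].
have fD x y : f (x + y) = f x + f y by rewrite -[x in LHS]scale1r fl mul1r.
have f0 : f 0 = 0 by apply: (@addrI _ (f 0)); rewrite -fD !addr0.
have fZ a x : f (a *: x) = a * f x by rewrite -[a *: x]addr0 fl f0 addr0.
have ND x y : N x -> N y -> N (x + y).
  by move=> Nx Ny w Ww; rewrite (psd_formDl _ _ _ (dotp_psd H)) Nx// Ny// addr0.
have NZ a x : N x -> N (a *: x).
  by move=> Nx w Ww; rewrite (psd_formZl _ _ _ (dotp_psd H)) Nx// mulr0.
pose J x := hsq x - 2 * re (f x).
have N0 : N 0 by move=> w _; rewrite (psd_form0l _ (dotp_psd H)).
have Jlb x : - M ^+ 2 <= J x.
  rewrite /J hsqE; have := re_le_cabs (f x); have := fM x.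
  have := sqr_ge0 (hnorm x - M); nra.
have hinf : has_inf (J @` N).
  by split; [exists (J 0), 0|exists (- M ^+ 2) => _ [x _ <-]].
set d := inf (J @` N).
have dJ x : N x -> d <= J x by move=> Nx; apply: ge_inf; [exact: hinf.2|exists x].
have ep n : 0 < (n.+1%:R^-1 : R) by rewrite invr_gt0.
have /choice[u uP] : forall n, exists x, N x /\ J x < d + n.+1%:R^-1.
  move=> n; have [_ [x Nx <-] xd] := inf_adherent (ep n) hinf.
  by exists x.
(* Parallelogram law: [J] at the midpoint is at least [d]. Minimizing sequences are therefore
   Cauchy. *)
have par x y : N x -> N y -> hsq (x - y) <= 2 * (J x - d) + 2 * (J y - d).
  move=> Nx Ny; have := dJ _ (NZ (2^-1)%:C%C _ (ND _ _ Nx Ny)).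
  rewrite /J hsqZr fZ reZ fD reD hsqD hsqB; lra.
have inv_small (e : R) : 0 < e -> exists n, forall i, (n <= i)%N -> i.+1%:R^-1 < e.
  move=> e0; exists (Num.truncn e^-1) => i ni.
  rewrite invf_plt ?posrE// (lt_le_trans (truncnS_gt _))// ler_nat ltnS//.
have arith (a b c p q r s : R) : a < r / 4 -> b < r / 4 -> p < c + a ->
    q < c + b -> s <= 2 * (q - c) + 2 * (p - c) -> s < r by clear f0; lra.
have [|l ul] := @hilbert_cauchy u.
  move=> e e0; have [|n hn] := inv_small (e ^+ 2 / 4); first by rewrite
    divr_gt0// exprn_gt0.
  exists n => i j ni nj.
  rewrite -(ltr_pXn2r (_ : 0 < 2)%N) ?nnegrE ?hnorm_ge0 ?(ltW e0)// -hsqE.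
  have := par _ _ (uP i).1 (uP j).1; have := (uP i).2; have := (uP j).2.
  have := hn _ ni; have := hn _ nj.
  exact: arith.
clear f0.
have re_part x : N x -> re (dotp x l - f x) = 0.
  move=> Nx; set q := hsq x; have q0 : 0 <= q := hsq_ge0 x.
  have small n : re (dotp x (u n) - f x) ^+ 2 <= (q + 1) * n.+1%:R^-1.
    (* Nearly the minimizer of [J (u n + s x)] in [s]; the denominator [q + 1] in place of [q]
       avoids a case [x = 0]. *)
    set a := re _; pose s := - a / (q + 1).
    have := dJ _ (ND _ _ (uP n).1 (NZ s%:C%C _ Nx)).
    have := (uP n).2; rewrite /J hsqD fD fZ hsqZr reD reZ -/q.
    rewrite (psd_formZr (dotp_psd H)) conj_Creal ?complex_real// reZ.
    rewrite (re_psd_formC (dotp_psd H)).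
    have aE : re (dotp x (u n)) = a + re (f x) by rewrite /a reB; ring.
    rewrite aE => h1 h2.
    have h3 : 0 <= n.+1%:R^-1 + 2 * s * a + s ^+ 2 * q.
      by move: h1 h2; move: (n.+1%:R^-1 : R) => e; nra.
    have qp : 0 < q + 1 by lra.
    have sE : 2 * s * a + s ^+ 2 * q <= - (a ^+ 2 / (q + 1)).
      rewrite -subr_ge0.
      have -> : - (a ^+ 2 / (q + 1)) - (2 * s * a + s ^+ 2 * q) = (a / (q + 1)) ^+ 2.
        by rewrite /s; field; rewrite gt_eqF.
      exact: sqr_ge0.
    rewrite [(q + 1) * _]mulrC -ler_pdivrMr//.
    have ar (b c e g : R) : 0 <= e + b + c -> b + c <= - g -> g <= e by lra.
    exact: ar h3 sE.
  apply/eqP; rewrite -sqrf_eq0 eq_le sqr_ge0 andbT.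
  apply/ler_addgt0Pr => e e0; rewrite add0r.
  have qp : 0 < q + 1 by lra.
  have [|n hn] := inv_small (e / 4 / (q + 1)); first by rewrite !divr_gt0.
  have s0 : 0 < Num.sqrt e / 2 by rewrite divr_gt0// sqrtr_gt0.
  have [m hm] := hcvg_dotp x ul s0.
  have {}hm := hm _ (leq_maxr n m); have {}hn := hn _ (leq_maxl n m).
  have := small (maxn n m); set k := maxn n m in hm hn *.
  move=> hs; rewrite ltr_pdivlMr// mulrC in hn.
  have {hn}hs := le_trans hs (ltW hn).
  have hk : (re (dotp x l - dotp x (u k))) ^+ 2 <= e / 4.
    have -> : e / 4 = (Num.sqrt e / 2) ^+ 2.
      by rewrite exprMn sqr_sqrtr ?(ltW e0)// exprVn -natrX.
    rewrite -real_normK ?num_real// ler_pXn2r ?nnegrE ?(ltW s0)//.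
    apply: le_trans (ltW hm); rewrite -cabsN opprB -lecR -cabsE; exact: normc_ge_Re.
  have -> : dotp x l - f x = (dotp x l - dotp x (u k)) + (dotp x (u k) - f x) by ring.
  rewrite reD.
  move: hk hs; set r := re _; set t := re _ => hk hs.
  by have := sqr_ge0 (r - t); nra.
have Nl : N l.
  move=> w Ww; rewrite dotp_conjC; apply/eqP; rewrite conjC_eq0; apply/eqP.
  apply: clim_unique (hcvg_dotp w ul) _; apply: clim_ext (clim_cst 0) => n.
  by rewrite dotp_conjC (uP n).1// conjC0.
exists l => // x Nx; apply/eqP; rewrite eq_sym -subr_eq0; apply/eqP.
(* The real part at ['i *: x] is minus the imaginary part at [x]. *)
have r0 := re_part _ Nx; have := re_part _ (NZ 'i%C _ Nx).
rewrite fZ (psd_formZl _ _ _ (dotp_psd H)) -mulrBr mulrC ReiNIm => /eqP.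
rewrite oppr_eq0 => /eqP i0.
by move: r0 i0; case: (_ - _) => a b /= -> ->.
Qed.

Lemma riesz (f : H -> R[i]) (M : R) : scalar f ->
  (forall x, cabs (f x) <= M * hnorm x) -> exists v, forall x, f x = dotp x v.
Proof.
move=> fl fM; have [v _ h] := riesz_on_orthogonal set0 fl fM.
by exists v => x; apply: h.
Qed.

(** The solution is the fixed point of [x |-> y + D x], reached by iteration. *)
Lemma neumann_surj (D : H -> H) (s : R) : linear D -> 0 <= s < 1 ->
  (forall x, hnorm (D x) <= s * hnorm x) -> forall y, exists x, x - D x = y.
Proof.
move=> Dl /andP[s0 s1] Ds y.
have DB x z : D (x - z) = D x - D z by rewrite addrC -scaleN1r Dl scaleN1r addrC.
pose u n := iter n (fun x => y + D x) y.
have uS n : hnorm (u n.+1 - u n) <= s ^+ n * hnorm (D y).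
  elim: n => [|n IH]; first by rewrite /u/= addrC addKr expr0 mul1r.
  have -> : u n.+2 - u n.+1 = D (u n.+1 - u n).
    by rewrite DB /u/= opprD addrACA subrr add0r.
  by apply: le_trans (Ds _) _; rewrite exprS -mulrA ler_wpM2l.
have ud n k : (1 - s) * hnorm (u (n + k)%N - u n) <= s ^+ n * hnorm (D y).
  have s1' : 0 < 1 - s by lra.
  suff : (1 - s) * hnorm (u (n + k)%N - u n) <= (s ^+ n - s ^+ (n + k)%N) * hnorm
    (D y).
    move=> h; apply: le_trans h _; rewrite ler_wpM2r ?hnorm_ge0//.
    by rewrite gerBl exprn_ge0.
  elim: k => [|k IH]; first by rewrite addn0 !subrr hnorm0 mulr0 mul0r.
  rewrite addnS.
  have -> : u (n + k).+1 - u n = (u (n + k).+1 - u (n + k)%N) + (u (n + k)%N - u n).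
    by rewrite addrA subrK.
  have := uS (n + k)%N; have := hnormD (u (n + k).+1 - u (n + k)%N) (u (n + k)%N
    - u n).
  rewrite exprS; move: IH.
  have := hnorm_ge0 (D y); move: (s ^+ (n + k)) (s ^+ n) => A B.
  move: (hnorm _) (hnorm _) (hnorm _) (hnorm _) => p q r t; nra.
have [|l ul] := @hilbert_cauchy u.
  move=> e e0.
  have s1' : 0 < 1 - s by lra.
  have p : 0 < hnorm (D y) + 1 by have := hnorm_ge0 (D y); lra.
  have e'0 : 0 < e / 2 * (1 - s) / (hnorm (D y) + 1) by rewrite divr_gt0//
    mulr_gt0// divr_gt0.
  have /cvgrPdist_lt/(_ _ e'0)[n _ hn] : (fun n => s ^+ n) @ \oo --> 0.
    by apply: cvg_expr; rewrite ger0_norm.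
  have {hn}sn : s ^+ n < e / 2 * (1 - s) / (hnorm (D y) + 1).
    by have := hn n (leqnn n); rewrite /= sub0r normrN ger0_norm// exprn_ge0.
  rewrite ltr_pdivlMr// in sn.
  have small k : (n <= k)%N -> hnorm (u k - u n) < e / 2.
    move=> /subnKC <-; rewrite -(ltr_pM2l s1'); apply: le_lt_trans (ud _ _) _.
    have : 0 <= s ^+ n by rewrite exprn_ge0.
    move: (s ^+ n) (hnorm (D y)) sn => A B; nra.
  exists n => i j /small ni /small nj.
  have -> : u i - u j = (u i - u n) - (u j - u n) by rewrite opprB addrA subrK.
  have := hnormD (u i - u n) (- (u j - u n)); rewrite hnormN; lra.
exists l; apply: (@hcvg_unique (fun n => u n - D (u n))).
  move=> e e0; have e2 : 0 < e / 2 by lra.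
  have [n un] := ul _ e2; exists n => i /un h.
  have -> : u i - D (u i) - (l - D l) = (u i - l) - D (u i - l).
    by rewrite DB !opprB addrACA [RHS]addrACA; congr (_ + _); exact: addrC.
  have := hnormD (u i - l) (- D (u i - l)); rewrite hnormN.
  have := Ds (u i - l); have := hnorm_ge0 (u i - l); nra.
move=> e e0; have e2 : 0 < e / 2 by lra.
have [n un] := ul _ e2; exists n => i ni.
have -> : u i - D (u i) - y = u i - u i.+1 by rewrite {4}/u/= opprD addrA addrAC.
have -> : u i - u i.+1 = (u i - l) - (u i.+1 - l) by rewrite opprB addrA subrK.
have := hnormD (u i - l) (- (u i.+1 - l)); rewrite hnormN.
have := un _ ni; have := un _ (leqW ni); lra.
Qed.
End hilbert_theory.

(** * Polynomials in an operator *)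

Section poly_op_theory.
Variables (R : realType) (H : hilbertType R) (T : H -> H).
Hypothesis Tl : linear T.
Implicit Types (p q : {poly R[i]}) (x y z : H) (a : R[i]).

Lemma op_linD x y : T (x + y) = T x + T y.
Proof. by rewrite -[x in LHS]scale1r Tl scale1r. Qed.
Lemma op_lin0 : T 0 = 0.
Proof. by apply: (@addrI _ (T 0)); rewrite -op_linD !addr0. Qed.
Lemma op_linZ a x : T (a *: x) = a *: T x.
Proof. by rewrite -[a *: x]addr0 Tl op_lin0 addr0. Qed.
Lemma op_linN x : T (- x) = - T x.
Proof. by rewrite -scaleN1r op_linZ scaleN1r. Qed.
Lemma op_linB x y : T (x - y) = T x - T y.
Proof. by rewrite op_linD op_linN. Qed.
Lemma op_lin_sum (I : Type) (s : seq I) (P : pred I) (f : I -> H) :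
  T (\sum_(i <- s | P i) f i) = \sum_(i <- s | P i) T (f i).
Proof. exact: (big_morph T op_linD op_lin0). Qed.
Lemma iter_linear n : linear (iter n T).
Proof. by elim: n => [//|n IH] a x y /=; rewrite IH Tl. Qed.

Lemma poly_op_wide n p x : (size p <= n)%N ->
  poly_op p T x = \sum_(i < n) p`_i *: iter i T x.
Proof.
move=> pn; rewrite /poly_op (big_ord_widen n (fun i => p`_i *: iter i T x) pn).
rewrite big_mkcond; apply: eq_bigr => i _; case: ltnP => // h.
by rewrite nth_default// scale0r.
Qed.

Lemma poly_opD p q x : poly_op (p + q) T x = poly_op p T x + poly_op q T x.
Proof.
rewrite (poly_op_wide _ (size_polyD p q)) (poly_op_wide x (leq_maxl (size p)
  (size q))).
rewrite (poly_op_wide x (leq_maxr (size p) (size q))) -big_split/=.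
by apply: eq_bigr => i _; rewrite coefD scalerDl.
Qed.

Lemma poly_opZ a p x : poly_op (a *: p) T x = a *: poly_op p T x.
Proof.
rewrite (poly_op_wide _ (size_scale_leq a p)) /poly_op scaler_sumr.
by apply: eq_bigr => i _; rewrite coefZ scalerA.
Qed.

Lemma poly_op0 x : poly_op 0 T x = 0.
Proof. by rewrite /poly_op size_poly0 big_ord0. Qed.

Lemma poly_opC a x : poly_op a%:P T x = a *: x.
Proof.
by rewrite (poly_op_wide _ (size_polyC_leq1 a)) big_ord1 coefC eqxx.
Qed.

Lemma poly_op1 x : poly_op 1 T x = x.
Proof. by rewrite poly_opC scale1r. Qed.

Lemma poly_opMX p x : poly_op (p * 'X) T x = poly_op p T (T x).
Proof.
have sz : (size (p * 'X)%R <= (size p).+1)%N.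
  by have [->|p0] := eqVneq p 0; rewrite ?mul0r ?size_poly0// size_mulX.
rewrite (poly_op_wide _ sz) big_ord_recl coefMX eqxx scale0r add0r.
by apply: eq_bigr => i _; rewrite coefMX /= -iterSr.
Qed.

Lemma poly_op_linear p : linear (poly_op p T).
Proof.
move=> a x y; rewrite /poly_op scaler_sumr -big_split/=.
by apply: eq_bigr => i _; rewrite iter_linear scalerDr !scalerA mulrC.
Qed.

Lemma poly_op_commT p x : poly_op p T (T x) = T (poly_op p T x).
Proof.
rewrite /poly_op op_lin_sum; apply: eq_bigr => i _.
by rewrite op_linZ -iterSr.
Qed.

Lemma poly_opM p q x : poly_op (p * q) T x = poly_op p T (poly_op q T x).
Proof.
elim/poly_ind: p x => [|p c IH] x; first by rewrite mul0r !poly_op0.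
rewrite mulrDl -mulrA ['X * q]mulrC mulrA !poly_opD poly_opMX IH.
by rewrite mul_polyC poly_opZ poly_opC poly_opMX poly_op_commT.
Qed.

Lemma poly_opX x : poly_op 'X T x = T x.
Proof. by rewrite -[X in poly_op X]mul1r poly_opMX poly_op1. Qed.

Lemma poly_op_sum (I : Type) (s : seq I) (P : pred I) (f : I -> {poly R[i]}) x :
  poly_op (\sum_(i <- s | P i) f i) T x = \sum_(i <- s | P i) poly_op (f i) T x.
Proof.
by apply: (big_morph (fun p => poly_op p T x)) => [p q|]; rewrite ?poly_opD ?poly_op0.
Qed.
Lemma poly_opB p q x : poly_op (p - q) T x = poly_op p T x - poly_op q T x.
Proof. by rewrite poly_opD -[- q]scaleN1r poly_opZ scaleN1r. Qed.

Lemma poly_op_comm p q x : poly_op p T (poly_op q T x) = poly_op q T (poly_op p T x).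
Proof. by rewrite -!poly_opM mulrC. Qed.
End poly_op_theory.

(** * Positive polynomials in a self-adjoint operator between 0 and 1 *)

Section positive_calculus.
Variables (R : realType) (H : hilbertType R) (X : H -> H).
Hypothesis Xsa : forall x y, dotp (X x) y = dotp x (X y).
Implicit Types (p q : {poly R}) (x y z : H).

Lemma selfadjoint_linear : linear X.
Proof.
have h := dotp_psd H => a x y; apply: dotp_eqP => z.
by rewrite Xsa !(psd_formDl _ _ _ h) !(psd_formZl _ _ _ h) !Xsa.
Qed.
Let Xl := selfadjoint_linear.

Definition rop p x := poly_op (map_poly (real_complex R) p) X x.

Lemma ropD p q x : rop (p + q) x = rop p x + rop q x.
Proof. by rewrite /rop rmorphD/= poly_opD. Qed.
Lemma ropB p q x : rop (p - q) x = rop p x - rop q x.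
Proof. by rewrite /rop rmorphB/= poly_opB. Qed.
Lemma ropZ (r : R) p x : rop (r%:P * p) x = r%:C%C *: rop p x.
Proof. by rewrite /rop rmorphM/= map_polyC/= mul_polyC poly_opZ. Qed.
Lemma ropM p q x : rop (p * q) x = rop p (rop q x).
Proof. by rewrite /rop rmorphM/= poly_opM. Qed.
Lemma ropX x : rop 'X x = X x.
Proof. by rewrite /rop map_polyX poly_opX. Qed.
Lemma rop1 x : rop 1 x = x.
Proof. by rewrite /rop rmorph1 poly_op1. Qed.
Lemma rop_linear p : linear (rop p).
Proof. exact: poly_op_linear. Qed.

Lemma rop_sa p x y : dotp (rop p x) y = dotp x (rop p y).
Proof.
have h := dotp_psd H.
have iterX n u v : dotp (iter n X u) v = dotp u (iter n X v).
  by elim: n u v => [//|n IH] u v; rewrite [iter _ _ u]iterS Xsa IH [iter _ _ v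
    in RHS]iterSr.
rewrite /rop /poly_op (psd_form_suml h) (psd_form_sumr h).
apply: eq_bigr => i _; rewrite (psd_formZl _ _ _ h) (psd_formZr h) iterX.
by rewrite coef_map/= conj_Creal// complex_real.
Qed.

Definition rform p x : R := re (dotp (rop p x) x).

Lemma rformD p q x : rform (p + q) x = rform p x + rform q x.
Proof. by rewrite /rform ropD (psd_formDl _ _ _ (dotp_psd H)) reD. Qed.
Lemma rformB p q x : rform (p - q) x = rform p x - rform q x.
Proof. by rewrite /rform ropB (psd_formBl (dotp_psd H)) reB. Qed.
Lemma rformZ (r : R) p x : rform (r%:P * p) x = r * rform p x.
Proof. by rewrite /rform ropZ (psd_formZl _ _ _ (dotp_psd H)) reZ. Qed.
Lemma rformM p q x : re (dotp (rop p x) (rop q x)) = rform (p * q) x.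
Proof. by rewrite /rform mulrC ropM [in RHS]rop_sa. Qed.
Lemma rform_sq p x : hsq (rop p x) = rform (p ^+ 2) x.
Proof. by rewrite expr2 -rformM. Qed.

Definition rpos p := forall x, 0 <= rform p x.

Lemma rposD p q : rpos p -> rpos q -> rpos (p + q).
Proof. by move=> hp hq x; rewrite rformD addr_ge0. Qed.
Lemma rposZ (r : R) p : 0 <= r -> rpos p -> rpos (r%:P * p).
Proof. by move=> r0 hp x; rewrite rformZ mulr_ge0. Qed.
Lemma rpos_sqM p q : rpos q -> rpos (p ^+ 2 * q).
Proof.
move=> hq x; have := hq (rop p x).
by rewrite {1}/rform -ropM rformM [p ^+ 2 * q]mulrC expr2 mulrA.
Qed.
Lemma rpos1 : rpos 1.
Proof. by move=> x; rewrite /rform rop1 hsq_ge0. Qed.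
Lemma rpos_sq p : rpos (p ^+ 2).
Proof. by rewrite -[p ^+ 2]mulr1; apply: rpos_sqM; exact: rpos1. Qed.

Hypothesis Xpos : forall x, 0 <= re (dotp (X x) x).
Hypothesis Xcontr : forall x, hsq (X x) <= re (dotp (X x) x).

Lemma rposX : rpos 'X.
Proof. by move=> x; rewrite /rform ropX. Qed.
Lemma rposX1 : rpos ('X * (1 - 'X)).
Proof.
move=> x; rewrite mulrBr mulr1 -expr2 rformB -rform_sq !ropX.
by rewrite /rform ropX subr_ge0.
Qed.
Lemma rpos1X : rpos (1 - 'X).
Proof.
have -> : 1 - 'X = (1 - 'X) ^+ 2 + 'X * (1 - 'X) :> {poly R} by ring.
by apply: rposD rposX1; exact: rpos_sq.
Qed.

(** Even powers form a square, which [rpos_sqM] moves into the vector; the exponents left are 0 or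
    1. These products generate the positive polynomials used for the Okubo-Ando form. *)
Lemma rposXn m n : rpos ('X ^+ m * (1 - 'X) ^+ n).
Proof.
have -> : 'X ^+ m * (1 - 'X) ^+ n =
    ('X ^+ m./2 * (1 - 'X) ^+ n./2) ^+ 2 * ('X ^+ odd m * (1 - 'X) ^+ odd n) :>
      {poly R}.
  rewrite -{1}[m]odd_double_half -{1}[n]odd_double_half !exprD -!muln2 !exprM.
  ring.
apply: rpos_sqM; case: (odd m); case: (odd n); rewrite ?expr0 ?expr1 ?mul1r ?mulr1.
- exact: rposX1.
- exact: rposX.
- exact: rpos1X.
- exact: rpos1.
Qed.

(** Cauchy-Schwarz for the form <p(X) u, v> at [x] and p(X) x gives |p(X) x|^4 <= s^2 |x|^2 |p(X)
    x|^2. *)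
Lemma rop_norm_le p (s : R) : 0 <= s -> rpos p -> rpos (s%:P - p) ->
  forall x, hnorm (rop p x) <= s * hnorm x.
Proof.
move=> s0 hp hsp x; have h := dotp_psd H.
have hb : psd_form (fun u v => dotp (rop p u) v).
  split=> [y a u v|u v|u].
  - by rewrite rop_linear (psd_formDl _ _ _ h) (psd_formZl _ _ _ h).
  - by rewrite rop_sa dotp_conjC.
  have -> : dotp (rop p u) u = (rform p u)%:C%C; last by rewrite lecR hp.
  rewrite RRe_real// CrealE; apply/eqP.
  by rewrite [in LHS]rop_sa -dotp_conjC.
have le u : rform p u <= s * hsq u.
  have := hsp u; rewrite rformB.
  have -> : rform s%:P u = s * hsq u by rewrite -[s%:P]mulr1 rformZ /rform rop1.
  by rewrite subr_ge0.
have := psd_CS hb x (rop p x); rewrite -/(fsq (@dotp R H) (rop p x)).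
have -> : cabs (dotp (rop p x) (rop p x)) = hsq (rop p x).
  by rewrite fsqE// cabs_real ?fsq_ge0.
rewrite /fsq -!/(rform p _) => h1.
have h2 := le x; have h3 := le (rop p x); have h4 := hp x; have h5 := hp (rop p x).
have : hsq (rop p x) ^+ 2 <= (s ^+ 2 * hsq x) * hsq (rop p x).
  apply: le_trans h1 _; apply: le_trans (ler_pM h4 h5 h2 h3) _.
  by rewrite expr2; nra.
rewrite expr2 !hsqE => h6.
have [->|n0] := eqVneq (hnorm (rop p x)) 0; first by rewrite mulr_ge0 ?hnorm_ge0.
have np : 0 < hnorm (rop p x) by rewrite lt_def n0 hnorm_ge0.
rewrite -(@ler_pXn2r _ 2) ?nnegrE ?mulr_ge0 ?hnorm_ge0//.
by rewrite -(ler_pM2r (exprn_gt0 2 np)) exprMn.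
Qed.
End positive_calculus.

(** * The Okubo-Ando form *)

Section okubo_ando.
Variables (R : realType) (H K : hilbertType R) (t : R).
Hypothesis t01 : 0 < t < 1.
Variables (T : H -> H) (V : {linear H -> K}) (P : {linear K -> H}) (U : {linear K
  -> K}).
Hypothesis Tl : linear T.
Hypothesis Viso : forall x y, dotp (V x) (V y) = dotp x y.
Hypothesis VP : adjoint_op V P.
Hypothesis Uun : unitary_op U.
Hypothesis dil : forall n x, (0 < n)%N ->
  iter n T x = (t^-1)%:C%C *: P (iter n U (V x)).

Let hH := dotp_psd H.
Let hK := dotp_psd K.

Definition past : set K := [set w | forall n x, (0 < n)%N ->
  dotp (iter n U (V x)) w = 0].
(* The closed span of the U^n V x, n >= 1, as a double orthogonal complement. *)
Definition future (k : K) := forall w, past w -> dotp k w = 0.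

Let Uiso x y : dotp (U x) (U y) = dotp x y.
Proof. by case: Uun => W [UW UK WK]; rewrite UW UK. Qed.

Let PV x y : dotp (P x) y = dotp x (V y).
Proof. by rewrite dotp_conjC -VP -dotp_conjC. Qed.

Let P_le x : hsq (P x) <= hsq x.
Proof.
have := hsq_ge0 (x - V (P x)).
by rewrite hsqB /hsq /fsq Viso -PV; lra.
Qed.

Lemma future_UV x : future (U (V x)).
Proof. by move=> w pw; exact: (pw 1%N). Qed.

Lemma futureD k l : future k -> future l -> future (k + l).
Proof. by move=> fk fl w pw; rewrite (psd_formDl _ _ _ hK) fk// fl// addr0. Qed.

Lemma future_U k : future k -> future (U k).
Proof.
case: Uun => W [UW UK WK] fk w pw; rewrite UW; apply: fk => n x n0.
have := pw n.+1 x isT; rewrite iterS => <-.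
by rewrite -{2}[w]WK Uiso.
Qed.

(** On the generators U^n V x both sides are t T^(n+1) x by [dil]. To reach the closed span, the
    difference paired with [y] is written as the pairing of [k] with one vector of K, which
    therefore lies in [past]; t^-1 P W V serves as the adjoint of T. *)
Lemma future_PU k : future k -> P (U k) = T (P k).
Proof.
have TE x : T x = (t^-1)%:C%C *: P (U (V x)) by rewrite -(dil x (ltn0Sn 0)).
case: Uun => W [UW UK WK] fk; apply: dotp_eqP => y.
have WU x z : dotp (W x) z = dotp x (U z) by rewrite -{2}[x]WK Uiso.
have tC : ((t^-1)%:C%C : R[i])^* = (t^-1)%:C%C by rewrite conj_Creal// complex_real.
have key x z : dotp (P (U x)) z - dotp (T (P x)) z = dotp x (W (V z) - V
  ((t^-1)%:C%C *: P (W (V z)))).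
  rewrite (psd_formBr hK) PV UW -PV (psd_formZr hH) tC; congr (_ - _).
  by rewrite TE (psd_formZl _ _ _ hH) PV UW -VP.
apply/eqP; rewrite -subr_eq0 key; apply/eqP; apply: fk => n x n0.
rewrite -key -iterS.
have t0 : (t%:C%C : R[i]) != 0 by rewrite (inj_eq (@complexI R) t 0) gt_eqF//;
  case/andP: t01.
have PE m z : (0 < m)%N -> P (iter m U (V z)) = t%:C%C *: iter m T z.
  by move=> m0; rewrite dil// scalerA -rmorphM/= divff ?scale1r// gt_eqF//;
    case/andP: t01.
by rewrite !PE// op_linZ// -iterS subrr.
Qed.

Lemma future_proj : exists j : H -> K, (forall x, future (j x)) /\
  forall k x, future k -> dotp k (V x) = dotp k (j x).
Proof.
have h x : exists k, future k /\ forall l, future l -> dotp l (V x) = dotp l k.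
  have [|l|k fk hk] := @riesz_on_orthogonal _ K past (fun k => dotp k (V x))
    (hnorm (V x)).
  - exact: dotp_scalarl.
  - by rewrite mulrC; exact: dotp_CS.
  - by exists k.
have [j hj] := choice h; exists j; split=> [x|k x fk].
  exact: (hj x).1.
exact: (hj x).2.
Qed.

Section with_projection.
Variable j : H -> K.
Hypothesis jf : forall x, future (j x).
Hypothesis jV : forall k x, future k -> dotp k (V x) = dotp k (j x).

Let X x := P (j x).
Let Xj x y : dotp (X x) y = dotp (j x) (j y).
Proof. by rewrite PV jV. Qed.
Let Xsa x y : dotp (X x) y = dotp x (X y).
Proof. by rewrite Xj [RHS]dotp_conjC Xj -dotp_conjC. Qed.
Let Xpos x : 0 <= re (dotp (X x) x).
Proof. by rewrite Xj hsq_ge0. Qed.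
Let Xcontr x : hsq (X x) <= re (dotp (X x) x).
Proof. by rewrite Xj; exact: P_le. Qed.

(* The form is b = t^2 De / nu at X.  It lies between t^2 and 1, and between
   (1 - x) / (1 - x + ((1 - t) / t)^2 x) and t^2 / x, the second of which T
   pulls back below the first.  The identities behind this are
   nu - t^2 De = ka x mu, nu - x De = (t - x)^2 (1 - x) and
   De - (1 - x) mu = x (t - x)^2. *)
Let ka : R := (1 - t) ^+ 2.
Let x1 : {poly R} := 1 - 'X.
Let De : {poly R} := x1 ^+ 2 + ka%:P * 'X ^+ 2.
Let mu : {poly R} := x1 ^+ 2 + (1 - t ^+ 2)%:P * 'X.
Let nu : {poly R} := (t ^+ 2)%:P * De + ka%:P * ('X * mu).

Local Notation rop := (rop X).
Local Notation rform := (rform X).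
Local Notation rpos := (rpos X).

Let XE u : X u = rop 'X u. Proof. by rewrite ropX. Qed.
Let t0 : 0 < t. Proof. by case/andP: t01. Qed.
Let t1 : t < 1. Proof. by case/andP: t01. Qed.
Let ka0 : 0 < ka. Proof. by rewrite exprn_gt0// subr_gt0. Qed.
Let c1 : 0 <= 1 - t. Proof. by rewrite subr_ge0 ltW. Qed.
Let c2 : 0 <= 2 * t. Proof. by rewrite mulr_ge0// ltW. Qed.
Let ka1 : ka <= 1.
Proof. by rewrite /ka; move: t0 t1; nra. Qed.
Let t21 : 0 <= 1 - t ^+ 2. Proof. by rewrite subr_ge0 expr_le1// ltW. Qed.

Let posXn m n : rpos ('X ^+ m * x1 ^+ n) := rposXn Xsa Xpos Xcontr m n.
Let kaE : ka%:P = (1 - t%:P) ^+ 2 :> {poly R}.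
Proof. by rewrite /ka rmorphXn/= rmorphB/= rmorph1. Qed.
Let t2E : (1 - t ^+ 2)%:P = 1 - t%:P ^+ 2 :> {poly R}.
Proof. by rewrite rmorphB/= rmorph1 rmorphXn/=. Qed.
Let t22E : (t ^+ 2)%:P = t%:P ^+ 2 :> {poly R}.
Proof. by rewrite rmorphXn/=. Qed.

Let c3 : 0 <= 1 - ka. Proof. by rewrite subr_ge0. Qed.

(** [De], [mu] and [nu] have nonnegative coefficients in the products ['X ^+ m * x1 ^+ n].
    Quantifying over all [m] and [n] makes positivity stable under multiplication by each of them,
    so no square roots of operators are needed. *)
Let posDe q : (forall m n, rpos (q * ('X ^+ m * x1 ^+ n))) ->
  forall m n, rpos (De * q * ('X ^+ m * x1 ^+ n)).
Proof.
move=> hq m n.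
have -> : De * q * ('X ^+ m * x1 ^+ n) = q * ('X ^+ m * x1 ^+ n.+2) +
    ka%:P * (q * ('X ^+ m.+2 * x1 ^+ n)) by rewrite /De !exprS; ring.
by apply: rposD (rposZ _ _); rewrite ?(ltW ka0)//; exact: hq.
Qed.
Let posmu q : (forall m n, rpos (q * ('X ^+ m * x1 ^+ n))) ->
  forall m n, rpos (mu * q * ('X ^+ m * x1 ^+ n)).
Proof.
move=> hq m n.
have -> : mu * q * ('X ^+ m * x1 ^+ n) = q * ('X ^+ m * x1 ^+ n.+2) +
    (1 - t ^+ 2)%:P * (q * ('X ^+ m.+1 * x1 ^+ n)) by rewrite /mu !exprS; ring.
by apply: rposD (rposZ _ _) => //; exact: hq.
Qed.
Let pos1 m n : rpos (1 * ('X ^+ m * x1 ^+ n)).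
Proof. by rewrite mul1r. Qed.
Let posnu q : (forall m n, rpos (q * ('X ^+ m * x1 ^+ n))) ->
  forall m n, rpos (nu * q * ('X ^+ m * x1 ^+ n)).
Proof.
move=> hq m n.
have -> : nu * q * ('X ^+ m * x1 ^+ n) = (t ^+ 2)%:P * (De * q * ('X ^+ m * x1 ^+
  n)) +
    ka%:P * (mu * q * ('X ^+ m.+1 * x1 ^+ n)) by rewrite /nu !exprS; ring.
apply: rposD; apply: rposZ; rewrite ?sqr_ge0 ?(ltW ka0)//; first exact: posDe.
exact: posmu.
Qed.

Let nu_surj y : exists z, rop nu z = y.
Proof.
(* A lower bound of [nu] on [0, 1]: nu >= t^2 De and De >= ka ((1 - x)^2 + x^2) >= ka / 2. Hence 0
   <= 1 - nu <= 1 - d, and nu(X) = 1 - (1 - nu)(X) is onto. *)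
pose d : R := t ^+ 2 * ka / 2.
have d0 : 0 < d by rewrite divr_gt0// mulr_gt0// exprn_gt0.
have d1 : d < 1.
  rewrite /d; have : t ^+ 2 <= 1 by move: t21; rewrite subr_ge0.
  have : 0 <= t ^+ 2 by exact: sqr_ge0.
  move: (t ^+ 2) => s; move: ka0 ka1; nra.
have pos1nu : rpos (1 - nu).
  have -> : 1 - nu = (1 - t)%:P * ((2 * t)%:P * ('X ^+ 0 * x1 ^+ 2) +
      (1 - t)%:P * ('X ^+ 0 * x1 ^+ 3)) + (2%:P * ('X ^+ 1 * x1 ^+ 1) +
      (1 - ka)%:P * ('X ^+ 2 * x1 ^+ 0)).
    rewrite /nu /De /mu [(1 - ka)%:P]rmorphB/= kaE t2E t22E !rmorphM/= !rmorphB/=.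
    by rewrite rmorph1 /x1 (rmorph_nat _ 2); ring.
  by do ![apply: rposD => // | apply: rposZ => //]; exact: posXn.
have posnud : rpos ((1 - d)%:P - (1 - nu)).
  have -> : (1 - d)%:P - (1 - nu) = (t ^+ 2)%:P * ((1 - ka)%:P * ('X ^+ 0 * x1 ^+ 2) +
      (ka / 2)%:P * ((1 - 'X - 'X) ^+ 2)) + ka%:P * (mu * 1 * ('X ^+ 1 * x1 ^+ 0)).
    have h2 : (ka / 2)%:P + (ka / 2)%:P = ka%:P :> {poly R}.
      by rewrite -rmorphD/=; congr (_%:P); lra.
    have -> : d = t ^+ 2 * (ka / 2) by rewrite /d mulrA.
    rewrite /nu /De [(1 - _)%:P]rmorphB/= [(1 - ka)%:P]rmorphB/= [(_ *
      _)%:P]rmorphM/= rmorph1 -h2 /x1; ring.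
  apply: rposD; apply: rposZ; rewrite ?sqr_ge0 ?(ltW ka0)//; last exact: posmu.
  apply: rposD; apply: rposZ; rewrite ?subr_ge0 ?divr_ge0 ?(ltW ka0)//.
  exact: rpos_sq.
have d2 : 0 <= 1 - d < 1 by apply/andP; split; move: d0 d1; lra.
have [|z hz] := neumann_surj (rop_linear Xsa (1 - nu)) d2 _ y.
  by apply: rop_norm_le => //; case/andP: d2.
by exists z; move: hz; rewrite ropB// rop1// opprB addrCA subrr addr0.
Qed.

Lemma okubo_ando_aux : exists b : H -> H -> R[i], [/\ psd_form b,
  forall x, t ^+ 2 * hsq x <= fsq b x <= hsq x & forall x, fsq b (T x) <= fsq b x].
Proof.
have [z zP] := choice nu_surj.
have nul := rop_linear Xsa nu.
(* Here [z x] plays the role of nu(X)^-1 x. All comparisons become positivity of polynomial forms at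
   [z x]. *)
pose b x y := (t ^+ 2)%:C%C * dotp (rop De (z x)) y.
have bE x y : b x y = (t ^+ 2)%:C%C * dotp (rop De (z x)) (rop nu (z y)) by
  rewrite zP.
have fE x : fsq b x = t ^+ 2 * rform (De * nu) (z x).
  by rewrite /fsq bE reZ rformM.
have hE x : hsq x = rform (nu ^+ 2) (z x) by rewrite -rform_sq// zP.
have hb : psd_form b.
  have bC x y : b x y = (b y x)^*.
    rewrite !bE conj_realM; congr (_ * _).
    by rewrite -dotp_conjC -[in LHS]rop_sa// -[in RHS]rop_sa// -!ropM// mulrC.
  split=> [y a u v|//|x].
    by rewrite bC {1}/b (psd_formDr hH) (psd_formZr hH) mulrDr mulrCA rmorphD
      rmorphM/= conjCK -!bC.
  have -> : b x x = (fsq b x)%:C%C.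
    by rewrite RRe_real// CrealE -bC.
  rewrite lecR fE mulr_ge0 ?sqr_ge0//.
  by have := posDe (posnu pos1) 0 0 (z x); rewrite !expr0 !mulr1.
exists b; split=> // x.
  rewrite fE hE; apply/andP; split.
    rewrite ler_wpM2l ?sqr_ge0//.
    have -> : De * nu = nu ^+ 2 + (1 - t)%:P * ((2 * t)%:P * (nu * 1 * ('X ^+ 0 *
      x1 ^+ 2)) +
      (1 - t)%:P * (nu * 1 * ('X ^+ 0 * x1 ^+ 3))).
      rewrite /nu /De /mu kaE t2E t22E !rmorphM/= !rmorphB/=.
      by rewrite rmorph1 /x1 (rmorph_nat _ 2); ring.
    by rewrite rformD// lerDl; apply: rposZ => //; apply: rposD; apply: rposZ =>
      //; exact: posnu.
  have -> : nu ^+ 2 = (t ^+ 2)%:P * (De * nu) + ka%:P * (mu * (nu * 1) * ('X ^+ 1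
    * x1 ^+ 0)).
    by rewrite expr2 {1}/nu expr0; ring.
  rewrite rformD// rformZ// lerDl; apply: rposZ; first exact: ltW.
  exact: posmu (posnu pos1) _ _.
pose zx := z x.
(* For U (V a + j w), the relation t a + X w = t x is what makes P of it equal to t T x. Subject to
   it the norm is least at w = t (1 - t) (t^2 (1 - X) + ka X)^-1 x. Replacing that inverse by mu /
   nu keeps everything polynomial at [zx] and still leaves the squared norm below b(x), by the form
   of t^2 ka (x (t - x))^2 mu. *)
pose a := rop (nu - (1 - t)%:P * ('X * mu)) zx.
pose w := rop ((t * (1 - t))%:P * mu) zx.
pose n1 := U (V a + j w).
have fn1 : future n1.
  rewrite /n1 linearD; apply: futureD; [exact: future_UV|exact/future_U/jf].
have Pn1 : P n1 = t%:C%C *: T x.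
  rewrite /n1 !linearD/= [P (U (j w))]future_PU// -/(X w).
  have -> : P (U (V a)) = t%:C%C *: T a.
    have -> : T a = (t^-1)%:C%C *: P (U (V a)) by exact: dil a (ltn0Sn 0).
    by rewrite scalerA -rmorphM/= divff ?scale1r// gt_eqF.
  rewrite -!(op_linZ Tl) -(op_linD Tl); congr T.
  rewrite -(zP x) -/zx /a /w XE -ropM//.
  have -> : 'X * ((t * (1 - t))%:P * mu) = t%:P * ((1 - t)%:P * ('X * mu)).
    by rewrite rmorphM/=; ring.
  by rewrite ropZ// -scalerDr -ropD// subrK.
have n1_le : hsq n1 <= fsq b x.
  have -> : hsq n1 = hsq a + hsq (j w) + 2 * re (dotp (V a) (j w)).
    have -> : hsq n1 = hsq (V a + j w) by rewrite /n1 /hsq /fsq Uiso.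
    by rewrite hsqD; congr (_ + _ + _); rewrite /hsq /fsq Viso.
  have -> : re (dotp (V a) (j w)) = re (dotp (X w) a).
    by rewrite (re_psd_formC hK) -PV.
  have -> : hsq (j w) = re (dotp (X w) w) by rewrite Xj.
  rewrite XE /a /w -ropM// !rformM// rform_sq// fE -!rformZ// -!rformD//.
  rewrite -subr_ge0 -rformB//.
  set p := (X in rform X _).
  have -> : p = (t ^+ 2)%:P * (ka%:P * (('X * (t%:P - 'X)) ^+ 2 * mu)).
    rewrite /p /nu /De /mu kaE t2E t22E !rmorphM/= !rmorphB/=.
    by rewrite rmorph1 /x1 (rmorph_nat _ 2); ring.
  apply: rposZ; rewrite ?sqr_ge0//; apply: rposZ; first exact: ltW.
  apply: rpos_sqM => //.
  by have := posmu pos1 0 0; rewrite !expr0 !mulr1.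
set v := fsq b (T x).
apply: le_trans n1_le.
(* Duality: b(Tx) = t^2 <g, Tx>, and P n1 = t T x with [n1] in [future] turns it into t Re <j g,
   n1>. Since x De <= nu gives t^2 |j g|^2 <= b(Tx), Cauchy-Schwarz yields b(Tx) <= |n1|^2. *)
pose g := rop De (z (T x)).
have v0 : 0 <= v by exact: fsq_ge0.
have vE : v = t * re (dotp (j g) n1).
  rewrite /v /fsq {1}/b reZ -/g; have -> : dotp g (T x) = (t^-1)%:C%C * dotp (j g) n1.
    have -> : T x = (t^-1)%:C%C *: P n1.
      by rewrite Pn1 scalerA -rmorphM/= mulVf ?scale1r// gt_eqF.
    rewrite (psd_formZr hH) conj_Creal ?complex_real//; congr (_ * _).
    by rewrite dotp_conjC PV jV// -dotp_conjC.
  by rewrite reZ mulrA expr2 -[t * t / t]mulrA divff ?mulr1// gt_eqF.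
have g_le : t ^+ 2 * hsq (j g) <= v.
  rewrite /v fE ler_wpM2l ?sqr_ge0//.
  have -> : hsq (j g) = rform ('X * De ^+ 2) (z (T x)).
    by rewrite /hsq /fsq -Xj XE /g -ropM// rformM//; congr (rform _ _); ring.
  rewrite -subr_ge0 -rformB//.
  have -> : De * nu - 'X * De ^+ 2 = (t%:P - 'X) ^+ 2 * (De * 1 * ('X ^+ 0 * x1
    ^+ 1)).
    by rewrite /nu /De /mu kaE t2E t22E /x1; ring.
  by apply: rpos_sqM => //; exact: (posDe pos1 0 1).
have : v ^+ 2 <= v * hsq n1.
  rewrite {1}vE exprMn.
  apply: (@le_trans _ _ (t ^+ 2 * (hsq (j g) * hsq n1))).
    rewrite ler_wpM2l ?sqr_ge0//; apply: le_trans (psd_CS hK _ _).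
    rewrite -real_normK ?num_real// ler_pXn2r ?nnegrE ?cabs_ge0//.
    by rewrite -lecR -cabsE; exact: normc_ge_Re.
  by rewrite mulrA ler_wpM2r ?hsq_ge0.
have [->|vn0] := eqVneq v 0; first by rewrite hsq_ge0.
by rewrite expr2 ler_pM2l// lt_def vn0.
Qed.
End with_projection.

Lemma okubo_ando : exists b : H -> H -> R[i], [/\ psd_form b,
  forall x, t ^+ 2 * hsq x <= fsq b x <= hsq x & forall x, fsq b (T x) <= fsq b x].
Proof. by have [j [jf jV]] := future_proj; exact: okubo_ando_aux jf jV. Qed.
End okubo_ando.

(** * The matrix von Neumann inequality *)

Section gram_diagonalization.
Local Open Scope sesquilinear_scope.
Variables (R : realType) (V : lmodType R[i]) (b : V -> V -> R[i]).
Hypothesis hb : psd_form b.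

(** The form may be degenerate, so the orthogonal family comes from a unitary diagonalization of the
    Gram matrix and is not normalized; null [z k] are allowed. *)
Lemma gram_diagonalization n (y : 'I_n -> V) :
  exists (Q : 'M[R[i]]_n) (z : 'I_n -> V),
    (forall j, y j = \sum_k Q j k *: z k) /\
    (forall k l, k != l -> b (z k) (z l) = 0).
Proof.
pose G := \matrix_(i < n, j < n) b (y i) (y j).
have Gh : G \is hermsymmx.
  apply/is_hermitianmxP; rewrite expr0 scale1r; apply/matrixP => i j.
  by rewrite !mxE -psd_formC.
have /hermitian_normalmx/orthomx_spectralP := Gh.
set P := spectralmx G; set d := spectral_diag G => GE.
have Pu : P \is unitarymx := spectral_unitarymx G.
rewrite invmx_unitary// in GE.
have PP : P *m P ^t* = 1%:M by apply/unitarymxP.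
have PP' : P ^t* *m P = 1%:M by exact: mulmx1C.
exists (P ^t*), (fun k => \sum_j P k j *: y j); split.
  move=> j; under eq_bigr do rewrite scaler_sumr.
  rewrite exchange_big/= (bigD1 j)//= [X in _ + X]big1 ?addr0 => [|i ij].
    under eq_bigr do rewrite scalerA.
    rewrite -scaler_suml; have /matrixP/(_ j j) := PP'.
    by rewrite !mxE eqxx => ->; rewrite scale1r.
  under eq_bigr do rewrite scalerA.
  rewrite -scaler_suml; have /matrixP/(_ j i) := PP'.
  by rewrite !mxE eq_sym (negbTE ij) => ->; rewrite scale0r.
move=> k l kl.
have /matrixP/(_ k l) : P *m G *m P ^t* = diag_mx d.
  by rewrite GE !mulmxA PP mul1mx -mulmxA PP mulmx1.
rewrite [RHS]mxE (negbTE kl) mulr0n => <-.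
rewrite psd_form_suml// !mxE.
under [RHS]eq_bigr do rewrite mxE mulr_suml.
rewrite [RHS]exchange_big/=; apply: eq_bigr => i _.
rewrite psd_form_sumr//; apply: eq_bigr => j _.
by rewrite psd_formZl// psd_formZr// !mxE -mulrA [_^* * _]mulrC.
Qed.

Definition vsq n (v : 'cV[R[i]]_n) : R := \sum_i cabs (v i 0) ^+ 2.

Lemma fsq_orthogonal_sum n (c : 'I_n -> R[i]) (z : 'I_n -> V) :
  (forall k l, k != l -> b (z k) (z l) = 0) ->
  fsq b (\sum_k c k *: z k) = \sum_k cabs (c k) ^+ 2 * fsq b (z k).
Proof.
move=> zo; rewrite {1}/fsq psd_form_suml// re_sum; apply: eq_bigr => k _.
rewrite psd_form_sumr// (bigD1 k)//= big1 ?addr0 => [|l lk].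
  by rewrite psd_formZl// psd_formZr// mulrA cabs_sq reZ.
by rewrite psd_formZl// psd_formZr// zo ?mulr0// eq_sym.
Qed.

(** This carries a bound on C^n over to V^n. In the orthogonal family both sides are sums over [k]
    weighted by [fsq b (z k)], and the scalar bound applies to each column of [Q]. *)
Lemma fsq_mx_le n (A : 'M[R[i]]_n) (M : R) (y : 'I_n -> V) :
  (forall v, vsq (A *m v) <= M * vsq v) ->
  \sum_i fsq b (\sum_j A i j *: y j) <= M * \sum_j fsq b (y j).
Proof.
move=> AM; have [Q [z [yE zo]]] := gram_diagonalization y.
have h (C : 'M[R[i]]_n) : \sum_i fsq b (\sum_j C i j *: y j) =
    \sum_k vsq (C *m col k Q) * fsq b (z k).
  rewrite /vsq; under [RHS]eq_bigr do rewrite mulr_suml.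
  rewrite [RHS]exchange_big/=; apply: eq_bigr => i _.
  have -> : \sum_j C i j *: y j = \sum_k (C *m Q) i k *: z k.
    under eq_bigr do rewrite yE scaler_sumr.
    rewrite exchange_big/=; apply: eq_bigr => k _.
    by rewrite mxE scaler_suml; apply: eq_bigr => j _; rewrite scalerA.
  rewrite fsq_orthogonal_sum//; apply: eq_bigr => k _; congr (_ ^+ 2 * _); congr cabs.
  by rewrite !mxE; apply: eq_bigr => j _; rewrite !mxE.
have -> : \sum_j fsq b (y j) = \sum_i fsq b (\sum_j (1%:M : 'M[R[i]]_n) i j *: y j).
  apply: eq_bigr => i _; rewrite (bigD1 i)//= big1 ?addr0 => [|j ji].
    by rewrite mxE eqxx scale1r.
  by rewrite mxE eq_sym (negbTE ji) scale0r.
rewrite !h mulr_sumr; apply: ler_sum => k _.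
by rewrite mul1mx mulrA ler_wpM2r ?fsq_ge0.
Qed.
End gram_diagonalization.

(** * Parseval's identity and block-circulant matrices on Z/N *)

Section discrete_fourier.
Variable R : realType.

Lemma prim_root_exists n : (0 < n)%N -> exists w : R[i], n.-primitive_root w.
Proof.
pose p : {poly R[i]} := 'X^n - 1; have [r Dp] := closed_field_poly_normal p.
move=> n_gt0; rewrite (monicP _) ?monicXnsubC // scale1r in Dp.
have rn1: all n.-unity_root r by apply/allP=> z; rewrite -root_prod_XsubC -Dp.
have sz_r: (n < (size r).+1)%N.
  by rewrite -(size_prod_XsubC r id) -Dp size_XnsubC.
have [|z] := hasP (has_prim_root n_gt0 rn1 _ sz_r); last by exists z.
by rewrite -separable_prod_XsubC -Dp separable_Xn_sub_1 // pnatr_eq0 -lt0n.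
Qed.

Variables (N' : nat) (w : R[i]).
Local Notation N := N'.+1.
Hypothesis wp : N.-primitive_root w.
Variables (V : lmodType R[i]) (b : V -> V -> R[i]).
Hypothesis hb : psd_form b.

Lemma cabs_unity_root (z : R[i]) : z ^+ N = 1 -> cabs z = 1.
Proof.
move=> zN; have : cabs z ^+ N = 1 by rewrite -cabsX zN cabs1.
by move/eqP; rewrite pexpr_eq1 ?cabs_ge0// => /eqP.
Qed.

Let chi (l j : nat) : R[i] := w^-1 ^+ (l * j).

Let wN : w ^+ N = 1 := prim_expr_order wp.
Let w0 : w != 0.
Proof. by rewrite (prim_root_eq0 wp). Qed.
Let wV : w^-1 = w^*.
Proof.
apply: (mulfI w0); rewrite mulfV// cabs_sq (cabs_unity_root wN).
by rewrite expr1n.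
Qed.

Let chi_orth (j k : 'I_N) : \sum_(l < N) chi l j * (chi l k)^* = N%:R *+ (j == k).
Proof.
pose z := w ^+ k * w^-1 ^+ j.
have -> : \sum_(l < N) chi l j * (chi l k)^* = \sum_(l < N) z ^+ l.
  apply: eq_bigr => l _; rewrite /chi wV rmorphXn/= conjCK -wV /z exprMn -!exprM.
  by rewrite mulrC ![(l * _)%N]mulnC.
case: (eqVneq j k) => [jk|jk].
  rewrite mulr1n; have -> : z = 1 by rewrite /z jk -exprMn mulfV// expr1n.
  by under eq_bigr do rewrite expr1n; rewrite sumr_const card_ord.
rewrite mulr0n; apply/eqP.
have z1 : z != 1.
  apply: contra jk; rewrite /z exprVn -[X in _ == X](mulfV (expf_neq0 j w0)).
  rewrite (inj_eq (mulIf _)) ?invr_eq0 ?expf_neq0//.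
  by rewrite (eq_prim_root_expr wp) !modn_small// eq_sym.
have : (z - 1) * \sum_(l < N) z ^+ l == 0.
  rewrite -subrX1 /z exprMn -!exprM ![(_ * N)%N]mulnC !exprM wN.
  by rewrite exprVn wN invr1 !expr1n mulr1 subrr.
by rewrite mulf_eq0 subr_eq0 (negbTE z1).
Qed.

Let dft (x : 'I_N -> V) (l : nat) : V := \sum_(j < N) chi l j *: x j.

Let parseval (x : 'I_N -> V) :
  \sum_(l < N) fsq b (dft x l) = N%:R * \sum_(j < N) fsq b (x j).
Proof.
have -> : \sum_(l < N) fsq b (dft x l) =
    re (\sum_(j < N) \sum_(k < N) (\sum_(l < N) chi l j * (chi l k)^*) * b (x j)
      (x k)).
  rewrite /fsq -re_sum; congr re.
  under [RHS]eq_bigr do under eq_bigr do rewrite mulr_suml.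
  under [RHS]eq_bigr do rewrite exchange_big/=.
  rewrite [RHS]exchange_big/=; apply: eq_bigr => l _.
  rewrite /dft psd_form_suml//; apply: eq_bigr => j _.
  rewrite psd_form_sumr//; apply: eq_bigr => k _.
  by rewrite psd_formZl// psd_formZr// mulrA.
rewrite re_sum mulr_sumr; apply: eq_bigr => j _.
rewrite (bigD1 j)//= [X in _ + X]big1 ?addr0 => [|k kj].
  rewrite chi_orth eqxx mulr1n.
  by rewrite (_ : N%:R = (N%:R : R)%:C%C) ?reZ// rmorph_nat.
by rewrite chi_orth eq_sym (negbTE kj) mul0r.
Qed.

(** The index [j + m] is taken modulo N. The Fourier transform turns the block-circulant operator
    into multiplication, at frequency [l], by the symbol at [w ^+ l], where [fsq_mx_le] applies;
    Parseval's identity is used on both sides. *)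
Lemma circulant_le n (G : 'I_N -> 'M[R[i]]_n) (M : R) (x : 'I_N -> 'I_n -> V) :
  (forall z : R[i], z ^+ N = 1 -> forall v,
    vsq ((\sum_(m < N) z ^+ m *: G m) *m v) <= M * vsq v) ->
  \sum_(j < N) \sum_i fsq b (\sum_(m < N) \sum_k G m i k *: x (j + m) k) <=
  M * \sum_(j < N) \sum_k fsq b (x j k).
Proof.
move=> GM; pose y i j := \sum_(m < N) \sum_k G m i k *: x (j + m) k.
have N0 : 0 < (N%:R : R) by rewrite ltr0n.
rewrite -(ler_pM2l N0) mulrCA [X in N%:R * X]exchange_big [X in _ <= _ * (_ *
  X)]exchange_big/=.
rewrite !mulr_sumr.
under eq_bigr do rewrite -(parseval (y _)).
under [X in _ <= X]eq_bigr do rewrite -parseval.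
rewrite -mulr_sumr exchange_big [X in _ <= _ * X]exchange_big/= mulr_sumr.
apply: ler_sum => l _.
have yE i : dft (y i) l = \sum_k (\sum_(m < N) (w ^+ l) ^+ m *: G m) i k *: dft
  (x^~ k) l.
  rewrite /dft /y; under eq_bigr do rewrite scaler_sumr.
  rewrite exchange_big/=.
  have -> : \sum_k (\sum_(m < N) (w ^+ l) ^+ m *: G m) i k *: \sum_(j < N) chi l
    j *: x j k
      = \sum_(m < N) \sum_k ((w ^+ l) ^+ m * G m i k) *: \sum_(j < N) chi l j *:
        x j k.
    rewrite exchange_big/=; apply: eq_bigr => k _; rewrite -scaler_suml; congr (_
      *: _).
    by rewrite summxE; apply: eq_bigr => m _; rewrite mxE.
  apply: eq_bigr => m _.
  under eq_bigr do rewrite scaler_sumr.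
  rewrite exchange_big/=; apply: eq_bigr => k _.
  rewrite [in RHS](reindex_inj (addIr m))/= scaler_sumr.
  apply: eq_bigr => j _; rewrite !scalerA; congr (_ *: _).
  rewrite -mulrA [_ * (G m i k * _)]mulrCA mulrC; congr (_ * _).
  have wlm : w^-1 ^+ l ^+ N = 1 by rewrite -exprM mulnC exprM exprVn wN invr1 expr1n.
  rewrite /chi !exprM /= (expr_mod _ wlm) exprD mulrCA -exprMn.
  by rewrite exprVn mulfV ?expf_neq0// expr1n mulr1.
under eq_bigr do rewrite yE.
apply: fsq_mx_le => // v; apply: GM.
by rewrite -exprM mulnC exprM wN expr1n.
Qed.
End discrete_fourier.

Section von_neumann.
Variables (R : realType) (H : hilbertType R) (b : H -> H -> R[i]).
Hypothesis hb : psd_form b.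
Variable S : H -> H.
Hypothesis Sl : linear S.
Hypothesis Sb : forall x, fsq b (S x) <= fsq b x.

Let defect x y := b x y - b (S x) (S y).

Let defect_psd : psd_form defect.
Proof.
split=> [y a u v|x y|x].
- rewrite /defect Sl !(psd_formDl _ _ _ hb) !(psd_formZl _ _ _ hb); ring.
- by rewrite /defect rmorphB/= -!psd_formC.
- by rewrite /defect !fsqE// -rmorphB/= lecR subr_ge0.
Qed.

Let telescope_defect j x :
  fsq b (iter j S x) + \sum_(p < j) fsq defect (iter p S x) = fsq b x.
Proof.
elim: j => [|j IH]; first by rewrite big_ord0 addr0.
rewrite big_ord_recr/= -[RHS]IH.
have -> : fsq defect (iter j S x) = fsq b (iter j S x) - fsq b (S (iter j S x)).
  by rewrite /fsq /defect reB.
ring.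
Qed.

(** The forms on the coordinates of the isometric dilation W of [S]: coordinate 0 carries [b], every
    later one the defect form. The vector W^j x has coordinate S^(j-i) x for i <= j and 0 beyond,
    and [telescope_form] says that W^j preserves the norm. *)
Let form (i : nat) := if i == 0%N then b else defect.
Let form_psd i : psd_form (form i).
Proof. by rewrite /form; case: eqP. Qed.

Let telescope_form j x :
  \sum_(i < j.+1) fsq (form i) (iter (j - i) S x) = fsq b x.
Proof.
rewrite big_ord_recl/= subn0 -[RHS](telescope_defect j); congr (_ + _).
rewrite (reindex_inj rev_ord_inj)/=; apply: eq_bigr => i _.
rewrite /bump/= add1n subnS.
by congr (fsq defect (iter _ S x)); have := ltn_ord i; lia.
Qed.

(** [circulant_le] is applied in each coordinate to the weighted orbit l^j W^j h_k, j < N. For j < N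
    - d the index [j + m] does not wrap around, and the output is l^j W^j u with u_e the sum of l^m
    G_m S^m h_k; the other outputs are dropped. The weights move a bound on the unit circle to the
    argument l S, at the cost of l^(2N'). *)
Lemma von_neumann_finite n d N' (G : nat -> 'M[R[i]]_n) (M l : R) (h : 'I_n -> H) :
  1 <= l -> 0 <= M -> (forall m, (d <= m)%N -> G m = 0) -> (d <= N')%N ->
  (forall z : R[i], cabs z = 1 -> forall v,
    vsq ((\sum_(m < d) z ^+ m *: G m) *m v) <= M * vsq v) ->
  (N'.+1 - d)%:R * \sum_i fsq b (\sum_(m < d) \sum_k (l%:C%C ^+ m * G m i k) *:
    iter m S (h k))
  <= N'.+1%:R * l ^+ (2 * N') * M * \sum_k fsq b (h k).
Proof.
move=> l1 M0 Gd dN GM; set N := N'.+1.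
have [w wp] := prim_root_exists R (ltn0Sn N').
pose x (i : nat) (j : 'I_N) (k : 'I_n) : H :=
  if (i <= j)%N then l%:C%C ^+ j *: iter (j - i) S (h k) else 0.
pose y i j e := \sum_(m < N) \sum_k G m e k *: x i (j + m) k.
pose u e := \sum_(m < d) \sum_k (l%:C%C ^+ m * G m e k) *: iter m S (h k).
have l0 : 0 <= l by lra.
have lX j : l%:C%C ^+ j = (l ^+ j)%:C%C by rewrite rmorphXn.
have step i : \sum_(j < N) \sum_e fsq (form i) (y i j e) <=
    M * \sum_(j < N) \sum_k fsq (form i) (x i j k).
  apply: (circulant_le wp (form_psd i)) => z zN v.
  have -> : \sum_(m < N) z ^+ m *: G m = \sum_(m < d) z ^+ m *: G m.
    rewrite (big_ord_widen N (fun m => z ^+ m *: G m) (leqW dN)) [RHS]big_mkcond.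
    by apply: eq_bigr => m _; case: ltnP => // /Gd ->; rewrite scaler0.
  by apply: GM; exact: cabs_unity_root zN.
have xsum : \sum_(i < N) \sum_(j < N) \sum_k fsq (form i) (x i j k) <=
    N%:R * l ^+ (2 * N') * \sum_k fsq b (h k).
  rewrite exchange_big/=.
  have -> : N%:R * l ^+ (2 * N') * \sum_k fsq b (h k) =
      \sum_(j < N) l ^+ (2 * N') * \sum_k fsq b (h k).
    by rewrite sumr_const card_ord -mulrA mulr_natl.
  apply: ler_sum => j _; rewrite exchange_big/= mulr_sumr; apply: ler_sum => k _.
  have -> : \sum_(i < N) fsq (form i) (x i j k) =
      \sum_(i < j.+1) l ^+ (2 * j) * fsq (form i) (iter (j - i) S (h k)).
    rewrite (big_ord_widen N (fun i : nat => l ^+ (2 * j) * fsq (form i) (iter (j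
      - i) S (h k))) (ltn_ord j)).
    rewrite [RHS]big_mkcond/=; apply: eq_bigr => i _; rewrite /x ltnS.
    by case: leqP => ij; rewrite ?fsq0// lX fsqZr// -exprM mulnC.
  rewrite -mulr_sumr telescope_form ler_wpM2r ?fsq_ge0//.
  by rewrite ler_weXn2l// leq_mul2l/= -ltnS ltn_ord.
have ysum : (N - d)%:R * \sum_e fsq b (u e) <=
    \sum_(i < N) \sum_(j < N) \sum_e fsq (form i) (y i j e).
  rewrite exchange_big/=.
  have le1 : \sum_(j < N | (j < N - d)%N) \sum_(i < N) \sum_e fsq (form i) (y i j
    e) <=
      \sum_(j < N) \sum_(i < N) \sum_e fsq (form i) (y i j e).
    rewrite big_mkcond; apply: ler_sum => j _; case: ifP => // _.
    by apply: sumr_ge0 => i _; apply: sumr_ge0 => e _; exact: fsq_ge0.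
  apply: le_trans le1.
  have -> : (N - d)%:R * \sum_e fsq b (u e) =
      \sum_(j < N | (j < N - d)%N) \sum_e fsq b (u e).
    rewrite -(big_ord_widen N (fun=> \sum_e fsq b (u e)) (leq_subr d N)).
    by rewrite sumr_const card_ord mulr_natl.
  apply: ler_sum => j jd; rewrite exchange_big/=; apply: ler_sum => e _.
  have -> : fsq b (u e) = \sum_(i < j.+1) fsq (form i) (iter (j - i) S (u e)).
    by rewrite telescope_form.
  rewrite (big_ord_widen N (fun i : nat => fsq (form i) (iter (j - i) S (u e)))
    (ltn_ord j)).
  rewrite big_mkcond; apply: ler_sum => i _; rewrite ltnS; case: leqP => ij; last
    exact: fsq_ge0.
  have -> : y i j e = (l ^+ j)%:C%C *: iter (j - i) S (u e).
    have itl := iter_linear Sl (j - i).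
    rewrite /u (op_lin_sum itl) scaler_sumr.
    have sm m : (m < d)%N -> (j + m < N)%N by move=> md; move: jd; rewrite
      ltn_subRL addnC; lia.
    rewrite /y.
    have -> : \sum_(m < N) \sum_k G m e k *: x i (j + m) k =
      \sum_(m < d) \sum_k G m e k *: (l%:C%C ^+ (j + m) *: iter (j + m - i) S (h k)).
      rewrite (big_ord_widen N (fun m : nat => \sum_k G m e k *: (l%:C%C ^+ (j +
        m) *: iter (j + m - i) S (h k))) (leqW dN)).
      rewrite [RHS]big_mkcond/=; apply: eq_bigr => m _; case: ltnP => [md|/Gd ->].
        apply: eq_bigr => k _; rewrite /x /= modn_small ?sm//.
        by rewrite (leq_trans ij (leq_addr _ _)).
      by rewrite big1// => k _; rewrite mxE scale0r.
    apply: eq_bigr => m _; rewrite (op_lin_sum itl) scaler_sumr.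
    apply: eq_bigr => k _; rewrite (op_linZ itl) -iterD !scalerA -lX.
    rewrite exprD; congr (_ *: iter _ S _); first by rewrite mulrC -mulrA.
    by lia.
  rewrite fsqZr//; apply: ler_peMl; first exact: fsq_ge0.
  by rewrite -exprM exprn_ege1.
apply: le_trans ysum _.
apply: (@le_trans _ _ (\sum_(i < N) M * \sum_(j < N) \sum_k fsq (form i) (x i j k))).
  by apply: ler_sum => i _.
rewrite -mulr_sumr mulrAC [_ * M]mulrC ler_wpM2l//.
Qed.
End von_neumann.

(** * Toeplitz forms and dilations *)

Section storage_inequality.
Variables (R : realType) (V : lmodType R[i]) (d b : V -> V -> R[i]) (t C : R).
Hypotheses (hd : psd_form d) (hb : psd_form b).
Hypothesis t01 : 0 < t <= 1.
Hypotheses (C1 : 1 <= C) (CE : C ^+ 2 - (1 + t ^+ 2) * C = 1 - 2 * t).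
Hypothesis dlb : forall x, t ^+ 2 * fsq d x <= fsq b x.
Hypothesis dub : forall x, fsq b x <= fsq d x.

(** Multiplied by 1 - t^2, the right side minus the left side is (d - b)(v1) + (b - t^2 d)(v2) with
    v1 = al u - ga g and v2 = ga u - al g. The mixed terms of [b] cancel because both products are
    al ga, and [CE] makes al ga = C (1 - t), as the mixed term of [d] requires. At t = 1 the factor
    vanishes, but then C = 1 and b = d. *)
Lemma storage_le u g : C * (fsq b u - fsq b g) <=
  C ^+ 2 * fsq d u - 2 * (1 - t) * C * re (d g u) + (1 - 2 * t) * fsq d g.
Proof.
have /andP[t0] := t01; rewrite le_eqVlt => /orP[/eqP t1|t1].
  have C_1 : C = 1.
    move: CE; rewrite t1 => h; have : (C - 1) ^+ 2 = 0.
      have -> : (C - 1) ^+ 2 = C ^+ 2 - (1 + 1 ^+ 2) * C + 1 by ring.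
      by rewrite h; ring.
    by move/eqP; rewrite sqrf_eq0 subr_eq0 => /eqP.
  have e x : fsq b x = fsq d x by apply/eqP; rewrite eq_le dub; have := dlb x;
    rewrite t1 expr1n mul1r => ->.
  by rewrite !e C_1 t1 le_eqVlt; apply/orP; left; apply/eqP; ring.
have t2 : t ^+ 2 < 1 by rewrite expr_lt1// ltW.
have a0 : 0 <= C ^+ 2 - C * t ^+ 2 by rewrite expr2 -mulrBr mulr_ge0 ?subr_ge0
  ?(le_trans (ltW t2))// (le_trans _ C1).
have c0 : 0 <= C ^+ 2 - C.
  by rewrite expr2 -{3}[C]mulr1 -mulrBr mulr_ge0 ?subr_ge0// (le_trans _ C1).
pose al := Num.sqrt (C ^+ 2 - C * t ^+ 2); pose ga := Num.sqrt (C ^+ 2 - C).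
have alE : al ^+ 2 = C ^+ 2 - C * t ^+ 2 by rewrite sqr_sqrtr.
have gaE : ga ^+ 2 = C ^+ 2 - C by rewrite sqr_sqrtr.
have agE : al * ga = C * (1 - t).
  rewrite -sqrtrM//.
  have -> : (C ^+ 2 - C * t ^+ 2) * (C ^+ 2 - C) = (C * (1 - t)) ^+ 2.
    have -> : (C ^+ 2 - C * t ^+ 2) * (C ^+ 2 - C) = C ^+ 2 * ((C ^+ 2 - (1 + t
      ^+ 2) * C) + t ^+ 2) by ring.
    by rewrite CE; ring.
  by rewrite sqrtr_sqr ger0_norm// mulr_ge0 ?subr_ge0 ?(ltW t1)// (le_trans _ C1).
pose v1 := al%:C%C *: u - ga%:C%C *: g; pose v2 := ga%:C%C *: u - al%:C%C *: g.
have exp f (hf : psd_form f) (r s : R) :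
    fsq f (r%:C%C *: u - s%:C%C *: g) = r ^+ 2 * fsq f u + s ^+ 2 * fsq f g - 2 *
      (r * s) * re (f g u).
  rewrite fsqB// !fsqZr// psd_formZl// psd_formZr// (_ : (s%:C%C : R[i])^* = s%:C%C).
    by rewrite !reZ (re_psd_formC hf u g); ring.
  by rewrite conj_Creal// complex_real.
have h1 := dub v1; have h2 := dlb v2.
rewrite /v1 /v2 !exp// [ga * al]mulrC agE alE gaE in h1 h2.
rewrite -(ler_pM2l (_ : 0 < 1 - t ^+ 2)) ?subr_gt0//.
rewrite -CE.
move: h1 h2; move: (fsq d u) (fsq d g) (fsq b u) (fsq b g) (re (d g u)) (re (b g u)).
move: (t ^+ 2) => s du dg bu bg rd rb h1 h2.
by lra.
Qed.
End storage_inequality.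

Lemma absz_shift (i : int) (m : nat) : (absz i <= m)%N ->
  (absz (i + m%:Z))%:Z = i + m%:Z /\ (absz (i + m%:Z)%R < (m + m).+1)%N.
Proof. by lia. Qed.

Section toeplitz.
Variables (R : realType) (H : hilbertType R) (S : H -> H) (t : R).
Hypothesis Sl : linear S.
Implicit Types (x y z : H).

Let hH := dotp_psd H.

(** The values that <U^d V x, V y> must take for a unitary dilation with constant 1/t: the kernel
    <T_d x, y> with T_0 = 1, T_n = t S^n and T_(-n) the adjoint of T_n. The adjoint is moved onto
    [y]. [Negz n] is -(n+1), whence the exponent [n.+1]. *)
Definition toeplitz (d : int) x y : R[i] :=
  match d with
  | Posz 0 => dotp x y
  | Posz n => t%:C%C * dotp (iter n S x) y
  | Negz n => t%:C%C * dotp x (iter n.+1 S y)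
  end.

Lemma toeplitz_scalarl d y : scalar (fun x => toeplitz d x y).
Proof.
move=> a x z; case: d => [[|n]|n] /=.
- exact: dotp_scalarl.
- rewrite -iterS iter_linear// (psd_formDl _ _ _ hH) (psd_formZl _ _ _ hH) /=; ring.
- rewrite (psd_formDl _ _ _ hH) (psd_formZl _ _ _ hH); ring.
Qed.

Lemma toeplitzC d x y : toeplitz d x y = (toeplitz (- d) y x)^*.
Proof.
case: d => [[|n]|n] /=; first exact: dotp_conjC.
- by rewrite conj_realM -dotp_conjC.
- by rewrite conj_realM -dotp_conjC.
Qed.

Lemma toeplitz0l d y : toeplitz d 0 y = 0.
Proof. by have := toeplitz_scalarl d y (-1) 0 0; rewrite scaler0 addr0 mulN1r
  addNr. Qed.
Lemma toeplitzDl d x z y : toeplitz d (x + z) y = toeplitz d x y + toeplitz d z y.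
Proof. by have := toeplitz_scalarl d y 1 x z; rewrite scale1r mul1r. Qed.
Lemma toeplitzZl d a x y : toeplitz d (a *: x) y = a * toeplitz d x y.
Proof. by have := toeplitz_scalarl d y a x 0; rewrite !addr0 toeplitz0l addr0. Qed.
Lemma toeplitz_suml d (I : Type) (s : seq I) (P : pred I) (f : I -> H) y :
  toeplitz d (\sum_(i <- s | P i) f i) y = \sum_(i <- s | P i) toeplitz d (f i) y.
Proof.
by apply: (big_morph (fun x => toeplitz d x y)) => [x z|]; rewrite ?toeplitzDl
  ?toeplitz0l.
Qed.
Lemma toeplitz_sumr d (I : Type) (s : seq I) (P : pred I) (f : I -> H) y :
  toeplitz d y (\sum_(i <- s | P i) f i) = \sum_(i <- s | P i) toeplitz d y (f i).
Proof.
rewrite toeplitzC toeplitz_suml rmorph_sum/=; apply: eq_bigr => i _.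
by rewrite -toeplitzC.
Qed.

Definition toeplitz_form (s s' : seq (int * H)) : R[i] :=
  \sum_(p <- s) \sum_(q <- s') toeplitz (p.1 - q.1) p.2 q.2.

Definition toeplitz_scale a (s : seq (int * H)) := [seq (p.1, a *: p.2) | p <- s].

Lemma toeplitz_form0l s : toeplitz_form [::] s = 0.
Proof. by rewrite /toeplitz_form big_nil. Qed.
Lemma toeplitz_formDl s1 s2 s : toeplitz_form (s1 ++ s2) s = toeplitz_form s1 s +
  toeplitz_form s2 s.
Proof. by rewrite /toeplitz_form big_cat. Qed.
Lemma toeplitz_formZl a s s' : toeplitz_form (toeplitz_scale a s) s' = a *
  toeplitz_form s s'.
Proof.
rewrite /toeplitz_form /toeplitz_scale big_map mulr_sumr; apply: eq_bigr => p _.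
by rewrite mulr_sumr; apply: eq_bigr => q _; rewrite toeplitzZl.
Qed.
Lemma toeplitz_formC s s' : toeplitz_form s s' = (toeplitz_form s' s)^*.
Proof.
rewrite /toeplitz_form exchange_big rmorph_sum/=; apply: eq_bigr => p _.
by rewrite rmorph_sum/=; apply: eq_bigr => q _; rewrite toeplitzC opprB.
Qed.

Definition toeplitz_positive := forall L (h : nat -> H),
  0 <= re (\sum_(i < L) \sum_(j < L) toeplitz ((i : nat)%:Z - (j : nat)%:Z) (h i)
    (h j)).

(** The times in [s] may be negative and repeated. The kernel depends only on differences, so the
    times are shifted by a common [m] into [0, 2m], and vectors with equal time are added. *)
Lemma toeplitz_form_ge0 : toeplitz_positive -> forall s, 0 <= toeplitz_form s s.
Proof.
move=> pos s.
have -> : toeplitz_form s s = (re (toeplitz_form s s))%:C%C.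
  by rewrite RRe_real// CrealE -toeplitz_formC.
rewrite lecR.
pose m : nat := \sum_(p <- s) absz p.1.
pose c (p : int * H) : nat := absz (p.1 + m%:Z).
pose L := (m + m).+1.
have cP p : p \in s -> (c p)%:Z = p.1 + m%:Z /\ (c p < L)%N.
  move=> ps; have : (absz p.1 <= m)%N by rewrite /m (big_rem p)//= leq_addr.
  exact: absz_shift.
pose h a := \sum_(p <- s | c p == a) p.2.
suff -> : toeplitz_form s s = \sum_(i < L) \sum_(j < L) toeplitz ((i : nat)%:Z -
  (j : nat)%:Z) (h i) (h j).
  exact: pos.
under eq_bigr do under eq_bigr do rewrite /h toeplitz_suml.
have -> : \sum_(i < L) \sum_(j < L) \sum_(p <- s | c p == i)
     toeplitz ((i : nat)%:Z - (j : nat)%:Z) p.2 (\sum_(q <- s | c q == j) q.2) =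
   \sum_(p <- s) \sum_(q <- s) \sum_(i < L | c p == i) \sum_(j < L | c q == j)
     toeplitz ((i : nat)%:Z - (j : nat)%:Z) p.2 q.2.
  under eq_bigr do rewrite exchange_big/=.
  rewrite (exchange_big_dep xpredT)//=; apply: eq_bigr => p _.
  rewrite [RHS]exchange_big/=; apply: eq_bigr => i _.
  under eq_bigr do rewrite toeplitz_sumr.
  by rewrite (exchange_big_dep xpredT).
rewrite /toeplitz_form !big_seq; apply: eq_bigr => p ps.
rewrite [RHS]big_seq [LHS]big_seq; apply: eq_bigr => q qs.
have [pE pL] := cP _ ps; have [qE qL] := cP _ qs.
rewrite (big_pred1 (Ordinal pL))/=; last first.
  by move=> i; rewrite /= -val_eqE/= eq_sym.
rewrite (big_pred1 (Ordinal qL))/=; last first.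
  by move=> i; rewrite /= -val_eqE/= eq_sym.
by rewrite pE qE; congr toeplitz; ring.
Qed.
End toeplitz.

Section toeplitz_positivity.
Variables (R : realType) (H : hilbertType R) (S : H -> H) (t C : R).
Hypothesis Sl : linear S.
Variable b : H -> H -> R[i].
Hypothesis hb : psd_form b.
Hypothesis t01 : 0 < t <= 1.
Hypotheses (C1 : 1 <= C) (CE : C ^+ 2 - (1 + t ^+ 2) * C = 1 - 2 * t).
Hypothesis dlb : forall x, t ^+ 2 * hsq x <= fsq b x.
Hypothesis dub : forall x, fsq b x <= hsq x.
Hypothesis Sb : forall x, C ^+ 2 * fsq b (S x) <= fsq b x.

Local Arguments toeplitz : simpl never.

Lemma toeplitz_positivity : toeplitz_positive S t.
Proof.
have hH := dotp_psd H; have C0 : 0 < C := lt_le_trans ltr01 C1.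
move=> L h.
(* Positivity alone would not pass through the induction; [b] stores what the later vectors
   contribute. In this section [S] already includes the division by C. *)
suff : fsq b (\sum_(i < L) iter i S (h i)) <=
    C * re (\sum_(i < L) \sum_(j < L) toeplitz S t ((i : nat)%:Z - (j : nat)%:Z)
      (h i) (h j)).
  by move/(le_trans (fsq_ge0 hb _)); rewrite pmulr_rge0.
elim: L h => [|L IH] h; first by rewrite !big_ord0 fsq0// mulr0.
pose h' n := h n.+1; pose u := \sum_(i < L) iter i S (h' i).
have uE : \sum_(i < L.+1) iter i S (h i) = h 0%N + S u.
  rewrite big_ord_recl /= (op_lin_sum Sl); congr (_ + _).
have Su : dotp (S u) (h 0%N) = \sum_(i < L) dotp (iter i.+1 S (h i.+1)) (h 0%N).
  by rewrite (op_lin_sum Sl) (psd_form_suml hH).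
have tE : re (\sum_(i < L.+1) \sum_(j < L.+1) toeplitz S t ((i : nat)%:Z - (j :
  nat)%:Z) (h i) (h j)) =
    re (\sum_(i < L) \sum_(j < L) toeplitz S t ((i : nat)%:Z - (j : nat)%:Z) (h'
      i) (h' j)) +
    hsq (h 0%N) + 2 * t * re (dotp (S u) (h 0%N)).
  rewrite big_ord_recl big_ord_recl /= subrr.
  under [X in _ + X]eq_bigr do rewrite big_ord_recl/=.
  rewrite big_split/= !reD -[re (toeplitz S t 0 _ _)]/(hsq (h 0%N)).
  have -> : \sum_(i < L) toeplitz S t ((bump 0 i)%:Z - 0) (h (bump 0 i)) (h 0%N) =
      t%:C%C * dotp (S u) (h 0%N).
    by rewrite Su mulr_sumr; apply: eq_bigr => i _; rewrite /bump/= add1n subr0.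
  have -> : re (\sum_(i < L) toeplitz S t (0 - (bump 0 i)%:Z) (h 0%N) (h (bump 0
    i))) =
      re (t%:C%C * dotp (S u) (h 0%N)).
    rewrite Su mulr_sumr !re_sum; apply: eq_bigr => i _.
    by rewrite /bump/= add1n sub0r -NegzE /toeplitz !reZ (re_psd_formC hH).
  have -> : \sum_(i < L) \sum_(j < L) toeplitz S t ((bump 0 i)%:Z - (bump 0
    j)%:Z) (h (bump 0 i)) (h (bump 0 j)) =
    \sum_(i < L) \sum_(j < L) toeplitz S t ((i : nat)%:Z - (j : nat)%:Z) (h' i)
      (h' j).
    apply: eq_bigr => i _; apply: eq_bigr => j _; rewrite /bump/= !add1n /h'.
    by congr toeplitz; rewrite !intS; ring.
  by rewrite !reZ; ring.
rewrite uE tE.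
set x := h 0%N; have := IH h'; rewrite -/u; set Q := re _ => {}IH.
(* With g = C S u the right side of [storage_le] collapses to C^2 (|x|^2 + 2 t Re <S u, x>), that is
   C^2 times the increment in [tE]. By [Sb] the term C^2 b(S u) is at most b(u), which the induction
   hypothesis controls. *)
have := storage_le hH hb t01 C1 CE dlb dub (x + S u) (C%:C%C *: S u).
rewrite (psd_formZl _ _ _ hH) reZ !(fsqZr hH) (fsqZr hb) (psd_formDr hH) reD
  -!/(hsq _).
rewrite hsqD (re_psd_formC hH x) -/(hsq (S u)).
have := Sb u.
have -> : re (dotp (S u) (S u)) = hsq (S u) by [].
move: (fsq b (x + S u)) (fsq b (S u)) (fsq b u) (hsq x) (hsq (S u)) (re _) IH.
move=> bxu bsu bu hx hs r h1 h2 h3.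
rewrite -(ler_pM2l C0).
have {}h1 := ler_wpM2l (ltW C0) h1.
have {}h2 := ler_wpM2l (ltW C0) h2.
by lra.
Qed.
End toeplitz_positivity.

Section toeplitz_dilation.
Variables (R : realType) (H : hilbertType R) (S : H -> H) (t : R).
Hypothesis Sl : linear S.
Hypothesis pos : toeplitz_positive S t.
Implicit Types (x y z : H) (s : seq (int * H)).

Definition toeplitz_ip : semi_ip R (seq (int * H)) :=
  SemiIp (toeplitz_form0l S t) (toeplitz_formDl S t) (toeplitz_formZl t Sl)
    (toeplitz_formC S t) (toeplitz_form_ge0 Sl pos).

Definition dilation_space : hilbertType R := completion toeplitz_ip.
Local Notation K := dilation_space.
Implicit Types f g : K.

Definition time_shift (k : int) s := [seq (p.1 + k, p.2) | p <- s].

Lemma time_shift_add k l s : time_shift k (time_shift l s) = time_shift (l + k) s.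
Proof. by rewrite /time_shift -map_comp; apply: eq_map => p /=; rewrite addrA. Qed.

Lemma time_shift0 s : time_shift 0 s = s.
Proof. by rewrite -[RHS]map_id; apply: eq_map => -[i x] /=; rewrite addr0. Qed.

Lemma toeplitz_form_shift k s s' :
  toeplitz_form S t (time_shift k s) s' = toeplitz_form S t s (time_shift (- k) s').
Proof.
rewrite /toeplitz_form big_map; apply: eq_bigr => p _.
rewrite big_map; apply: eq_bigr => q _ /=; congr toeplitz; ring.
Qed.

Lemma shift_limit k u (f : seq (int * H) -> R[i]) : @ip_limit R _ toeplitz_ip u f ->
  @ip_limit R _ toeplitz_ip (fun n => time_shift k (u n)) (f \o time_shift (- k)).
Proof.
move=> [uc uf]; split.
  move=> e /uc[n un]; exists n => i j ni nj; have := un i j ni nj.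
  congr (_ < _); rewrite !ip_sqB /ip_sq /=.
  by rewrite !toeplitz_form_shift !time_shift_add !subrr !time_shift0.
move=> s; apply: clim_ext (uf (time_shift (- k) s)) => n.
by rewrite /= toeplitz_form_shift.
Qed.

Lemma shift_pred k f : val f \o time_shift (- k) \in completion_pred toeplitz_ip.
Proof.
have [u uf] := completion_rep f.
by apply/completion_predP; exists (fun n => time_shift k (u n)); exact: shift_limit.
Qed.

(** The form is invariant under translation, so translating a representing sequence by [k] amounts
    to composing its functional with translation by [- k]. *)
Definition bilateral_shift (k : int) (f : K) : K := Sub (val f \o time_shift (-
  k)) (shift_pred k f).

Lemma bilateral_shift_linear k : linear (bilateral_shift k).
Proof. by move=> a f g; apply: val_inj; apply/funext => s. Qed.

HB.instance Definition _ k :=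
  GRing.isLinear.Build R[i] K K *:%R (bilateral_shift k) (bilateral_shift_linear k).

Lemma bilateral_shiftK k : cancel (bilateral_shift k) (bilateral_shift (- k)).
Proof.
move=> f; apply: val_inj; apply/funext => s /=.
by rewrite time_shift_add opprK subrr time_shift0.
Qed.

Lemma dotp_bilateral_shift k f g :
  dotp (bilateral_shift k f) (bilateral_shift k g) = dotp f g.
Proof.
have [u uf] := completion_rep f; have [v vg] := completion_rep g.
rewrite !completion_dotpE; apply: clim_unique (completion_dotpP uf vg).
apply: clim_ext (@completion_dotpP _ _ _ _ _ (bilateral_shift k f)
  (bilateral_shift k g)
  (shift_limit k uf) (shift_limit k vg)) => n /=.
by rewrite toeplitz_form_shift time_shift_add subrr time_shift0.
Qed.

Lemma bilateral_shift_unitary k : unitary_op (bilateral_shift k).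
Proof.
exists (bilateral_shift (- k)); split; last 1 first.
- by move=> f; rewrite -{1}[k]opprK bilateral_shiftK.
- by move=> f g; rewrite -(dotp_bilateral_shift (- k)) bilateral_shiftK.
- exact: bilateral_shiftK.
Qed.

Definition dilation_incl x : K := completion_inj toeplitz_ip [:: (0, x)].

Lemma dilation_incl_linear : linear dilation_incl.
Proof.
move=> a x y; apply: val_inj; apply/funext => s; rewrite /=.
rewrite !fctE /= /toeplitz_form !big_seq1 scaler_sumr -big_split/=.
by apply: eq_bigr => q _; exact: toeplitz_scalarl.
Qed.

HB.instance Definition _ :=
  GRing.isLinear.Build R[i] H K *:%R dilation_incl dilation_incl_linear.

Lemma dotp_dilation_incl x y : dotp (dilation_incl x) (dilation_incl y) = dotp x y.
Proof. by rewrite dotp_completion_inj/= /toeplitz_form !big_seq1. Qed.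

Lemma dilation_proj_ex f : exists x, forall y, dotp (dilation_incl y) f = dotp y x.
Proof.
apply: (@riesz R H (fun y => dotp (dilation_incl y) f) (hnorm f)).
  by move=> a x y; rewrite dilation_incl_linear; exact: dotp_scalarl.
move=> y; apply: le_trans (dotp_CS _ _) _.
rewrite mulrC ler_wpM2l ?hnorm_ge0//.
rewrite -(@ler_pXn2r _ 2) ?nnegrE ?hnorm_ge0// -!hsqE.
by rewrite /hsq /fsq dotp_dilation_incl.
Qed.

Definition dilation_proj f : H := sval (cid (dilation_proj_ex f)).

Lemma dilation_projP y f : dotp (dilation_incl y) f = dotp y (dilation_proj f).
Proof. exact: svalP (cid (dilation_proj_ex f)) y. Qed.

Lemma dilation_proj_linear : linear dilation_proj.
Proof.
have hH := dotp_psd H; have hK := dotp_psd K.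
move=> a f g; apply: dotp_eqP => y.
rewrite dotp_conjC -dilation_projP [RHS]dotp_conjC; congr (_^*).
rewrite !(psd_formDr hH) !(psd_formZr hH) -!dilation_projP.
by rewrite !(psd_formDr hK) !(psd_formZr hK).
Qed.

HB.instance Definition _ :=
  GRing.isLinear.Build R[i] K H *:%R dilation_proj dilation_proj_linear.

Lemma iter_bilateral_shift n x : iter n (bilateral_shift 1) (dilation_incl x) =
  completion_inj toeplitz_ip [:: (n%:Z, x)].
Proof.
elim: n => [//|n IH]; rewrite iterS IH; apply: val_inj; apply/funext => s /=.
rewrite -toeplitz_form_shift /=; congr (toeplitz_form S t [:: (_, _)] _).
by rewrite addrC -intS.
Qed.

Lemma toeplitz_rho_class : 0 < t -> rho_class t^-1 S.
Proof.
move=> t0; exists K, dilation_incl, dilation_proj, (bilateral_shift 1).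
split; [exact: dotp_dilation_incl|exact: dilation_projP|exact:
  bilateral_shift_unitary|].
move=> n x n0; have hH := dotp_psd H; apply: dotp_eqP => y.
rewrite (psd_formZl _ _ _ hH) iter_bilateral_shift.
have -> : dotp (dilation_proj (completion_inj toeplitz_ip [:: (n%:Z, x)])) y =
    t%:C%C * dotp (iter n S x) y.
  rewrite dotp_conjC -dilation_projP -dotp_conjC dotp_completion_inj/=.
  by rewrite /toeplitz_form !big_seq1; case: n n0 => [//|n] _ /=; rewrite addn0.
by rewrite mulrA -rmorphM/= mulVf ?gt_eqF// mul1r.
Qed.
End toeplitz_dilation.

(** * Rational functions of an operator *)

Section power_bounds.
Variable R : realType.

Lemma expr_close1 (n : nat) (e : R) : 0 < e -> exists l : R, 1 < l /\ l ^+ n <= 1 + e.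
Proof.
move=> e0; have p0 : 0 < (2 : R) ^+ n by rewrite exprn_gt0.
pose s := Num.min 1 (e / 2 ^+ n).
have s0 : 0 < s by rewrite lt_min ltr01 divr_gt0.
have s1 : s <= 1 by rewrite ge_min lexx.
exists (1 + s); split; first by rewrite ltrDl.
(* The chord of the convex function (1 + s)^m over [0, 1]. *)
have h (m : nat) : (1 + s) ^+ m <= 1 + s * (2 ^+ m - 1).
  elim: m => [|m IH]; first by rewrite !expr0 subrr mulr0 addr0.
  have m1 : 1 <= (2 : R) ^+ m by rewrite exprn_ege1// ler1n.
  rewrite !exprS; move: ((1 + s) ^+ m) (2 ^+ m : R) IH m1 => a c h1 h2.
  have h3 : 0 <= s * (1 - s) * (c - 1) by rewrite !mulr_ge0 ?subr_ge0// ltW.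
  have h4 : 0 <= (1 + s) * (1 + s * (c - 1) - a).
    by rewrite mulr_ge0 ?subr_ge0// addr_ge0// ltW.
  by lra.
apply: le_trans (h n) _; rewrite lerD2l.
apply: (@le_trans _ _ (s * 2 ^+ n)); first by rewrite ler_wpM2l ?(ltW s0)// gerBl.
rewrite -ler_pdivlMr//.
by rewrite ge_min lexx orbT.
Qed.

Lemma le_expr_close (n : nat) (a c : R) : 0 <= c ->
  (forall l, 1 < l -> a <= l ^+ n * c) -> a <= c.
Proof.
move=> c0 h; apply/ler_addgt0Pr => e e0.
have p : 0 < c + 1 by lra.
have [l [l1 lE]] := expr_close1 n (divr_gt0 e0 p).
apply: le_trans (h l l1) _; apply: le_trans (ler_wpM2r c0 lE) _.
rewrite mulrDl mul1r lerD2l mulrAC ler_pdivrMr//.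
by rewrite ler_wpM2l ?(ltW e0)// lerDl.
Qed.

Variables (H : hilbertType R) (T : H -> H) (rho : R).
Hypotheses (rho1 : 1 <= rho) (Tb : bounded_op T) (Tr : (rho_radius rho T <= 1)%E).

Let Tl : linear T := Tb.1.
Let rho0 : 0 < rho := lt_le_trans ltr01 rho1.

(** The infimum yields some l' < l for which T / l' has a unitary dilation; the form of T / l' is
    used, at the cost of the factor l^2. *)
Lemma contractive_form (l : R) : 1 < l -> exists b : H -> H -> R[i], [/\ psd_form b,
  forall x, rho^-1 ^+ 2 * hsq x <= fsq b x <= hsq x &
  forall x, fsq b (T x) <= l ^+ 2 * fsq b x].
Proof.
move=> l1.
have : (rho_radius rho T < l%:E)%E by apply: le_lt_trans Tr _; rewrite lte_fin.
move=> /ereal_inf_lt[_ [l' [l'0 cl] <-]]; rewrite lte_fin => l'l.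
set T' := fun x => _ in cl.
have T'l : linear T'.
  by move=> a x y; rewrite /T' Tl scalerDr !scalerA mulrC.
have TE x : T x = l'%:C%C *: T' x.
  by rewrite /T' scalerA divff ?scale1r// (inj_eq (@complexI R) l' 0) gt_eqF.
suff [b [hb bb bT]] : exists b : H -> H -> R[i], [/\ psd_form b,
    forall x, rho^-1 ^+ 2 * hsq x <= fsq b x <= hsq x &
    forall x, fsq b (T' x) <= fsq b x].
  exists b; split=> // x; rewrite TE fsqZr//.
  apply: (@le_trans _ _ (l' ^+ 2 * fsq b x)).
    by rewrite ler_wpM2l ?sqr_ge0.
  by rewrite ler_wpM2r ?fsq_ge0// ler_pXn2r ?nnegrE// ?ltW// (lt_trans l'0).
have [K [V [P [U [Viso VP Uun dil]]]]] := cl.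
(* [okubo_ando] needs t < 1. For rho = 1 the operator T' is the compression of a unitary, hence a
   contraction of the inner product itself. *)
move: rho1; rewrite le_eqVlt => /orP[/eqP r1|r1].
  exists (@dotp R H); split; first exact: dotp_psd.
    by move=> x; rewrite -r1 invr1 expr1n mul1r lexx.
  move=> x; rewrite -!/(hsq _).
  have -> : T' x = P (U (V x)) by have := dil 1%N x isT; rewrite -r1 /= scale1r.
  have Uiso y z : dotp (U y) (U z) = dotp y z.
    by have [W [UW UK WK]] := Uun; rewrite UW UK.
  have <- : hsq (U (V x)) = hsq x by rewrite /hsq /fsq Uiso Viso.
  set k := U _; have := hsq_ge0 (k - V (P k)).
  have h1 : hsq (V (P k)) = hsq (P k) by rewrite /hsq /fsq Viso.
  have h2 : re (dotp k (V (P k))) = hsq (P k).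
    by rewrite (re_psd_formC (dotp_psd K)) VP.
  by rewrite hsqB h1 h2; lra.
apply: (@okubo_ando R H K rho^-1 _ T' V P U) => //.
  by rewrite invr_gt0 rho0/= invf_lt1.
by move=> n x n0; rewrite invrK dil.
Qed.

(** The form depends on [l], but its comparison with the norm does not; the remaining factor l^n
    disappears as [l] tends to 1 with [n] fixed. *)
Lemma power_bounded n x : hnorm (iter n T x) <= rho * hnorm x.
Proof.
apply: (@le_expr_close n) => [|l l1]; first by rewrite mulr_ge0 ?hnorm_ge0// ltW.
have l0 : 0 < l by apply: lt_trans l1.
have [b [hb bb bT]] := contractive_form l1.
have h m : fsq b (iter m T x) <= l ^+ (2 * m) * fsq b x.
  elim: m => [|m IH]; first by rewrite muln0 expr0 mul1r.
  apply: le_trans (bT _) _; rewrite mulnS exprD -mulrA ler_wpM2l ?sqr_ge0//.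
rewrite -(@ler_pXn2r _ 2) ?nnegrE ?hnorm_ge0 ?mulr_ge0 ?exprn_ge0 ?hnorm_ge0
  ?(ltW l0) ?(ltW rho0)//.
rewrite !exprMn -!hsqE -exprM mulnC.
have /andP[h1 _] := bb (iter n T x); have /andP[_ h2] := bb x.
have h3 := le_trans h1 (le_trans (h n) (ler_wpM2l (exprn_ge0 _ (ltW l0)) h2)).
by rewrite mulrCA -ler_pdivrMl ?exprn_gt0// -exprVn.
Qed.
End power_bounds.

(** * Approximate inverses of polynomials without roots in the closed disc *)

Section polynomial_inverse.
Variable R : realType.
Implicit Types (p r d : {poly R[i]}) (z : R[i]) (e : R).

(** A bound on the l1 norm of the coefficients, which controls both r(z) on the closed disc and r(T)
    for a power bounded T. The list of monomials may repeat exponents, so sums are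
    concatenations. *)
Definition coef_sum_le r e := exists s : seq (R[i] * nat),
  r = \sum_(c <- s) c.1 *: 'X^(c.2) /\ \sum_(c <- s) cabs c.1 <= e.

Lemma coef_sum_leD r p e e' : coef_sum_le r e -> coef_sum_le p e' ->
  coef_sum_le (r + p) (e + e').
Proof.
move=> [s [-> hs]] [s' [-> hs']]; exists (s ++ s').
by rewrite !big_cat/= lerD.
Qed.

Lemma coef_sum_leM r a m e : coef_sum_le r e ->
  coef_sum_le (r * (a *: 'X^m)) (e * cabs a).
Proof.
move=> [s [-> hs]]; exists [seq (c.1 * a, (c.2 + m)%N) | c <- s]; split.
  rewrite big_map mulr_suml; apply: eq_bigr => c _ /=.
  by rewrite -scalerAr -scalerAl scalerA exprD mulrC.
rewrite big_map/=; under eq_bigr do rewrite cabsM.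
by rewrite -mulr_suml ler_wpM2r ?cabs_ge0.
Qed.

Lemma coef_sum_le_monomial a m : coef_sum_le (a *: 'X^m) (cabs a).
Proof. by exists [:: (a, m)]; rewrite !big_seq1. Qed.

Lemma coef_sum_leW r e e' : e <= e' -> coef_sum_le r e -> coef_sum_le r e'.
Proof. by move=> ee [s [rE hs]]; exists s; split=> //; exact: le_trans ee. Qed.

Lemma coef_sum_le_eval r e z : coef_sum_le r e -> cabs z <= 1 -> cabs r.[z] <= e.
Proof.
move=> [s [-> hs]] z1; rewrite horner_sum; apply: le_trans (cabs_sum _ _ _) _.
apply: le_trans hs; apply: ler_sum => c _.
rewrite hornerZ hornerXn cabsM cabsX ler_piMr ?cabs_ge0//.
by rewrite exprn_ile1 ?cabs_ge0.
Qed.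

Lemma coef_sum_le_op (H : hilbertType R) (T : H -> H) (M : R) r e x : linear T ->
  (forall n y, hnorm (iter n T y) <= M * hnorm y) -> coef_sum_le r e ->
  0 <= M -> hnorm (poly_op r T x) <= e * M * hnorm x.
Proof.
move=> Tl TM [s [-> hs]] M0; rewrite poly_op_sum//.
apply: le_trans (hnorm_sum _ _ _) _.
apply: (@le_trans _ _ (\sum_(c <- s) cabs c.1 * (M * hnorm x))).
  apply: ler_sum => c _; rewrite poly_opZ// hnormZ ler_wpM2l ?cabs_ge0//.
  suff -> : poly_op 'X^(c.2) T x = iter c.2 T x by [].
  elim: (c.2) => [|n IH]; first by rewrite poly_op1.
  by rewrite exprS poly_opM// poly_opX// IH.
by rewrite -mulr_suml -mulrA ler_wpM2r// mulr_ge0 ?hnorm_ge0.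
Qed.

(** For one root, ['X - z] divides X^m - z^m, and dividing by - z^m gives 1 - z^-m X^m, whose second
    term is small since |z| > 1. The product of two such identities is again of the form 1 minus
    something small. *)
Lemma linear_factors_inverse (zs : seq R[i]) e : 0 < e -> all (fun z => 1 < cabs
  z) zs ->
  exists p r, \prod_(z <- zs) ('X - z%:P) * p = 1 - r /\ coef_sum_le r e.
Proof.
elim: zs e => [|z zs IH] e e0 /=.
  move=> _; exists 1, 0; rewrite big_nil mulr1 subr0; split=> //.
  by exists [::]; rewrite !big_nil ltW.
move=> /andP[z1 zs1].
(* The new remainder r + a X^m - a r X^m has coefficient sum at most e' + e' + e'^2 <= 3 e'. *)
pose e' := Num.min 1 (e / 3).
have e'0 : 0 < e' by rewrite lt_min ltr01 divr_gt0.
have e'1 : e' <= 1 by rewrite ge_min lexx.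
have e'3 : e' <= e / 3 by rewrite ge_min lexx orbT.
have [p [r [pr rs]]] := IH _ e'0 zs1.
have zV : `|(cabs z)^-1| < 1 by rewrite ger0_norm ?invr_ge0 ?cabs_ge0//
  invf_lt1// (lt_trans ltr01).
have /cvgrPdist_lt/(_ _ e'0)[m _ /(_ m (leqnn m))] := cvg_expr zV.
rewrite /= sub0r normrN ger0_norm ?exprn_ge0 ?invr_ge0 ?cabs_ge0// => zm.
have z0 : z ^+ m != 0.
  by rewrite expf_neq0// -cabs_eq0 gt_eqF// (lt_trans ltr01).
pose a := (z ^+ m)^-1.
have am : cabs a < e' by rewrite cabsV cabsX -exprVn.
exists (- a *: (p * (\sum_(i < m) 'X^(m.-1 - i) * z%:P ^+ i))), (r + a *: 'X^m +
  r * (- a *: 'X^m)); split.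
  rewrite big_cons -scalerAr [X in _ *: X](_ : _ = (\prod_(z <- zs) ('X - z%:P) *
    p) * ('X^m - (z ^+ m)%:P)).
    rewrite pr; have -> : - a *: ((1 - r) * ('X^m - (z ^+ m)%:P)) = (1 - r) * (1
      - a *: 'X^m).
      rewrite scalerAr; congr (_ * _).
      by rewrite scalerBr !scaleNr opprK -[a *: (z ^+ m)%:P]mul_polyC -polyCM
        mulVf// addrC.
    rewrite scaleNr; ring.
  rewrite [(z ^+ m)%:P]rmorphXn/= subrXX; ring.
apply: coef_sum_leW (coef_sum_leD (coef_sum_leD rs (coef_sum_le_monomial a m))
  (coef_sum_leM (- a) m rs)).
rewrite cabsN; have := cabs_ge0 a; nra.
Qed.

Lemma approx_inverse d e : (forall z, cabs z <= 1 -> ~~ root d z) -> 0 < e ->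
  exists p r, d * p = 1 - r /\ coef_sum_le r e.
Proof.
move=> dz e0; have [zs dE] := closed_field_poly_normal d.
have l0 : lead_coef d != 0.
  rewrite lead_coef_eq0; apply: contra (dz 0 _) => [/eqP->|]; rewrite ?root0//.
  by rewrite cabs0.
have zs1 : all (fun z => 1 < cabs z) zs.
  apply/allP => z zzs; rewrite ltNge; apply/negP => /dz.
  by rewrite dE rootZ// root_prod_XsubC zzs.
have [p [r [pr rs]]] := linear_factors_inverse e0 zs1.
exists ((lead_coef d)^-1 *: p), r; split=> //.
by rewrite {1}dE -scalerAr -scalerAl scalerA mulVf// scale1r.
Qed.

(** One remainder [r] serves all denominators, so that replacing a matrix F by polynomials
    multiplies it by the single scalar function 1 - r and keeps its norm bound. *)
Lemma approx_inverse_family (I : finType) (d : I -> {poly R[i]}) e :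
  (forall i z, cabs z <= 1 -> ~~ root (d i) z) -> 0 < e ->
  exists (p : I -> {poly R[i]}) r, (forall i, d i * p i = 1 - r) /\ coef_sum_le r e.
Proof.
move=> dz e0; have [|p [r [pr rs]]] := @approx_inverse (\prod_i d i) e _ e0.
  by move=> z z1; rewrite /root horner_prod; apply/prodf_neq0 => i _; exact: dz.
exists (fun i => (\prod_(j | j != i) d j) * p), r; split=> // i.
by rewrite mulrA -pr [in RHS](bigD1 i).
Qed.
End polynomial_inverse.

Section operator_inverse.
Variables (R : realType) (H : hilbertType R) (T : H -> H) (M : R).
Hypotheses (Tl : linear T) (M0 : 0 < M).
Hypothesis TM : forall n y, hnorm (iter n T y) <= M * hnorm y.
Implicit Types (d p r : {poly R[i]}).

Lemma poly_op_bounded p : exists L : R, 0 <= L /\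
  forall x, hnorm (poly_op p T x) <= L * hnorm x.
Proof.
exists (\sum_(i < size p) cabs p`_i * M); split.
  by apply: sumr_ge0 => i _; rewrite mulr_ge0 ?cabs_ge0 ?ltW.
move=> x; apply: le_trans (hnorm_sum _ _ _) _; rewrite mulr_suml.
by apply: ler_sum => i _; rewrite hnormZ -mulrA ler_wpM2l ?cabs_ge0.
Qed.

(** From d p = 1 - r with |r(T)| <= 1/2: the Neumann series makes d(T) onto, and p(T) d(T) = 1 -
    r(T) bounds it from below, so the inverse is bounded. *)
Lemma poly_op_invertible d : (forall z, cabs z <= 1 -> ~~ root d z) ->
  exists B, is_inverse_op (poly_op d T) B.
Proof.
move=> dz; have e0 : 0 < (2 * M)^-1 by rewrite invr_gt0 mulr_gt0.
have [p [r [pr rs]]] := approx_inverse dz e0.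
have rT x : hnorm (poly_op r T x) <= 2^-1 * hnorm x.
  apply: le_trans (coef_sum_le_op x Tl TM rs (ltW M0)) _.
  by rewrite invfM divfK ?gt_eqF.
have dp x : poly_op d T (poly_op p T x) = x - poly_op r T x.
  by rewrite -poly_opM// pr poly_opB// poly_op1.
have h2 : 0 <= (2^-1 : R) < 1 by rewrite invr_ge0 ler0n/= invf_lt1// ltr1n.
have /choice[B BP] : forall y, exists x, poly_op d T x = y.
  move=> y; have [x xy] := neumann_surj (poly_op_linear Tl r) h2 rT y.
  by exists (poly_op p T x); rewrite dp.
have [L [L0 pL]] := poly_op_bounded p.
have lower x : hnorm x <= 2 * L * hnorm (poly_op d T x).
  have := pL (poly_op d T x); rewrite (poly_op_comm Tl) dp.
  have := hnormD (x - poly_op r T x) (poly_op r T x); rewrite subrK.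
  have := rT x; lra.
have inj x : poly_op d T x = 0 -> x = 0.
  move=> x0; apply: hnorm_eq0; apply/eqP; rewrite eq_le hnorm_ge0 andbT.
  by have := lower x; rewrite x0 hnorm0 mulr0.
have BK : cancel (poly_op d T) B.
  move=> x; apply/eqP; rewrite -subr_eq0; apply/eqP; apply: inj.
  by rewrite (op_linB (poly_op_linear Tl d)) BP subrr.
exists B; split=> //; split.
  move=> a x y; rewrite -[RHS]BK; congr B.
  by rewrite poly_op_linear// !BP.
exists (2 * L) => x; rewrite !hnormE -rmorphM/= lecR.
by apply: le_trans (lower _) _; rewrite BP.
Qed.

Lemma inv_opP (A : H -> H) : (exists B, is_inverse_op A B) -> is_inverse_op A
  (inv_op A).
Proof. by move=> [B AB]; rewrite /inv_op; case: xgetP => [C _ //|/(_ B)]. Qed.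

Lemma spectrum_closed_disc : spectrum T `<=` closed_disc (R := R).
Proof.
move=> z /= zs; rewrite /closed_disc/= cabsE -[1]/((1 : R)%:C%C) lecR leNgt.
apply/negP => z1; apply: zs.
have [|B hB] := @poly_op_invertible ('X - z%:P).
  move=> w w1; rewrite root_XsubC; apply: contraTN w1 => /eqP ->.
  by rewrite -ltNge.
exists B; have -> // : (fun x => T x - z *: x) = poly_op ('X - z%:P) T.
by apply/funext => x; rewrite poly_opB// poly_opX// poly_opC.
Qed.
End operator_inverse.

Section polynomial_matrices.
Variables (R : realType) (H : hilbertType R) (T : H -> H).
Hypothesis Tl : linear T.

(** [L] is chosen before [b]: the forms at hand are contracted only up to a factor, and [L] says
    which factor is acceptable. *)
Lemma von_neumann_poly n (G : 'I_n -> 'I_n -> {poly R[i]}) (M e : R) : 0 <= M ->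
  0 < e ->
  (forall z, cabs z < 1 -> forall v, vsq ((\matrix_(i, k) (G i k).[z]) *m v) <= M
    * vsq v) ->
  exists L : R, 1 < L /\ forall b, psd_form b ->
    (forall x, fsq b (T x) <= L ^+ 2 * fsq b x) -> forall h : 'I_n -> H,
    \sum_i fsq b (\sum_k poly_op (G i k) T (h k)) <=
    (1 + e) ^+ 2 * M * \sum_k fsq b (h k).
Proof.
move=> M0 e0 GM.
pose d := (\sum_i \sum_k size (G i k))%N.
have dG i k : (size (G i k) <= d)%N.
  by rewrite /d (bigD1 i)//= (bigD1 k)//= -addnA leq_addr.
(* Large enough that the lost fraction N / (N - d) is at most 1 + e. Then [L] is taken so close to 1
   that L^(4N') costs another 1 + e. *)
pose N' := (d + Num.truncn (d%:R * (1 + e) / e : R))%N.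
have dN : (d <= N')%N by exact: leq_addr.
have NE : N'.+1%:R <= (1 + e) * (N'.+1 - d)%:R :> R.
  rewrite natrB ?leqW//.
  have : d%:R * (1 + e) / e < N'.+1%:R.
    apply: lt_le_trans (truncnS_gt _) _; rewrite ler_nat ltnS; exact: leq_addl.
  rewrite ltr_pdivrMr//; move: (d%:R : R) (N'.+1%:R : R) => a c; lra.
have [L [L1 LE]] := expr_close1 (4 * N') e0.
exists L; split=> // b hb bT h.
have L0 : 0 < L by apply: lt_trans L1.
have LC : (L%:C%C : R[i]) != 0 by rewrite (inj_eq (@complexI R) L 0) gt_eqF.
pose S x := (L^-1)%:C%C *: T x.
have Sl : linear S by move=> a x y; rewrite /S Tl scalerDr !scalerA mulrC.
have Sb x : fsq b (S x) <= fsq b x.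
  rewrite /S fsqZr// exprVn ler_pdivrMl ?exprn_gt0//; exact: bT.
have iS m x : iter m S x = (L^-1)%:C%C ^+ m *: iter m T x.
  elim: m => [|m IH]; first by rewrite expr0 scale1r.
  by rewrite !iterS IH /S (op_linZ Tl) scalerA -exprS.
pose Gm m : 'M[R[i]]_n := \matrix_(i, k) ((L^-1)%:C%C ^+ m * (G i k)`_m).
have Gd m : (d <= m)%N -> Gm m = 0.
  by move=> dm; apply/matrixP => i k; rewrite !mxE nth_default ?mulr0//
    (leq_trans (dG i k)).
have l1 : 1 <= L ^+ 2 by rewrite exprn_ege1// ltW.
have Gb z : cabs z = 1 -> forall v, vsq ((\sum_(m < d) z ^+ m *: Gm m) *m v) <= M
  * vsq v.
  move=> z1 v.
  have -> : \sum_(m < d) z ^+ m *: Gm m = \matrix_(i, k) (G i k).[(L^-1)%:C%C * z].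
    apply/matrixP => i k; rewrite summxE mxE (horner_coef_wide _ (dG i k)).
    by apply: eq_bigr => m _; rewrite !mxE exprMn; ring.
  apply: GM; rewrite cabsM z1 mulr1 cabs_real ?invr_ge0 ?ltW// invf_lt1//.
(* The weight is l = L^2: one factor L undoes S = T / L, the other undoes the replacement of G(z) by
   G(z / L), which brings the unit circle into the open disc where [GM] holds. *)
have := von_neumann_finite hb Sl Sb h l1 M0 Gd dN Gb.
have -> : \sum_i fsq b (\sum_(m < d) \sum_k ((L ^+ 2)%:C%C ^+ m * Gm m i k) *:
  iter m S (h k)) =
    \sum_i fsq b (\sum_k poly_op (G i k) T (h k)).
  apply: eq_bigr => i _; congr (fsq b _); rewrite exchange_big/=; apply: eq_bigr
    => k _.
  rewrite (poly_op_wide _ _ (dG i k)); apply: eq_bigr => m _.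
  rewrite iS scalerA mxE; congr (_ *: _).
  rewrite fmorphV rmorphXn/= exprAC !exprVn.
  by have := expf_neq0 m LC; move: (L%:C%C ^+ m) => c c0; field.
set A := \sum_i _; set Bs := \sum_k _.
have Bs0 : 0 <= Bs by apply: sumr_ge0 => k _; exact: fsq_ge0.
have Nd0 : 0 < (N'.+1 - d)%:R :> R by rewrite ltr0n subn_gt0 ltnS.
rewrite -exprM mulnA -[(2 * 2)%N]/4%N => h1.
have h2 : (N'.+1 - d)%:R * A <= ((1 + e) * (N'.+1 - d)%:R) * (1 + e) * M * Bs.
  apply: le_trans h1 _; rewrite ler_wpM2r// ler_wpM2r//.
  by apply: ler_pM; rewrite ?exprn_ge0// ltW.
rewrite -(ler_pM2l Nd0); apply: le_trans h2 _.
by rewrite le_eqVlt; apply/orP; left; apply/eqP; ring.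
Qed.
End polynomial_matrices.

Section ell2_forms.
Variables (R : realType) (H : hilbertType R) (n : nat).

Lemma ell2_coordD (i : 'I_n) (x y : ell2_sum H n) :
  ell2_coord i (x + y) = ell2_coord i x + ell2_coord i y.
Proof. by rewrite /ell2_coord ffunE. Qed.
Lemma ell2_coordZ (i : 'I_n) a (x : ell2_sum H n) :
  ell2_coord i (a *: x) = a *: ell2_coord i x.
Proof. by rewrite /ell2_coord ffunE. Qed.

Lemma hsq_ell2 (x : ell2_sum H n) : hsq x = \sum_i hsq (ell2_coord i x).
Proof. by rewrite /hsq /fsq -re_sum. Qed.

Definition ell2_form (b : H -> H -> R[i]) (x y : ell2_sum H n) : R[i] :=
  \sum_i b (ell2_coord i x) (ell2_coord i y).

Lemma ell2_form_psd b : psd_form b -> psd_form (ell2_form b).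
Proof.
move=> hb; split=> [y a u v|x y|x].
- rewrite /ell2_form mulr_sumr -big_split/=; apply: eq_bigr => i _.
  by rewrite ell2_coordD ell2_coordZ (psd_formDl _ _ _ hb) (psd_formZl _ _ _ hb).
- by rewrite /ell2_form rmorph_sum/=; apply: eq_bigr => i _; rewrite -psd_formC.
- by apply: sumr_ge0 => i _; case: hb.
Qed.

Lemma fsq_ell2 b x : fsq (ell2_form b) x = \sum_i fsq b (ell2_coord i x).
Proof. by rewrite /fsq /ell2_form re_sum. Qed.
End ell2_forms.

Section opnorm.
Variables (R : realType) (n : nat).

Lemma ell2_norm_sq (v : 'cV[R[i]]_n) : ell2_norm v = Num.sqrt (vsq v).
Proof.
by congr Num.sqrt; apply: eq_bigr => i _; rewrite cabsE -rmorphXn.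
Qed.

Lemma vsq_ge0 (v : 'cV[R[i]]_n) : 0 <= vsq v.
Proof. by apply: sumr_ge0 => i _; exact: sqr_ge0. Qed.

Lemma vsqZ a (v : 'cV[R[i]]_n) : vsq (a *: v) = cabs a ^+ 2 * vsq v.
Proof.
by rewrite /vsq mulr_sumr; apply: eq_bigr => i _; rewrite mxE cabsM exprMn.
Qed.

Lemma mx_opnorm_vsq (A : 'M[R[i]]_n) (B : R) : 0 <= B -> (mx_opnorm A <= B%:E)%E ->
  forall v, vsq (A *m v) <= B ^+ 2 * vsq v.
Proof.
move=> B0 AB v.
have hb w : vsq w <= 1 -> vsq (A *m w) <= B ^+ 2.
  move=> w1; have : ((ell2_norm (A *m w))%:E <= B%:E)%E.
    apply: le_trans AB; apply: ereal_sup_ubound; exists w => //=.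
    by rewrite ell2_norm_sq -sqrtr1 ler_sqrt.
  rewrite lee_fin ell2_norm_sq => h.
  rewrite -[leLHS]sqr_sqrtr ?vsq_ge0// ler_pXn2r ?nnegrE ?sqrtr_ge0//.
have [v0|v0] := eqVneq (vsq v) 0.
  have -> : v = 0.
    apply/matrixP => i j; rewrite [j]ord1 mxE; apply/eqP; rewrite -cabs_eq0.
    move/eqP: v0; rewrite psumr_eq0 => [/allP/(_ i (mem_index_enum _))|k _]; last
      exact: sqr_ge0.
    by rewrite sqrf_eq0.
  by rewrite mulmx0 /vsq !big1 ?mulr0// => i _; rewrite mxE cabs0 expr0n.
have vp : 0 < vsq v by rewrite lt_def v0 vsq_ge0.
have sp : 0 < Num.sqrt (vsq v) by rewrite sqrtr_gt0.
have := hb ((Num.sqrt (vsq v))^-1%:C%C *: v).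
rewrite -scalemxAr !vsqZ cabs_real ?invr_ge0 ?sqrtr_ge0// exprVn sqr_sqrtr ?vsq_ge0//.
rewrite mulVf ?gt_eqF// => /(_ (lexx _)).
by rewrite ler_pdivrMl// mulrC.
Qed.
End opnorm.

Section rational_matrices.
Variables (R : realType) (rho : R) (H : hilbertType R) (T : H -> H).
Hypotheses (rho1 : 1 <= rho) (Tb : bounded_op T) (Tr : (rho_radius rho T <= 1)%E).
Variables (n : nat) (F : 'M[{fraction {poly R[i]}}]_n).
Hypothesis Fp : forall i j z, closed_disc z -> ~~ ratfun_pole (F i j) z.

Let Tl : linear T := Tb.1.
Let rho0 : 0 < rho := lt_le_trans ltr01 rho1.
Let TM := power_bounded rho1 Tb Tr.

Let den_root i j (z : R[i]) : cabs z <= 1 -> ~~ root (ratfun_den (F i j)) z.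
Proof. by move=> z1; apply: Fp; rewrite /closed_disc/= cabsE -[1]/((1 : R)%:C%C)
  lecR. Qed.

Let inv_den i j : is_inverse_op (poly_op (ratfun_den (F i j)) T)
  (inv_op (poly_op (ratfun_den (F i j)) T)).
Proof.
apply: inv_opP; apply: (poly_op_invertible Tl rho0 TM) => z; exact: den_root.
Qed.

Let ratfun_op_linear i j : linear (ratfun_op (F i j) T).
Proof.
move=> a x y; rewrite /ratfun_op /=; have [[-> _] _ _] := inv_den i j.
by rewrite poly_op_linear.
Qed.

Lemma ratmx_op_linear : linear (ratmx_op F T : ell2_sum H n -> ell2_sum H n).
Proof.
move=> a x y; apply/ffunP => i; rewrite !ffunE scaler_sumr -big_split/=.
apply: eq_bigr => j _; rewrite ell2_coordD ell2_coordZ.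
exact: ratfun_op_linear.
Qed.

Lemma ratmx_contractive_form (B mu : R) : 0 <= B -> B < mu ->
  (forall z, open_disc z -> (mx_opnorm (ratmx_eval F z) <= B%:E)%E) ->
  exists b : H -> H -> R[i], [/\ psd_form b,
    forall x, rho^-1 ^+ 2 * hsq x <= fsq b x <= hsq x &
    forall x : ell2_sum H n,
      fsq (ell2_form b) (ratmx_op F T x) <= mu ^+ 2 * fsq (ell2_form b) x].
Proof.
move=> B0 Bmu FB.
have mu0 : 0 < mu by exact: le_lt_trans Bmu.
have q0 : 0 < mu ^+ 2 - B ^+ 2 by rewrite subr_gt0 ltr_pXn2r ?nnegrE// ltW.
have w0 : 0 < 15 * B ^+ 2 + 2 * mu ^+ 2.
  by rewrite ltr_wpDl ?mulr_ge0 ?sqr_ge0// mulr_gt0// exprn_gt0.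
(* Chosen so that (1 + 15 e) B^2 <= (1 - 2 e) mu^2. Here 1 + 15 e bounds (1 + e)^4, and 1 - 2 e,
   positive for e <= 1/4, is the loss from 1 - r(T) in the form [b]. *)
pose e := Num.min 4^-1 ((mu ^+ 2 - B ^+ 2) / (15 * B ^+ 2 + 2 * mu ^+ 2)).
have e0 : 0 < e by rewrite lt_min invr_gt0 ltr0n/= divr_gt0.
have e4 : e <= 4^-1 by rewrite ge_min lexx.
have ew : e * (15 * B ^+ 2 + 2 * mu ^+ 2) <= mu ^+ 2 - B ^+ 2.
  by rewrite -ler_pdivlMr// ge_min lexx orbT.
(* One factor rho pays for the power bound of T, the other for the comparison of [b] with the norm;
   what is left is b(r(T) u) <= e^2 b(u). *)
have eta0 : 0 < e / rho ^+ 2 by rewrite divr_gt0// exprn_gt0.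
have [|p [r [pr rs]]] := @approx_inverse_family R ('I_n * 'I_n)%type
    (fun ij => ratfun_den (F ij.1 ij.2)) (e / rho ^+ 2) _ eta0.
  by move=> ij z; exact: den_root.
pose G i k := ratfun_num (F i k) * p (i, k).
have GE i k x : poly_op (G i k) T x = ratfun_op (F i k) T x - poly_op r T
  (ratfun_op (F i k) T x).
  rewrite /ratfun_op /=; have [_ _ IK] := inv_den i k.
  rewrite -{1}[x]IK /G poly_opM//; set y := inv_op _ x.
  rewrite -[poly_op (p _) T _]poly_opM// mulrC (pr (i, k)).
  by rewrite poly_op_comm// poly_opB// poly_op1.
have er : e / rho ^+ 2 <= e.
  rewrite ler_pdivrMr ?exprn_gt0// ler_peMr ?(ltW e0)//.
  by rewrite exprn_ege1.
have Gz z : cabs z < 1 -> forall v, vsq ((\matrix_(i, k) (G i k).[z]) *m v) <=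
    ((1 + e) * B) ^+ 2 * vsq v.
  move=> z1 v.
  have -> : \matrix_(i, k) (G i k).[z] = (1 - r.[z]) *: ratmx_eval F z.
    apply/matrixP => i k; rewrite !mxE /G hornerM /ratfun_eval.
    have dz : (ratfun_den (F i k)).[z] != 0 by apply: den_root; exact: ltW.
    have := congr1 (horner^~ z) (pr (i, k)).
    rewrite hornerM hornerD hornerN hornerC /= => <-.
    by field.
  rewrite -scalemxAl vsqZ exprMn -[leRHS]mulrA.
  have zd : open_disc z by rewrite /open_disc/= cabsE -[1]/((1 : R)%:C%C) ltcR.
  have h := mx_opnorm_vsq B0 (FB z zd) v.
  apply: ler_pM; [exact: sqr_ge0|exact: vsq_ge0| |exact: h].
  rewrite ler_pXn2r ?nnegrE ?cabs_ge0 ?addr_ge0 ?(ltW e0)//.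
  have := cabsD 1 (- r.[z]); rewrite cabs1 cabsN => h1.
  apply: le_trans h1 _; rewrite lerD2l; apply: le_trans er.
  exact: coef_sum_le_eval rs (ltW z1).
have [L [L1 LP]] := von_neumann_poly Tl (sqr_ge0 ((1 + e) * B)) e0 Gz.
have [b [hb bb bT]] := contractive_form rho1 Tb Tr L1.
exists b; split=> // x; rewrite !fsq_ell2.
set A := \sum_i _; set Bs := \sum_k _.
have Bs0 : 0 <= Bs by apply: sumr_ge0 => k _; exact: fsq_ge0.
have := LP b hb bT (fun k => ell2_coord k x).
have low : (1 - 2 * e) * A <= \sum_i fsq b (\sum_k poly_op (G i k) T (ell2_coord
  k x)).
  rewrite mulr_sumr; apply: ler_sum => i _.
  pose u := ell2_coord i (ratmx_op F T x).
  have -> : \sum_k poly_op (G i k) T (ell2_coord k x) = u - poly_op r T u.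
    rewrite /u /ell2_coord ffunE (op_lin_sum (poly_op_linear Tl r)) -sumrB.
    by apply: eq_bigr => k _; rewrite GE.
  rewrite -/u; set w := poly_op r T u.
  have wu : fsq b w <= e ^+ 2 * fsq b u.
    have /andP[_ h1] := bb w; have /andP[h2 _] := bb u.
    apply: le_trans h1 _; rewrite hsqE.
    have h3 := coef_sum_le_op u Tl TM rs (ltW rho0).
    have h4 : e / rho ^+ 2 * rho = e * rho^-1 by field; rewrite gt_eqF.
    rewrite h4 in h3.
    apply: (@le_trans _ _ ((e * rho^-1 * hnorm u) ^+ 2)).
      by rewrite ler_pXn2r ?nnegrE ?hnorm_ge0 ?mulr_ge0 ?hnorm_ge0 ?invr_ge0
        ?(ltW e0) ?(ltW rho0).
    rewrite !exprMn -hsqE -mulrA ler_wpM2l ?sqr_ge0//.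
  have h5 : re (b u w) <= e * fsq b u.
    apply: le_trans (re_le_cabs _) _.
    rewrite -(@ler_pXn2r _ 2) ?nnegrE ?cabs_ge0 ?mulr_ge0 ?fsq_ge0 ?(ltW e0)//.
    apply: le_trans (psd_CS hb _ _) _.
    rewrite exprMn [X in _ <= _ * X]expr2 mulrA [_ * fsq b u * _]mulrC.
    by rewrite ler_wpM2l ?fsq_ge0.
  rewrite fsqB//; have := fsq_ge0 hb w; lra.
move=> up; have {low up} := le_trans low up.
rewrite exprMn => h.
have e1 : e <= 1 by apply: le_trans e4 _; rewrite invf_le1// ler1n.
have E4 : (1 + e) ^+ 2 * ((1 + e) ^+ 2 * B ^+ 2) <= (1 + 15 * e) * B ^+ 2.
  rewrite mulrA ler_wpM2r ?sqr_ge0//.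
  have := e0; nra.
have c0 : 0 < 1 - 2 * e by lra.
rewrite -(ler_pM2l c0); apply: le_trans h _.
rewrite [leRHS]mulrA ler_wpM2r//; apply: le_trans E4 _.
move: (B ^+ 2) (mu ^+ 2) ew => B2 m2; lra.
Qed.
End rational_matrices.

(** * The constant, and the final estimate *)

Lemma dilation_constant (R : realType) (rho : R) (C := ((rho ^+ 2 + 1 +
    (rho - 1) * Num.sqrt (5 * rho ^+ 2 + 2 * rho + 1)) / (2 * rho ^+ 2))) :
  1 <= rho -> 1 <= C /\ C ^+ 2 - (1 + rho^-1 ^+ 2) * C = 1 - 2 * rho^-1.
Proof.
move=> rho1; have rho0 : 0 < rho := lt_le_trans ltr01 rho1.
have q0 : 0 <= 5 * rho ^+ 2 + 2 * rho + 1.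
  by rewrite !addr_ge0 ?mulr_ge0 ?sqr_ge0 ?ltW.
pose s := Num.sqrt (5 * rho ^+ 2 + 2 * rho + 1).
have sE : s ^+ 2 = 5 * rho ^+ 2 + 2 * rho + 1 by rewrite sqr_sqrtr.
(* This gives C >= 1, because rho^2 + 1 + (rho - 1) (rho + 1) = 2 rho^2. *)
have sl : rho + 1 <= s.
  rewrite -(@ler_pXn2r _ 2) ?nnegrE ?sqrtr_ge0 ?addr_ge0 ?(ltW rho0)// sE.
  by have := sqr_ge0 rho; nra.
split.
  rewrite /C ler_pdivlMr ?mulr_gt0 ?exprn_gt0// mul1r -/s.
  by have := sqr_ge0 rho; nra.
apply/eqP; rewrite -subr_eq0 /C -/s; apply/eqP.
transitivity ((rho - 1) ^+ 2 * (s ^+ 2 - (5 * rho ^+ 2 + 2 * rho + 1)) / (4 * rho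
  ^+ 4)).
  by field; rewrite gt_eqF.
by rewrite sE subrr mulr0 mul0r.
Qed.

Theorem theorem5p2 (R : realType) (rho : R) (H : hilbertType R) (T : H -> H) :
  1 <= rho ->
  bounded_op T ->
  (rho_radius rho T <= 1)%E ->
  complete_rho_disc
    ((rho ^+ 2 + 1 + (rho - 1) * Num.sqrt (5 * rho ^+ 2 + 2 * rho + 1))
      / (2 * rho ^+ 2))
    rho T.
Proof.
move=> rho1 Tb Tr; have [C1 CE] := dilation_constant rho1.
set C := (X in complete_rho_disc X); rewrite -/C in C1 CE.
have rho0 : 0 < rho := lt_le_trans ltr01 rho1.
have C0 : 0 < C := lt_le_trans ltr01 C1.
have TM := power_bounded rho1 Tb Tr.
split=> //; first exact: spectrum_closed_disc Tb.1 rho0 TM.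
move=> n F n0 Fp; set s := ereal_sup _.
have s_ub z : open_disc z -> (mx_opnorm (ratmx_eval F z) <= s)%E.
  by move=> zd; apply: ereal_sup_ubound; exists z.
have s0 : (0 <= s)%E.
  have od0 : open_disc (0 : R[i]) by rewrite /open_disc/= normr0.
  apply: le_trans (s_ub 0 od0); apply: ereal_sup_ubound; exists 0 => /=.
    by rewrite ell2_norm_sq /vsq big1 ?sqrtr0// => i _; rewrite mxE cabs0 expr0n.
  by rewrite mulmx0 ell2_norm_sq /vsq big1 ?sqrtr0// => i _; rewrite mxE cabs0 expr0n.
(* An infinite supremum makes the bound trivial, as C > 0; the value -oo is excluded by [s0]. *)
case: s s0 s_ub => [B| |] s0 s_ub; last 2 first.
- by rewrite gt0_muley ?lte_fin// leey.
- by rewrite leeNy_eq in s0.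
rewrite -EFinM; apply/lee_addgt0Pr => e e0; rewrite -EFinD.
rewrite lee_fin in s0.
(* The slack [e] keeps [lam] positive even for B = 0 and gives the strict B < lam / C. With mu = lam
   / C, the operator F(T) / lam contracts [b] by the factor 1 / C, as [toeplitz_positivity]
   requires. *)
pose lam := C * B + e.
have lam0 : 0 < lam by rewrite ltr_wpDl// mulr_ge0// ltW.
have Bmu : B < lam / C by rewrite ltr_pdivlMr// mulrC ltrDl.
have [b [hb bb bF]] := ratmx_contractive_form rho1 Tb Tr Fp s0 Bmu s_ub.
apply: ereal_inf_lbound; exists lam => //; split=> //.
pose S (x : ell2_sum H n) : ell2_sum H n := lam%:C%C^-1 *: ratmx_op F T x.
have Sl : linear S.
  by move=> a x y; rewrite /S (ratmx_op_linear rho1 Tb Tr Fp) scalerDr !scalerA mulrC.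
rewrite -[rho]invrK; apply: (@toeplitz_rho_class _ _ S rho^-1 Sl); last by
  rewrite invr_gt0.
have t01 : 0 < rho^-1 <= 1 by rewrite invr_gt0 rho0 invf_le1.
apply: (toeplitz_positivity Sl (ell2_form_psd n hb) t01 C1 CE).
- move=> x; rewrite hsq_ell2 fsq_ell2 mulr_sumr; apply: ler_sum => i _.
  by case/andP: (bb (ell2_coord i x)).
- move=> x; rewrite hsq_ell2 fsq_ell2; apply: ler_sum => i _.
  by case/andP: (bb (ell2_coord i x)).
move=> x; have hb' := ell2_form_psd n hb.
rewrite /S -fmorphV fsqZr// mulrA -exprMn.
apply: le_trans (ler_wpM2l (sqr_ge0 _) (bF x)) _.
rewrite mulrA -exprMn (_ : C / lam * (lam / C) = 1) ?expr1n ?mul1r//.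
by field; rewrite !gt_eqF.
Qed.
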